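(* Assume $\Delta=\sum_{j=1}^q B_j-\sum_{k=1}^p A_k=0$ and $\mu=-m$ for some $m\in\mathbb{N}_0$. Let $\gamma=-\min_{1\le k\le p}(a_k/A_k)$. Then the Mellin transform of the H function exists in the half-plane $\Re s>\gamma$ and $$\int_0^\rho H_{q,p}^{p,0}\left(x \,\middle|\, \begin{array}{c}(\mathbf{B},\mathbf{b})\\(\mathbf{A},\mathbf{a})\end{array}\right)x^{s-1}\,dx=\frac{\prod_{k=1}^p\Gamma(A_ks+a_k)}{\prod_{j=1}^q\Gamma(B_js+b_j)}-\nu\rho^s\sum_{k=0}^m l_{m-k}s^k,\qquad \Re s>\gamma.$$
   Context: Let $p,q\in\mathbb{N}$, $\mathbf{A}=(A_1,\dots,A_p)$, $\mathbf{B}=(B_1,\dots,B_q)$ have positive entries and $\mathbf{a}=(a_1,\dots,a_p)$, $\mathbf{b}=(b_1,\dots,b_q)$ be real vectors. Define $\rho=\prod_{k=1}^pA_k^{A_k}\prod_{j=1}^qB_j^{-B_j}$, $\mu=\sum_{j=1}^q b_j-\sum_{k=1}^p a_k+\frac{p-q}{2}$, and $\nu=(2\pi)^{(p-q)/2}\prod_{k=1}^pA_k^{a_k-1/2}\prod_{j=1}^qB_j^{1/2-b_j}$. For $0<x<\rho$ Fox's H function is $$H_{q,p}^{p,0}\left(x \,\middle|\, \begin{array}{c}(\mathbf{B},\mathbf{b})\\(\mathbf{A},\mathbf{a})\end{array}\right)=\frac{1}{2\pi i}\int_{\mathcal{L}_{-\infty}}\frac{\prod_{k=1}^p\Gamma(A_ks+a_k)}{\prod_{j=1}^q\Gamma(B_js+b_j)}x^{-s}\,ds,$$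 where $\mathcal{L}_{-\infty}$ is a loop lying in a horizontal strip, starting at $-\infty+i\varphi_1$ and ending at $-\infty+i\varphi_2$ ($\varphi_1<\varphi_2$), leaving all poles of the integrand on its left. Bernoulli polynomials $\mathcal{B}_n(a)$: $\frac{te^{at}}{e^t-1}=\sum_{n\ge0}\mathcal{B}_n(a)\frac{t^n}{n!}$. The numbers $l_r$: $l_0=1$, $l_r=\frac1r\sum_{m'=1}^r q_{m'} l_{r-m'}$ for $r\ge1$, where $q_{m'}=\frac{(-1)^{m'+1}}{m'+1}\Big[\sum_{k=1}^p\frac{\mathcal{B}_{m'+1}(a_k)}{A_k^{m'}}-\sum_{j=1}^q\frac{\mathcal{B}_{m'+1}(b_j)}{B_j^{m'}}\Big]$. *)

(* Defs.v *)
From Stdlib Require Import Reals Lra List Factorial.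
From Coquelicot Require Import Coquelicot.
Open Scope R_scope.

Fixpoint rsum (n : nat) (f : nat -> R) : R :=
  match n with O => 0 | S n' => rsum n' f + f n' end.
Fixpoint rprod (n : nat) (f : nat -> R) : R :=
  match n with O => 1 | S n' => rprod n' f * f n' end.
Fixpoint csum (n : nat) (f : nat -> C) : C :=
  match n with O => RtoC 0 | S n' => Cplus (csum n' f) (f n') end.
Fixpoint cprod (n : nat) (f : nat -> C) : C :=
  match n with O => RtoC 1 | S n' => Cmult (cprod n' f) (f n') end.

Fixpoint rmin_upto (n : nat) (f : nat -> R) : R :=
  match n with O => f O | S n' => Rmin (rmin_upto n' f) (f n) end.

Definition cexp (z : C) : C :=
  (exp (Re z) * cos (Im z), exp (Re z) * sin (Im z)).
Definition cpow (x : R) (z : C) : C := cexp (Cmult z (RtoC (ln x))).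

(* ---------- Euler's Gamma function on C (Gauss limit formula) ----------
   Gamma z = lim_{n -> oo} n^z n! / (z (z+1) ... (z+n)),
   valid for z not in {0,-1,-2,...}. *)
Definition gauss_seq (z : C) (n : nat) : C :=
  Cdiv (Cmult (cpow (INR n) z) (RtoC (INR (fact n))))
       (cprod (S n) (fun k => Cplus z (RtoC (INR k)))).
Definition CGamma (z : C) : C :=
  @lim C_R_CompleteNormedModule (filtermap (gauss_seq z) eventually).

(* ---------- Bernoulli polynomials via the generating function ----------
   t e^{a t}/(e^t - 1) = sum_n B_n(a) t^n / n!, i.e. B_n(a) is the n-th
   derivative at 0 of the (continuously extended) generating function. *)
Definition bern_gen (a : R) (t : R) : R :=
  if Req_EM_T t 0 then 1 else t * exp (a * t) / (exp t - 1).
Definition bernoulli_poly (n : nat) (a : R) : R := Derive_n (bern_gen a) n 0.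

Section HData.
(* data: p, q, A = (A_0..A_{p-1}), a, B = (B_0..B_{q-1}), b *)
Variables (p q : nat) (A a B b : nat -> R).

Definition rhoH : R :=
  rprod p (fun k => Rpower (A k) (A k)) * rprod q (fun j => Rpower (B j) (- B j)).
Definition muH : R := rsum q b - rsum p a + (INR p - INR q) / 2.
Definition nuH : R :=
  Rpower (2 * PI) ((INR p - INR q) / 2)
  * rprod p (fun k => Rpower (A k) (a k - 1/2))
  * rprod q (fun j => Rpower (B j) (1/2 - b j)).
Definition DeltaH : R := rsum q B - rsum p A.
Definition gammaH : R := - rmin_upto (pred p) (fun k => a k / A k).

Definition qcoef (m' : nat) : R :=
  (-1) ^ (S m') / INR (S m') *
  (rsum p (fun k => bernoulli_poly (S m') (a k) / (A k) ^ m')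
   - rsum q (fun j => bernoulli_poly (S m') (b j) / (B j) ^ m')).

(* lrev r = [l_r; l_{r-1}; ...; l_0] *)
Fixpoint lrev (r : nat) : list R :=
  match r with
  | O => 1 :: nil
  | S r' => let prev := lrev r' in
      (/ INR (S r') * rsum (S r') (fun i => qcoef (S i) * nth i prev 0)) :: prev
  end.
Definition lcoef (r : nat) : R := hd 0 (lrev r).

Definition GH (s : C) : C :=
  Cdiv (cprod p (fun k => CGamma (Cplus (Cmult (RtoC (A k)) s) (RtoC (a k)))))
       (cprod q (fun j => CGamma (Cplus (Cmult (RtoC (B j)) s) (RtoC (b j))))).

Definition Hintegrand (x : R) (s : C) : C := Cmult (GH s) (cpow x (Copp s)).

(* Contour L_{-oo}: the loop starting at -oo - i, running along Im s = -1 to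
   c - i, up the segment Re s = c to c + i, and back along Im s = 1 to -oo + i,
   with c = gammaH + 1 (all poles of GH are real and <= gammaH, so they lie on
   the left of this loop). *)
Definition Hfox (x : R) : C :=
  let c := gammaH + 1 in
  let low := @RInt_gen C_R_CompleteNormedModule
               (fun t => Hintegrand x (t, -1)) (Rbar_locally m_infty) (at_point c) in
  let up := @RInt_gen C_R_CompleteNormedModule
               (fun t => Hintegrand x (t, 1)) (Rbar_locally m_infty) (at_point c) in
  let vert := @RInt C_R_CompleteNormedModule
               (fun y => Cmult (Hintegrand x (c, y)) (0, 1)) (-1) 1 in
  Cmult (Cinv (Cmult (RtoC (2 * PI)) (0, 1))) (Cminus (Cplus low vert) up).
End HData.

(* Main.v *)
Require Import Defs.
From Stdlib Require Import Reals Lra Lia List Factorial.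
From Coquelicot Require Import Coquelicot.
Open Scope R_scope.

(** Proof idea.  For [0 < x < rho] the loop may be deformed freely in the region
    where the Gamma quotient [G] is holomorphic, since on [|Im t| >= 1] one has
    [|G t| <= C rho^(Re t) |t|^m].  Hence for [r < rho]
    [int_0^r H(x) x^(s-1) dx = (1 / 2 pi i) int_L G(t) r^(s-t) / (s-t) dt]
    with [s] on the right of [L].  In this integral [G] may be replaced by
    [G - E], where [E(t) = nu rho^t sum_k l_(m-k) t^k] is entire.  Moving [L]
    across [s] to the loop bounded by [Im t = -h], [Re t = h], [Im t = h] picks up the
    residue [G(s) - E(s)], which is the claimed value.  With [r = rho e^(-1/h)] the
    remaining integral is [O(1/h)], because on that loop
    [|G(t) - E(t)| <= C rho^(Re t) (|t| / h)^m / h].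

    The last bound is Stirling's expansion of [ln Gamma (z + a)] with a remainder
    that is [O(|Im z|^(-N))] uniformly in [Re z], which is available even for
    [Re z -> -oo], so that no reflection formula is needed: if [F] is the truncated
    Stirling series, then [F(z+1) - F(z) - ln (z+a) = O(|z|^(-N-2))], and summing over
    [z, z+1, z+2, ...] in Gauss's limit formula turns this into the expansion.
    Wallis's product supplies the constant [ln (2 pi) / 2]. *)

(** * Complex-valued functions of a real variable *)

(** The loop converges because [x < rho], but its convergence degenerates as [x] tends to [rho];
    hence the coupling of [r] with the size [h] of the large loop.

    [E] collects the nonnegative powers of [t] in the expansion of [G / (nu rho^t)] in decreasing
    powers of [t]. It is entire and decays to the left against [r^(s-t)], so by Cauchy's theorem it
    adds nothing to the loop integral in the limit. The count behind [O(1/h)]: the bound on [G - E]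
    gains one factor [1/h], the kernel [1 / (s - t)] a second one, and the effective length of the
    large loop is of order [h], because the integrand decays like a power of [e^(Re t / h)] to the
    left.

    The loop integral and the integral over [x] are exchanged without Fubini: a truncated loop
    integral is differentiated in its parameter [r], and the truncation is removed by uniform
    convergence. *)

Lemma C_ext (z w : C) : fst z = fst w -> snd z = snd w -> z = w.
Proof. destruct z, w; simpl; intros -> ->; reflexivity. Qed.

Lemma Cmod_le_abs (z : C) : Cmod z <= Rabs (fst z) + Rabs (snd z).
Proof.
  unfold Cmod. rewrite <- (sqrt_pow2 (Rabs (fst z) + Rabs (snd z))).
  2: generalize (Rabs_pos (fst z)) (Rabs_pos (snd z)); lra.
  apply sqrt_le_1_alt. rewrite <- (pow2_abs (fst z)), <- (pow2_abs (snd z)).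
  generalize (Rabs_pos (fst z)) (Rabs_pos (snd z)). intros. nra.
Qed.

Lemma abs_fst_le (z : C) : Rabs (fst z) <= Cmod z.
Proof. eapply Rle_trans; [apply Rmax_l | apply (Rmax_Cmod z)]. Qed.

Lemma abs_snd_le (z : C) : Rabs (snd z) <= Cmod z.
Proof. eapply Rle_trans; [apply Rmax_r | apply (Rmax_Cmod z)]. Qed.

Lemma Cmod_norm_R (z : C) : @norm R_AbsRing C_R_NormedModule z = Cmod z.
Proof.
  unfold norm; simpl. unfold prod_norm, norm; simpl. unfold abs; simpl. unfold Cmod.
  f_equal. rewrite <- (pow2_abs (fst z)), <- (pow2_abs (snd z)). simpl. ring.
Qed.

Lemma Cmod_sqr (z : C) : Cmod z ^ 2 = fst z ^ 2 + snd z ^ 2.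
Proof. unfold Cmod. rewrite pow2_sqrt; [reflexivity | nra]. Qed.

Lemma Cmod_sub_sym (z w : C) : Cmod (z - w) = Cmod (w - z).
Proof. rewrite <- Cmod_opp. f_equal. ring. Qed.

Lemma Cmod_triangle_sub (z w : C) : Cmod (z - w) <= Cmod z + Cmod w.
Proof. unfold Cminus. eapply Rle_trans; [apply Cmod_triangle|]. rewrite Cmod_opp. lra. Qed.

Lemma Cmod_triangle_rev (z w : C) : Cmod z - Cmod w <= Cmod (z + w).
Proof.
  assert (Cmod z <= Cmod (z + w) + Cmod w); [|lra].
  replace z with ((z + w) - w)%C at 1 by ring. apply Cmod_triangle_sub.
Qed.

(** With the value [0] at [0], the rules for inverses hold without nonvanishing hypotheses. This is
    what later lets the reciprocal of Gamma be handled at the poles. *)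
Lemma Cinv_0 : Cinv 0 = 0.
Proof. unfold Cinv; simpl. apply C_ext; simpl; unfold Rdiv; ring. Qed.

Lemma Cmod_inv_tot (z : C) : Cmod (/ z) = / Cmod z.
Proof.
  destruct (Ceq_dec z 0) as [->|H]; [|apply Cmod_inv; auto].
  rewrite Cinv_0, Cmod_0, Rinv_0. reflexivity.
Qed.

Lemma Cinv_mult_tot (z w : C) : (/ (z * w) = / z * / w)%C.
Proof.
  destruct (Ceq_dec z 0) as [->|H]; [rewrite Cmult_0_l, Cinv_0; ring|].
  destruct (Ceq_dec w 0) as [->|H']; [rewrite Cmult_0_r, Cinv_0; ring|].
  field; auto.
Qed.

Lemma Cinv_inv_tot (z : C) : (/ / z = z)%C.
Proof.
  destruct (Ceq_dec z 0) as [->|H]; [rewrite !Cinv_0; reflexivity|].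
  field; auto.
Qed.

Definition dC (f : R -> C) (x : R) (l : C) : Prop :=
  is_derive (fun t => fst (f t)) x (fst l) /\ is_derive (fun t => snd (f t)) x (snd l).
Definition contC {U : UniformSpace} (f : U -> C) (x : U) : Prop :=
  continuous (fun t => fst (f t)) x /\ continuous (fun t => snd (f t)) x.

Lemma dC_eq (f : R -> C) (x : R) (l l' : C) : l = l' -> dC f x l -> dC f x l'.
Proof. intros ->; auto. Qed.

Lemma dC_ext_loc (f g : R -> C) (x : R) (l : C) :
  locally x (fun t => f t = g t) -> dC f x l -> dC g x l.
Proof.
  intros H [H1 H2]; split.
  - apply (is_derive_ext_loc (fun t => fst (f t))); auto.
    apply filter_imp with (2 := H). intros t ->; reflexivity.
  - apply (is_derive_ext_loc (fun t => snd (f t))); auto.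
    apply filter_imp with (2 := H). intros t ->; reflexivity.
Qed.

Lemma dC_ext (f g : R -> C) (x : R) (l : C) :
  (forall t, f t = g t) -> dC f x l -> dC g x l.
Proof. intros H; apply dC_ext_loc. apply filter_forall; auto. Qed.

Lemma dC_const (c : C) (x : R) : dC (fun _ => c) x 0.
Proof. split; simpl; apply @is_derive_const. Qed.

Lemma dC_id (x : R) : dC (fun t => RtoC t) x 1.
Proof. split; simpl; [apply @is_derive_id | apply @is_derive_const]. Qed.

Lemma dC_plus (f g : R -> C) (x : R) (l m : C) :
  dC f x l -> dC g x m -> dC (fun t => f t + g t)%C x (l + m).
Proof. intros [] []; split; simpl; apply @is_derive_plus; assumption. Qed.

Lemma dC_opp (f : R -> C) (x : R) (l : C) : dC f x l -> dC (fun t => - f t)%C x (- l).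
Proof. intros []; split; simpl; apply @is_derive_opp; assumption. Qed.

Lemma dC_minus (f g : R -> C) (x : R) (l m : C) :
  dC f x l -> dC g x m -> dC (fun t => f t - g t)%C x (l - m).
Proof. intros; apply dC_plus; auto. apply dC_opp; auto. Qed.

Lemma is_derive_Rmult (f g : R -> R) (x df dg : R) :
  is_derive f x df -> is_derive g x dg ->
  is_derive (fun t => f t * g t) x (df * g x + f x * dg).
Proof.
  intros Hf Hg. apply (is_derive_mult f g x df dg Hf Hg). intros; apply Rmult_comm.
Qed.

Lemma dC_mult (f g : R -> C) (x : R) (l m : C) :
  dC f x l -> dC g x m -> dC (fun t => f t * g t)%C x (l * g x + f x * m).
Proof.
  intros [a1 a2] [b1 b2]; split; simpl.
  - evar_last; [apply @is_derive_minus; apply is_derive_Rmult; eassumption|].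
    unfold minus, plus, opp; simpl; ring.
  - evar_last; [apply @is_derive_plus; apply is_derive_Rmult; eassumption|].
    unfold plus; simpl; ring.
Qed.

Lemma dC_scal (c : C) (f : R -> C) (x : R) (l : C) :
  dC f x l -> dC (fun t => c * f t)%C x (c * l).
Proof.
  intros H. eapply dC_eq; [|apply dC_mult; [apply dC_const|eassumption]]. cbv beta; ring.
Qed.

Lemma Csqr_pos (z : C) : z <> 0 -> 0 < fst z ^ 2 + snd z ^ 2.
Proof.
  intros H. rewrite <- Cmod_sqr. apply pow_lt. apply Cmod_gt_0; auto.
Qed.

Lemma dC_inv (f : R -> C) (x : R) (l : C) :
  f x <> 0 -> dC f x l -> dC (fun t => / f t)%C x (- (l / (f x * f x)))%C.
Proof.
  intros H0 [a1 a2]. assert (Hp := Csqr_pos _ H0).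
  assert (Hd : is_derive (fun t => fst (f t) ^ 2 + snd (f t) ^ 2) x
      (2 * (fst (f x) * fst l + snd (f x) * snd l))).
  { evar_last; [apply @is_derive_plus; apply is_derive_pow; eassumption|].
    unfold plus; simpl; ring. }
  destruct (f x) as [u v] eqn:E. destruct l as [u' v']. simpl in *.
  split; simpl.
  - evar_last; [apply is_derive_div; [apply a1|apply Hd|rewrite E; simpl; lra]|].
    cbv beta; rewrite E; simpl. field. split; nra.
  - evar_last; [apply is_derive_div; [apply @is_derive_opp; apply a2|apply Hd|rewrite E; simpl; lra]|].
    unfold opp; simpl. cbv beta; rewrite E; simpl. field. split; nra.
Qed.

Lemma dC_comp (f : R -> C) (g : R -> R) (x : R) (l : C) (d : R) :
  dC f (g x) l -> is_derive g x d -> dC (fun t => f (g t)) x (RtoC d * l).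
Proof.
  intros [a1 a2] b; split; simpl.
  - evar_last; [apply (is_derive_comp (fun t => fst (f t)) g); eassumption|].
    unfold scal; simpl; unfold mult; simpl; ring.
  - evar_last; [apply (is_derive_comp (fun t => snd (f t)) g); eassumption|].
    unfold scal; simpl; unfold mult; simpl; ring.
Qed.

Lemma dC_cexp (f : R -> C) (x : R) (l : C) :
  dC f x l -> dC (fun t => cexp (f t)) x (l * cexp (f x)).
Proof.
  intros [a1 a2]; split; unfold cexp, Re, Im; simpl.
  - evar_last.
    + apply is_derive_Rmult.
      * apply (is_derive_comp exp (fun t => fst (f t))); [apply is_derive_exp|eassumption].
      * apply (is_derive_comp cos (fun t => snd (f t))); [apply is_derive_cos|eassumption].
    + unfold scal; simpl; unfold mult; simpl; ring.
  - evar_last.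
    + apply is_derive_Rmult.
      * apply (is_derive_comp exp (fun t => fst (f t))); [apply is_derive_exp|eassumption].
      * apply (is_derive_comp sin (fun t => snd (f t))); [apply is_derive_sin|eassumption].
    + unfold scal; simpl; unfold mult; simpl; ring.
Qed.

Lemma dC_pow (f : R -> C) (x : R) (l : C) (n : nat) :
  dC f x l -> dC (fun t => Cpow (f t) (S n)) x (RtoC (INR (S n)) * l * Cpow (f x) n).
Proof.
  intros H. induction n as [|n IH].
  - apply dC_ext with f. { intros; simpl; ring. }
    eapply dC_eq; [|apply H]. simpl. ring.
  - eapply dC_ext; [intros; symmetry; apply Cpow_S|].
    eapply dC_eq; [|apply dC_mult; [apply H|apply IH]].
    rewrite (S_INR (S n)), RtoC_plus. simpl Cpow. ring.
Qed.

Lemma dC_csum (n : nat) (f : nat -> R -> C) (l : nat -> C) (x : R) :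
  (forall k, (k < n)%nat -> dC (f k) x (l k)) ->
  dC (fun t => csum n (fun k => f k t)) x (csum n l).
Proof.
  intros H. induction n as [|n IH]; simpl.
  - apply dC_const.
  - apply dC_plus; auto.
Qed.

Lemma dC_contC (f : R -> C) (x : R) (l : C) : dC f x l -> contC f x.
Proof.
  intros [a b]; split.
  - apply (ex_derive_continuous (fun t => fst (f t))). eexists; eassumption.
  - apply (ex_derive_continuous (fun t => snd (f t))). eexists; eassumption.
Qed.

Section Cont.
Context {U : UniformSpace}.
Implicit Types (f g : U -> C) (x : U).
Lemma contC_ext_loc f g x :
  locally x (fun t => f t = g t) -> contC f x -> contC g x.
Proof.
  intros H [a b]; split.
  - eapply continuous_ext_loc; [|apply a]. apply filter_imp with (2 := H). intros t ->; reflexivity.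
  - eapply continuous_ext_loc; [|apply b]. apply filter_imp with (2 := H). intros t ->; reflexivity.
Qed.

Lemma contC_ext f g x : (forall t, f t = g t) -> contC f x -> contC g x.
Proof. intros H; apply contC_ext_loc. apply filter_forall; auto. Qed.

Lemma contC_const (c : C) x : contC (fun _ => c) x.
Proof. split; apply continuous_const. Qed.

Lemma contC_RtoC (h : U -> R) x : continuous h x -> contC (fun t => RtoC (h t)) x.
Proof. intros H; split; simpl; [apply H| apply continuous_const]. Qed.

Lemma contC_plus f g x : contC f x -> contC g x -> contC (fun t => f t + g t)%C x.
Proof. intros [] []; split; simpl; apply @continuous_plus; assumption. Qed.

Lemma contC_opp f x : contC f x -> contC (fun t => - f t)%C x.
Proof. intros []; split; simpl; apply @continuous_opp; assumption. Qed.

Lemma contC_minus f g x : contC f x -> contC g x -> contC (fun t => f t - g t)%C x.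
Proof. intros; apply contC_plus; auto. apply contC_opp; auto. Qed.

Lemma continuous_Rmult (f g : U -> R) x :
  continuous f x -> continuous g x -> continuous (fun t => f t * g t) x.
Proof. intros. apply (continuous_mult f g x); auto. Qed.

Lemma contC_mult f g x : contC f x -> contC g x -> contC (fun t => f t * g t)%C x.
Proof.
  intros [] []; split; simpl.
  - apply (continuous_minus (fun t => fst (f t) * fst (g t)) (fun t => snd (f t) * snd (g t)));
    apply continuous_Rmult; auto.
  - apply (continuous_plus (fun t => fst (f t) * snd (g t)) (fun t => snd (f t) * fst (g t)));
    apply continuous_Rmult; auto.
Qed.

Lemma continuous_Rinv_comp (h : U -> R) x : h x <> 0 -> continuous h x -> continuous (fun t => / h t) x.
Proof.
  intros H0 H. apply (continuous_comp h Rinv); auto. apply continuous_Rinv; auto.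
Qed.

Lemma contC_inv f x : f x <> 0 -> contC f x -> contC (fun t => / f t)%C x.
Proof.
  intros H0 [a b]. assert (Hp := Csqr_pos _ H0).
  assert (Hc : continuous (fun t => / (fst (f t) ^ 2 + snd (f t) ^ 2)) x).
  { apply continuous_Rinv_comp; [lra|].
    apply (continuous_plus (fun t => fst (f t) ^ 2) (fun t => snd (f t) ^ 2)).
    - apply continuous_ext with (fun t => fst (f t) * fst (f t)). { intros; simpl; ring. }
      apply continuous_Rmult; auto.
    - apply continuous_ext with (fun t => snd (f t) * snd (f t)). { intros; simpl; ring. }
      apply continuous_Rmult; auto. }
  split; simpl; apply continuous_Rmult; auto.
  apply (continuous_opp (fun t => snd (f t))); auto.
Qed.

Lemma contC_cexp f x : contC f x -> contC (fun t => cexp (f t)) x.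
Proof.
  intros [a b]; split; unfold cexp, Re, Im; simpl; apply continuous_Rmult.
  - apply (continuous_comp (fun t => fst (f t)) exp); auto. apply continuous_exp.
  - apply (continuous_comp (fun t => snd (f t)) cos); auto. apply continuous_cos.
  - apply (continuous_comp (fun t => fst (f t)) exp); auto. apply continuous_exp.
  - apply (continuous_comp (fun t => snd (f t)) sin); auto. apply continuous_sin.
Qed.

Lemma contC_continuous f x : contC f x <-> continuous (U := C_UniformSpace) f x.
Proof.
  split.
  - intros [a b]. apply continuous_ext with (fun t => (fst (f t), snd (f t))).
    { intros t; destruct (f t); reflexivity. }
    intros P HP.
    apply (filterlim_pair (F := locally x) (fun t => fst (f t)) (fun t => snd (f t)) a b).
    destruct HP as [eps HP].
    exists (ball (fst (f x)) eps) (ball (snd (f x)) eps).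
    + apply locally_ball. + apply locally_ball.
    + intros u v Hu Hv. apply HP. split; auto.
  - intros H; split.
    + apply (continuous_comp f (fst : C_UniformSpace -> R)); auto.
      destruct (f x); apply @continuous_fst.
    + apply (continuous_comp f (snd : C_UniformSpace -> R)); auto.
      destruct (f x); apply @continuous_snd.
Qed.
End Cont.
Lemma contC_comp {U V : UniformSpace} (f : U -> V) (g : V -> C) (x : U) :
  continuous f x -> contC g (f x) -> contC (fun t => g (f t)) x.
Proof.
  intros H [a b]; split.
  - apply (continuous_comp f (fun t => fst (g t))); auto.
  - apply (continuous_comp f (fun t => snd (g t))); auto.
Qed.

Lemma contC_compC {U : UniformSpace} (f : U -> C) (g : C_UniformSpace -> C) (x : U) :
  contC f x -> contC g (f x) -> contC (fun t => g (f t)) x.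
Proof. intros H. apply contC_continuous in H. apply (contC_comp (V := C_UniformSpace)); auto. Qed.

Lemma contC_idC (z : C_UniformSpace) : contC (fun y : C_UniformSpace => y) z.
Proof. apply contC_continuous. apply continuous_id. Qed.

(** There is no mean value equality for complex-valued functions, so the real one is applied to each
    component. This costs the factor [2], which recurs in all constants derived from it. *)
Lemma dC_bound (h dh : R -> C) (D x y : R) :
  (forall t, Rmin x y <= t <= Rmax x y -> dC h t (dh t) /\ Cmod (dh t) <= D) ->
  Cmod (h y - h x) <= 2 * D * Rabs (y - x).
Proof.
  intros H.
  assert (K : forall g dg : R -> R, (forall t, Rmin x y <= t <= Rmax x y ->
     is_derive g t (dg t) /\ Rabs (dg t) <= D) -> Rabs (g y - g x) <= D * Rabs (y - x)).
  { intros g dg Hg. destruct (MVT_gen g x y dg) as [c [Hc E]].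
    - intros t Ht. apply Hg; lra.
    - intros t Ht. apply continuity_pt_filterlim.
      apply (ex_derive_continuous g t). exists (dg t). apply Hg; lra.
    - rewrite E, Rabs_mult. apply Rmult_le_compat_r; [apply Rabs_pos|]. apply Hg; auto. }
  eapply Rle_trans; [apply Cmod_le_abs|]. simpl.
  assert (A1 : Rabs (fst (h y) - fst (h x)) <= D * Rabs (y - x)).
  { apply (K (fun t => fst (h t)) (fun t => fst (dh t))). intros t Ht.
    destruct (H t Ht) as [[a b] c]. split; auto. eapply Rle_trans; [apply abs_fst_le|auto]. }
  assert (A2 : Rabs (snd (h y) - snd (h x)) <= D * Rabs (y - x)).
  { apply (K (fun t => snd (h t)) (fun t => snd (dh t))). intros t Ht.
    destruct (H t Ht) as [[a b] c]. split; auto. eapply Rle_trans; [apply abs_snd_le|auto]. }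
  unfold Rminus in *. lra.
Qed.

(** * Integrals of complex-valued functions *)

Notation RIntC := (@RInt C_R_CompleteNormedModule).
Notation is_RIntC := (@is_RInt C_R_NormedModule).

Lemma is_RIntC_iff (f : R -> C) a b l :
  is_RIntC f a b l <->
  is_RInt (fun t => fst (f t)) a b (fst l) /\ is_RInt (fun t => snd (f t)) a b (snd l).
Proof.
  split.
  - intros H; split.
    + apply (is_RInt_fct_extend_fst (U := R_NormedModule) (V := R_NormedModule) f a b l H).
    + apply (is_RInt_fct_extend_snd (U := R_NormedModule) (V := R_NormedModule) f a b l H).
  - intros [H1 H2].
    rewrite (surjective_pairing l).
    apply (is_RInt_fct_extend_pair (U := R_NormedModule) (V := R_NormedModule)); auto.
Qed.

Lemma contC_ex (f : R -> C) a b :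
  (forall t, Rmin a b <= t <= Rmax a b -> contC f t) -> is_RIntC f a b (RIntC f a b).
Proof.
  intros H. apply (RInt_correct (V := C_R_CompleteNormedModule)).
  apply (ex_RInt_continuous (V := C_R_CompleteNormedModule)).
  intros z Hz. apply (contC_continuous f z). auto.
Qed.

Lemma is_RIntC_eq (f : R -> C) a b l : is_RIntC f a b l -> RIntC f a b = l.
Proof. apply (is_RInt_unique (V := C_R_CompleteNormedModule)). Qed.

Lemma is_RIntC_FTC (f df : R -> C) a b :
  (forall x, Rmin a b <= x <= Rmax a b -> dC f x (df x)) ->
  (forall x, Rmin a b <= x <= Rmax a b -> contC df x) ->
  is_RIntC df a b (f b - f a)%C.
Proof.
  intros H1 H2. apply is_RIntC_iff. simpl. split.
  - apply (is_RInt_derive (fun t => fst (f t)) (fun t => fst (df t))); intros;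
      [apply H1 | apply H2]; auto.
  - apply (is_RInt_derive (fun t => snd (f t)) (fun t => snd (df t))); intros;
      [apply H1 | apply H2]; auto.
Qed.

Lemma is_RIntC_scal (c : C) (f : R -> C) a b l :
  is_RIntC f a b l -> is_RIntC (fun t => c * f t)%C a b (c * l)%C.
Proof.
  rewrite !is_RIntC_iff. intros [H1 H2]. simpl. split.
  - apply (is_RInt_minus (fun t => fst c * fst (f t)) (fun t => snd c * snd (f t)));
      apply (is_RInt_scal (V := R_NormedModule)); auto.
  - apply (is_RInt_plus (fun t => fst c * snd (f t)) (fun t => snd c * fst (f t)));
      apply (is_RInt_scal (V := R_NormedModule)); auto.
Qed.

Lemma is_RIntC_plus (f g : R -> C) a b l m :
  is_RIntC f a b l -> is_RIntC g a b m -> is_RIntC (fun t => f t + g t)%C a b (l + m)%C.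
Proof. apply (is_RInt_plus (V := C_R_NormedModule)). Qed.

Lemma is_RIntC_bound (f : R -> C) (g : R -> R) a b l lg :
  a <= b -> (forall x, a <= x <= b -> Cmod (f x) <= g x) ->
  is_RIntC f a b l -> is_RInt g a b lg -> Cmod l <= lg.
Proof.
  intros Hab H Hf Hg. rewrite <- Cmod_norm_R.
  apply (norm_RInt_le (V := C_R_NormedModule) f g a b l lg); auto.
  intros x Hx. rewrite Cmod_norm_R. auto.
Qed.

Lemma is_RIntC_bound_const (f : R -> C) (M : R) a b l :
  a <= b -> (forall x, a <= x <= b -> Cmod (f x) <= M) ->
  is_RIntC f a b l -> Cmod l <= M * (b - a).
Proof.
  intros Hab H Hf. eapply is_RIntC_bound; [apply Hab|apply H|apply Hf|].
  replace (M * (b - a)) with (scal (b - a) M).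
  2: { unfold scal; simpl; unfold mult; simpl; ring. }
  apply (is_RInt_const (V := R_NormedModule)).
Qed.

Lemma is_RIntC_ext (f g : R -> C) a b l :
  (forall x, Rmin a b <= x <= Rmax a b -> f x = g x) -> is_RIntC f a b l -> is_RIntC g a b l.
Proof. intros H. apply (is_RInt_ext (V := C_R_NormedModule)). intros; apply H; lra. Qed.

(** The margin [eps] around the range of [t] is there because the derivative must agree with [df] on
    a full neighbourhood of [(x, t)], also when [t] is an end point. *)
Lemma dC_RInt_param (f df : R -> R -> C) (a b x : R) (eps : posreal) :
  (forall y t, Rabs (y - x) < eps -> Rmin a b - eps < t < Rmax a b + eps ->
     dC (fun u => f u t) y (df y t)) ->
  (forall y t, Rabs (y - x) < eps -> Rmin a b <= t <= Rmax a b -> contC (f y) t) ->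
  (forall t, Rmin a b <= t <= Rmax a b ->
     contC (U := prod_UniformSpace R_UniformSpace R_UniformSpace)
       (fun p => df (fst p) (snd p)) (x, t)) ->
  dC (fun y => RIntC (f y) a b) x (RIntC (df x) a b).
Proof.
  intros Hd Hf Hc.
  assert (Hx0 : Rabs (x - x) < eps).
  { replace (x - x) with 0 by ring. rewrite Rabs_R0. apply cond_pos. }
  assert (Hm : Rmin a b <= Rmax a b) by apply Rminmax.
  assert (Hdf : is_RIntC (df x) a b (RIntC (df x) a b)).
  { apply contC_ex. intros t Ht.
    apply (contC_comp (U := R_UniformSpace) (V := prod_UniformSpace R_UniformSpace R_UniformSpace)
      (fun v => (x, v)) (fun p => df (fst p) (snd p))).
    - intros P [e HP]. exists e. intros u Hu. apply HP. split; [apply ball_center|apply Hu].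
    - apply Hc; auto. }
  assert (Hff : forall y, Rabs (y - x) < eps -> is_RIntC (f y) a b (RIntC (f y) a b)).
  { intros y Hy. apply contC_ex. intros t Ht; apply Hf; auto. }
  assert (Hl : forall P : R -> Prop, (forall y, Rabs (y - x) < eps -> P y) -> locally x P).
  { intros P HP. exists eps. intros y Hy. apply HP. apply Hy. }
  (* [pr] stands for either of the two projections, so that the real theorem is used only once. *)
  assert (K : forall pr : C -> R,
    (forall y t, Rabs (y - x) < eps -> Rmin a b - eps < t < Rmax a b + eps ->
      is_derive (fun u => pr (f u t)) y (pr (df y t))) ->
    (forall y, Rabs (y - x) < eps ->
       is_RInt (fun t => pr (f y t)) a b (pr (RIntC (f y) a b))) ->
    is_RInt (fun t => pr (df x t)) a b (pr (RIntC (df x) a b)) ->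
    (forall t, Rmin a b <= t <= Rmax a b ->
      continuous (T := prod_UniformSpace R_UniformSpace R_UniformSpace)
       (fun p => pr (df (fst p) (snd p))) (x, t)) ->
    is_derive (fun y => pr (RIntC (f y) a b)) x (pr (RIntC (df x) a b))).
  { intros pr P1 P2 P3 P4.
    apply (is_derive_ext_loc (fun y => RInt (fun t => pr (f y t)) a b)).
    { apply Hl. intros y Hy. apply is_RInt_unique. apply P2; auto. }
    evar_last.
    - apply (is_derive_RInt_param (fun u t => pr (f u t)) a b x).
      + apply Hl. intros y Hy t Ht. eexists. apply P1; auto.
        generalize (cond_pos eps); lra.
      + intros t Ht. apply continuity_2d_pt_filterlim.
        apply (@continuous_ext_loc (prod_UniformSpace R_UniformSpace R_UniformSpace) R_UniformSpace
           (fun p : R * R => Derive (fun z => pr (f z (snd p))) (fst p))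
           (fun p : R * R => pr (df (fst p) (snd p))) (x, t)).
        2: apply P4; auto.
        exists eps. intros [y v] [Hy Hv]. simpl in *.
        symmetry. apply is_derive_unique. apply P1; [apply Hy|].
        change (Rabs (v - t) < eps) in Hv. apply Rabs_def2 in Hv. lra.
      + apply Hl. intros y Hy. eexists. apply P2; auto.
    - transitivity (RInt (fun t => pr (df x t)) a b); [|apply is_RInt_unique; auto].
      apply RInt_ext. intros t Ht. apply is_derive_unique. apply P1; auto.
      generalize (cond_pos eps); lra. }
  split; [apply (K fst)|apply (K snd)].
  - intros; apply Hd; auto.
  - intros y Hy. exact (proj1 (proj1 (is_RIntC_iff _ _ _ _) (Hff y Hy))).
  - exact (proj1 (proj1 (is_RIntC_iff _ _ _ _) Hdf)).
  - intros t Ht; exact (proj1 (Hc t Ht)).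
  - intros; apply Hd; auto.
  - intros y Hy. exact (proj2 (proj1 (is_RIntC_iff _ _ _ _) (Hff y Hy))).
  - exact (proj2 (proj1 (is_RIntC_iff _ _ _ _) Hdf)).
  - intros t Ht; exact (proj2 (Hc t Ht)).
Qed.

(** * The complex exponential and logarithm *)

Lemma cexp_plus (z w : C) : (cexp (z + w) = cexp z * cexp w)%C.
Proof.
  unfold cexp, Re, Im; simpl. rewrite exp_plus, cos_plus, sin_plus.
  apply C_ext; simpl; ring.
Qed.

Lemma cexp_0 : cexp 0 = 1.
Proof. unfold cexp, Re, Im; simpl. rewrite exp_0, cos_0, sin_0. apply C_ext; simpl; ring. Qed.

Lemma Cmod_cexp (z : C) : Cmod (cexp z) = exp (fst z).
Proof.
  unfold cexp, Cmod, Re, Im; simpl.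
  replace (_ + _) with (exp (fst z) * exp (fst z) * (Rsqr (sin (snd z)) + Rsqr (cos (snd z)))).
  2: unfold Rsqr; ring.
  rewrite sin2_cos2, Rmult_1_r. apply sqrt_square. left; apply exp_pos.
Qed.

Lemma cexp_neq_0 (z : C) : cexp z <> 0.
Proof. apply Cmod_gt_0. rewrite Cmod_cexp. apply exp_pos. Qed.

Lemma cexp_opp (z : C) : (cexp (- z) = / cexp z)%C.
Proof.
  assert (H : (cexp (- z) * cexp z = 1)%C).
  { rewrite <- cexp_plus. rewrite Cplus_comm, Cplus_opp_r. apply cexp_0. }
  assert (Hn := cexp_neq_0 z).
  replace (cexp (- z)) with (cexp (- z) * cexp z / cexp z)%C by (field; auto).
  rewrite H. unfold Cdiv. ring.
Qed.

Lemma cexp_RtoC (x : R) : cexp (RtoC x) = RtoC (exp x).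
Proof. unfold cexp, Re, Im; simpl. rewrite cos_0, sin_0. apply C_ext; simpl; ring. Qed.

(** The factor [6] is the [2] of [dC_bound] times the bound [3] for [e]. *)
Lemma cexp_sub1_bound (z : C) : Cmod z <= 1 -> Cmod (cexp z - 1) <= 6 * Cmod z.
Proof.
  intros Hz.
  assert (H : Cmod (cexp (RtoC 1 * z) - cexp (RtoC 0 * z)) <= 2 * (Cmod z * 3) * Rabs (1 - 0)).
  { apply (dC_bound (fun t => cexp (RtoC t * z)) (fun t => z * cexp (RtoC t * z))%C).
    intros t Ht. rewrite Rmin_left, Rmax_right in Ht by lra. split.
    - apply dC_cexp. eapply dC_eq; [|apply dC_mult; [apply dC_id|apply dC_const]]. cbv beta; ring.
    - rewrite Cmod_mult, Cmod_cexp. apply Rmult_le_compat_l; [apply Cmod_ge_0|].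
      eapply Rle_trans; [|apply exp_le_3].
      assert (Hle : fst (RtoC t * z)%C <= 1).
      { simpl. generalize (abs_fst_le z) (Rle_abs (fst z)). intros. nra. }
      destruct Hle as [Hl|Hl]; [left; apply exp_increasing; auto|rewrite Hl; right; auto]. }
  rewrite Cmult_1_l, Cmult_0_l, cexp_0 in H.
  replace (1 - 0) with 1 in H by ring. rewrite Rabs_R1 in H. lra.
Qed.

(** The plane cut along the ray from [0] to [-oo]. *)
Definition slit (z : C) : Prop := 0 < fst z \/ snd z <> 0.
(** The half-angle formula for the argument is smooth on all of [slit]. *)
Definition clog (z : C) : C := (ln (Cmod z), 2 * atan (snd z / (Cmod z + fst z))).

Lemma slit_neq_0 (z : C) : slit z -> z <> 0.
Proof. intros H ->. destruct H; simpl in *; lra. Qed.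

Lemma slit_Cmod (z : C) : slit z -> 0 < Cmod z.
Proof. intros H. apply Cmod_gt_0. apply slit_neq_0; auto. Qed.

Lemma slit_pos (z : C) : slit z -> 0 < Cmod z + fst z.
Proof.
  intros H. assert (H0 := slit_Cmod z H). assert (Hs := Cmod_sqr z).
  destruct H as [H|H]; [lra|].
  assert (0 < snd z ^ 2) by (simpl; rewrite Rmult_1_r; apply Rsqr_pos_lt; auto).
  nra.
Qed.

Lemma slit_shift (z : C) (x : R) : slit z -> 0 <= x -> slit (z + RtoC x).
Proof. intros [H|H] Hx; [left|right]; simpl; lra. Qed.

Lemma dC_clog (f : R -> C) (x : R) (l : C) :
  slit (f x) -> dC f x l -> dC (fun t => clog (f t)) x (l / f x)%C.
Proof.
  intros Hs [a1 a2].
  assert (Hr := slit_Cmod _ Hs). assert (Hp := slit_pos _ Hs). assert (Hq := Cmod_sqr (f x)).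
  assert (Hsq : 0 < fst (f x) ^ 2 + snd (f x) ^ 2) by (rewrite <- Hq; apply pow_lt; auto).
  assert (Hm : is_derive (fun t => Cmod (f t)) x
     ((fst (f x) * fst l + snd (f x) * snd l) / Cmod (f x))).
  { unfold Cmod at 1. evar_last.
    - apply (is_derive_sqrt (fun t => fst (f t) ^ 2 + snd (f t) ^ 2)); [|apply Hsq].
      apply @is_derive_plus; apply is_derive_pow; eassumption.
    - unfold plus; simpl. unfold Cmod; simpl.
      field. unfold Cmod in Hr. simpl in Hr. lra. }
  unfold clog. set (r := Cmod (f x)) in *.
  destruct (f x) as [u v] eqn:E. destruct l as [u' v']. simpl in *.
  split; simpl.
  - evar_last; [apply (is_derive_comp ln (fun t => Cmod (f t)));
       [apply is_derive_ln; rewrite E; apply Hr|apply Hm]|].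
    cbv beta; rewrite E. fold r. unfold scal; simpl; unfold mult; simpl.
    replace (u * (u * 1) + v * (v * 1)) with (r * r) by lra.
    replace (u' * (u / (r * r)) - v' * (- v / (r * r))) with ((u * u' + v * v') / (r * r)).
    { field; lra. }
    field; lra.
  - evar_last.
    + apply (is_derive_scal (fun t => atan (snd (f t) / (Cmod (f t) + fst (f t)))) x 2).
      apply (is_derive_comp atan (fun t => snd (f t) / (Cmod (f t) + fst (f t)))).
      * apply is_derive_atan.
      * apply is_derive_div; [apply a2|apply @is_derive_plus; [apply Hm|apply a1]|].
        rewrite E; simpl. fold r. lra.
    + cbv beta; rewrite E; simpl. fold r. unfold scal, plus, mult; simpl; unfold mult; simpl.
      replace (u * (u * 1) + v * (v * 1)) with (r * r) by lra.
      unfold Rsqr.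
      (* This factorization of [v^2 = r^2 - u^2] removes all squares of [r + u] from the derivative
         of the arctangent. *)
      assert (Hv : v * v = (r - u) * (r + u)) by lra.
      replace (v / (r + u) * (v / (r + u))) with ((r - u) / (r + u)).
      2: { replace (v / (r + u) * (v / (r + u))) with ((v * v) / ((r + u) * (r + u))) by (field; lra).
           rewrite Hv. field; lra. }
      replace (1 + (r - u) / (r + u)) with (2 * r / (r + u)) by (field; lra).
      transitivity ((v' * (r * (r + u) - v * v) - v * u' * (r + u)) / (r * r * (r + u))).
      { field. lra. }
      rewrite Hv. field. lra.
Qed.

Lemma contC_clog {U : UniformSpace} (f : U -> C) (x : U) :
  slit (f x) -> contC f x -> contC (fun t => clog (f t)) x.
Proof.
  intros Hs [a b].
  assert (Hr := slit_Cmod _ Hs). assert (Hp := slit_pos _ Hs).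
  assert (Hm : continuous (fun t => Cmod (f t)) x).
  { unfold Cmod.
    apply (continuous_comp (fun t => fst (f t) ^ 2 + snd (f t) ^ 2) sqrt).
    - apply (continuous_plus (fun t => fst (f t) ^ 2) (fun t => snd (f t) ^ 2)).
      + apply continuous_ext with (fun t => fst (f t) * fst (f t)). { intros; simpl; ring. }
        apply continuous_Rmult; auto.
      + apply continuous_ext with (fun t => snd (f t) * snd (f t)). { intros; simpl; ring. }
        apply continuous_Rmult; auto.
    - apply continuous_sqrt. }
  split; simpl.
  - apply (continuous_comp (fun t => Cmod (f t)) ln); auto.
    apply (ex_derive_continuous ln). eexists. apply is_derive_ln. auto.
  - apply (continuous_Rmult (fun _ => 2)); [apply continuous_const|].
    apply (continuous_comp (fun t => snd (f t) / (Cmod (f t) + fst (f t))) atan).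
    + apply continuous_Rmult; auto. apply continuous_Rinv_comp; [lra|].
      apply (continuous_plus (fun t => Cmod (f t)) (fun t => fst (f t))); auto.
    + apply (ex_derive_continuous atan). eexists. apply is_derive_atan.
Qed.

Lemma cexp_clog (z : C) : slit z -> cexp (clog z) = z.
Proof.
  intros Hs. assert (Hr := slit_Cmod _ Hs). assert (Hp := slit_pos _ Hs). assert (Hq := Cmod_sqr z).
  unfold cexp, clog, Re, Im; simpl. rewrite exp_ln by auto.
  set (r := Cmod z) in *. destruct z as [x y]; simpl in *.
  (* [th] is half the argument of [z]; the duplication formulas then give back [x / r] and
     [y / r]. *)
  set (th := atan (y / (r + x))).
  assert (Ht : tan th = y / (r + x)) by apply atan_right_inv.
  assert (Hc : 0 < cos th). { destruct (atan_bound (y / (r + x))). apply cos_gt_0; unfold th; lra. }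
  assert (Hsin : sin th = cos th * (y / (r + x))). { rewrite <- Ht. unfold tan. field. lra. }
  assert (H1 := sin2_cos2 th). unfold Rsqr in H1. rewrite Hsin in H1.
  assert (Hc2 : cos th * cos th = (r + x) / (2 * r)).
  { assert (E : cos th * cos th * (1 + y / (r + x) * (y / (r + x))) = 1) by lra.
    replace (1 + y / (r + x) * (y / (r + x))) with (2 * r / (r + x)) in E.
    - apply (Rmult_eq_reg_r (2 * r / (r + x))).
      + rewrite E. field. lra.
      + apply Rgt_not_eq. apply Rdiv_lt_0_compat; lra.
    - replace (y / (r + x) * (y / (r + x))) with ((y * y) / ((r + x) * (r + x))) by (field; lra).
      replace (y * y) with ((r - x) * (r + x)) by lra. field; lra. }
  apply C_ext; simpl.
  - rewrite cos_2a_cos. replace (2 * cos th * cos th) with (2 * (cos th * cos th)) by ring.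
    rewrite Hc2. field. lra.
  - rewrite sin_2a, Hsin. replace (2 * (cos th * (y / (r + x))) * cos th) with (2 * (cos th * cos th) * (y / (r + x))) by ring.
    rewrite Hc2. field. lra.
Qed.

Lemma clog_scale (A : R) (z : C) : 0 < A -> slit z -> clog (RtoC A * z) = (RtoC (ln A) + clog z)%C.
Proof.
  intros HA Hs. assert (Hr := slit_Cmod _ Hs). assert (Hp := slit_pos _ Hs).
  unfold clog. rewrite Cmod_mult, Cmod_R, Rabs_pos_eq by lra.
  apply C_ext; simpl.
  - apply ln_mult; auto.
  - rewrite Rplus_0_l. f_equal. f_equal. field. split; [lra|].
    nra.
Qed.

Lemma clog_bound (z : C) : Cmod (clog z) <= Rabs (ln (Cmod z)) + PI.
Proof.
  eapply Rle_trans; [apply Cmod_le_abs|]. unfold clog; simpl.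
  apply Rplus_le_compat_l.
  destruct (atan_bound (snd z / (Cmod z + fst z))). apply Rabs_le. lra.
Qed.

Lemma clog_RtoC (x : R) : 0 < x -> clog (RtoC x) = RtoC (ln x).
Proof.
  intros Hx. unfold clog. rewrite Cmod_R, Rabs_pos_eq by lra. apply C_ext; simpl; auto.
  unfold Rdiv. rewrite Rmult_0_l, atan_0. ring.
Qed.

(** The half-arguments of [z] and [- z] have tangents that are inverse to each other up to sign,
    hence differ by [PI / 2]. Two jumps of this kind make up the [2 PI] of Cauchy's formula. *)
Lemma clog_antipodal (z : C) : 0 < snd z -> (clog z - clog (- z) = (0, PI))%C.
Proof.
  intros Hy. assert (Hs : slit z) by (right; lra).
  assert (Hs' : slit (- z)) by (right; simpl; lra).
  assert (Hp := slit_pos _ Hs). assert (Hp' := slit_pos _ Hs'). assert (Hq := Cmod_sqr z).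
  unfold clog. rewrite Cmod_opp in *. simpl in *. apply C_ext; simpl; [ring|].
  set (r := Cmod z) in *.
  replace (- snd z / (r + - fst z)) with (- (snd z / (r - fst z))) by (field; lra).
  rewrite atan_opp.
  replace (snd z / (r - fst z)) with (/ (snd z / (r + fst z))).
  - rewrite atan_inv; [field|]. apply Rdiv_lt_0_compat; lra.
  - field_simplify_eq; [|lra]. nra.
Qed.

(** * Holomorphic functions and Cauchy's formula on rectangles *)

(** Differentiability along every real line, with a continuous complex derivative,
    is all that the proof of Cauchy's formula uses. *)
Definition hol (U : C -> Prop) (f : C -> C) : Prop :=
  exists f' : C -> C, forall z, U z ->
    (forall w, dC (fun t => f (z + RtoC t * w)%C) 0 (w * f' z)%C) /\
    contC (U := C_UniformSpace) f z /\ contC (U := C_UniformSpace) f' z.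
Definition openC (U : C -> Prop) : Prop :=
  forall z, U z -> locally (T := C_UniformSpace) z U.

Lemma hol_cont U f z : hol U f -> U z -> contC (U := C_UniformSpace) f z.
Proof. intros [f' H] Hz. apply (H z Hz). Qed.

Lemma hol_subset (U V : C -> Prop) f : (forall z, U z -> V z) -> hol V f -> hol U f.
Proof. intros H [f' Hf]. exists f'. intros z Hz. apply Hf; auto. Qed.

Lemma line_0 (z w : C) : (z + RtoC 0 * w = z)%C.
Proof. ring. Qed.

Lemma dC_line (z w : C) (x : R) : dC (fun t => z + RtoC t * w)%C x w.
Proof.
  eapply dC_eq; [|apply dC_plus; [apply dC_const|apply dC_mult; [apply dC_id|apply dC_const]]].
  cbv beta; ring.
Qed.

Lemma hol_ext U f g : openC U -> (forall z, U z -> f z = g z) -> hol U f -> hol U g.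
Proof.
  intros HU E [f' Hf]. exists f'. intros z Hz. destruct (Hf z Hz) as (H1 & H2 & H3).
  assert (HL := HU z Hz). split; [|split; auto].
  - intros w. apply dC_ext_loc with (2 := H1 w).
    assert (Hc := dC_contC _ _ _ (dC_line z w 0)). apply contC_continuous in Hc.
    specialize (Hc U). cbv beta in Hc. rewrite line_0 in Hc.
    specialize (Hc HL). unfold filtermap in Hc.
    apply filter_imp with (2 := Hc). intros t Ht. apply E; auto.
  - apply contC_ext_loc with (2 := H2).
    apply filter_imp with (2 := HL). intros t Ht. rewrite E; auto.
Qed.

Lemma hol_const U c : hol U (fun _ => c).
Proof.
  exists (fun _ => 0). intros z _. split; [|split; apply contC_const].
  intros w. eapply dC_eq; [|apply dC_const]. ring.
Qed.

Lemma hol_id U : hol U (fun z => z).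
Proof.
  exists (fun _ => 1). intros z _. split; [|split; [apply contC_idC|apply contC_const]].
  intros w. eapply dC_eq; [|apply dC_line]. ring.
Qed.

Lemma hol_plus U f g : hol U f -> hol U g -> hol U (fun z => f z + g z)%C.
Proof.
  intros [f' Hf] [g' Hg]. exists (fun z => f' z + g' z)%C. intros z Hz.
  destruct (Hf z Hz) as (F1 & F2 & F3), (Hg z Hz) as (G1 & G2 & G3).
  split; [|split; apply contC_plus; auto].
  intros w. eapply dC_eq; [|apply dC_plus; [apply F1|apply G1]]. ring.
Qed.

Lemma hol_opp U f : hol U f -> hol U (fun z => - f z)%C.
Proof.
  intros [f' Hf]. exists (fun z => - f' z)%C. intros z Hz.
  destruct (Hf z Hz) as (F1 & F2 & F3).
  split; [|split; apply contC_opp; auto].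
  intros w. eapply dC_eq; [|apply dC_opp; apply F1]. ring.
Qed.

Lemma hol_minus U f g : hol U f -> hol U g -> hol U (fun z => f z - g z)%C.
Proof. intros; apply hol_plus; auto; apply hol_opp; auto. Qed.

Lemma hol_mult U f g : hol U f -> hol U g -> hol U (fun z => f z * g z)%C.
Proof.
  intros [f' Hf] [g' Hg]. exists (fun z => f' z * g z + f z * g' z)%C. intros z Hz.
  destruct (Hf z Hz) as (F1 & F2 & F3), (Hg z Hz) as (G1 & G2 & G3).
  split; [|split; [apply contC_mult; auto|apply contC_plus; apply contC_mult; auto]].
  intros w. eapply dC_eq; [|apply dC_mult; [apply F1|apply G1]]. cbv beta. rewrite !line_0. ring.
Qed.

Lemma hol_inv U (f : C -> C) : (forall z, U z -> f z <> 0) -> hol U f -> hol U (fun z => / f z)%C.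
Proof.
  intros H0 [f' Hf]. exists (fun z => - (f' z * / (f z * f z)))%C. intros z Hz.
  destruct (Hf z Hz) as (F1 & F2 & F3). assert (Hn := H0 z Hz).
  assert (Hnn : (f z * f z)%C <> 0) by (apply Cmult_neq_0; exact Hn).
  split; [|split].
  - intros w. eapply dC_eq; [|apply dC_inv; [|apply F1]]; cbv beta; rewrite line_0; auto.
    field; auto.
  - apply contC_inv; auto.
  - apply contC_opp, contC_mult; auto. apply contC_inv; auto. apply contC_mult; auto.
Qed.

Lemma hol_cexp U f : hol U f -> hol U (fun z => cexp (f z)).
Proof.
  intros [f' Hf]. exists (fun z => f' z * cexp (f z))%C. intros z Hz.
  destruct (Hf z Hz) as (F1 & F2 & F3).
  split; [|split; [apply contC_cexp; auto|apply contC_mult; auto; apply contC_cexp; auto]].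
  intros w. eapply dC_eq; [|apply dC_cexp; apply F1]. cbv beta. rewrite !line_0. ring.
Qed.

Lemma hol_clog : hol slit clog.
Proof.
  exists (fun z => / z)%C. intros z Hz. assert (Hn := slit_neq_0 z Hz).
  split; [|split].
  - intros w. eapply dC_eq; [|apply dC_clog; [|apply dC_line]]; cbv beta; rewrite line_0; auto.
  - apply (contC_clog (U := C_UniformSpace) (fun y => y)); auto. apply contC_idC.
  - apply (contC_inv (U := C_UniformSpace) (fun y => y)); auto. apply contC_idC.
Qed.

Lemma hol_affine (U V : C -> Prop) f (al be : C) :
  (forall z, U z -> V (al * z + be)%C) -> hol V f -> hol U (fun z => f (al * z + be)%C).
Proof.
  intros HV [f' Hf]. exists (fun z => al * f' (al * z + be))%C. intros z Hz.
  destruct (Hf _ (HV z Hz)) as (F1 & F2 & F3).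
  assert (Ha : contC (U := C_UniformSpace) (fun z => al * z + be)%C z).
  { apply contC_plus; [apply contC_mult; [apply contC_const|apply contC_idC]|apply contC_const]. }
  split; [|split].
  - intros w. eapply dC_eq; [|apply dC_ext with (fun t => f ((al * z + be) + RtoC t * (al * w))%C)].
    2: intros; f_equal; ring.
    2: apply F1. ring.
  - apply (contC_compC (U := C_UniformSpace) (fun z => al * z + be)%C f); auto.
  - apply contC_mult; [apply contC_const|].
    apply (contC_compC (U := C_UniformSpace) (fun z => al * z + be)%C f'); auto.
Qed.

Lemma hol_cprod U n (f : nat -> C -> C) :
  (forall k, (k < n)%nat -> hol U (f k)) -> hol U (fun z => cprod n (fun k => f k z)).
Proof.
  intros H; induction n; simpl; [apply hol_const|apply hol_mult; auto].
Qed.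

Lemma hol_csum U n (f : nat -> C -> C) :
  (forall k, (k < n)%nat -> hol U (f k)) -> hol U (fun z => csum n (fun k => f k z)).
Proof.
  intros H; induction n; simpl; [apply hol_const|apply hol_plus; auto].
Qed.

Lemma hol_pow U f n : hol U f -> hol U (fun z => Cpow (f z) n).
Proof. intros H; induction n; simpl; [apply hol_const|apply hol_mult; auto]. Qed.

(** For [0 <= l <= 1] the point is a convex combination of [s] and [x]. Leaving [[0, 1]] by at most
    [e'] moves it by at most [e' (hi - lo + 1)], and [x] itself may be off by [e']. The margins are
    those required for differentiating under the integral sign. *)
Lemma scale_between (lo hi s x l e e' : R) :
  lo < s < hi -> 0 < e' <= 1 -> e' * (3 + (hi - lo)) <= e ->
  lo - e' <= x <= hi + e' -> - e' <= l <= 1 + e' ->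
  lo - e <= s + l * (x - s) <= hi + e.
Proof.
  intros Hs He He2 Hx Hl.
  assert (B : Rabs (x - s) <= (hi - lo) + 1) by (apply Rabs_le; lra).
  assert (K : forall l1 dl, 0 <= l1 <= 1 -> Rabs dl <= e' -> lo - e <= s + (l1 + dl) * (x - s) <= hi + e).
  { intros l1 dl Hl1 Hdl.
    assert (P1 : Rabs (dl * (x - s)) <= e' * (hi - lo + 1)).
    { rewrite Rabs_mult. apply Rmult_le_compat; auto; apply Rabs_pos. }
    apply Rabs_le_between in P1.
    assert (P2 : lo - e' <= s + l1 * (x - s) <= hi + e') by nra.
    lra. }
  destruct (Rle_lt_dec l 0) as [H|H].
  - replace l with (0 + l) by ring. apply K; [lra|apply Rabs_le; lra].
  - destruct (Rle_lt_dec l 1) as [H'|H'].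
    + replace l with (l + 0) by ring. apply K; [lra|rewrite Rabs_R0; lra].
    + replace l with (1 + (l - 1)) by ring. apply K; [lra|apply Rabs_le; lra].
Qed.

Section Edge.
Variables (U : C -> Prop) (g g' : C -> C).
Hypothesis Hg : forall z, U z ->
    (forall w, dC (fun t => g (z + RtoC t * w)%C) 0 (w * g' z)%C) /\
    contC (U := C_UniformSpace) g z /\ contC (U := C_UniformSpace) g' z.

Lemma hol_line (z v : C) (x : R) :
  U (z + RtoC x * v)%C -> dC (fun t => g (z + RtoC t * v)%C) x (v * g' (z + RtoC x * v))%C.
Proof.
  intros H. destruct (Hg _ H) as [H1 _].
  apply dC_ext with (fun t => g ((z + RtoC x * v) + RtoC (t - x) * v)%C).
  { intros t. f_equal. rewrite RtoC_minus. ring. }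
  eapply dC_eq; [|apply (dC_comp (fun u => g ((z + RtoC x * v) + RtoC u * v)%C) (fun t => t - x))].
  3: { evar_last; [apply @is_derive_minus; [apply @is_derive_id|apply @is_derive_const]|].
       unfold minus, plus, opp, one, zero; simpl. reflexivity. }
  2: { replace (x - x) with 0 by ring. apply H1. }
  replace (1 + - 0) with 1 by ring. ring.
Qed.

Variables (s w : C) (e : R -> C) (z0 : C) (al be : R).
Hypothesis He : forall t, e t = (z0 + RtoC t * w)%C.
Hypothesis Hs : forall t, (e t - s)%C <> 0.

(** The homothety with centre [s] and ratio [l], which shrinks the contour onto [s] as [l] goes from
    [1] to [0]. *)
Definition edge_pt (l t : R) : C := (s + RtoC l * (e t - s))%C.

(** The chain rule produces the factor [e t - s], which cancels the denominator; the derivative is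
    therefore regular down to [l = 0]. *)
Lemma edge_derive (l : R) (eps : posreal) :
  (forall y t, Rabs (y - l) < eps -> Rmin al be - eps < t < Rmax al be + eps -> U (edge_pt y t)) ->
  dC (fun y => RIntC (fun t => g (edge_pt y t) * (w / (e t - s)))%C al be) l
     (RIntC (fun t => g' (edge_pt l t) * w)%C al be).
Proof.
  intros HU. assert (He0 := cond_pos eps).
  assert (Hcl : forall t, contC e t).
  { intros t. apply contC_ext with (fun t => z0 + RtoC t * w)%C. { intros; symmetry; apply He. }
    eapply dC_contC. apply dC_line. }
  apply (dC_RInt_param (fun y t => g (edge_pt y t) * (w / (e t - s)))%C
                       (fun y t => g' (edge_pt y t) * w)%C al be l eps).
  - intros y t Hy Ht. unfold edge_pt.
    eapply dC_eq; [|apply dC_mult; [apply hol_line; apply HU; auto|apply dC_const]].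
    cbv beta. field. apply Hs.
  - intros y t Hy Ht.
    assert (Hut : U (edge_pt y t)) by (apply HU; auto; lra).
    apply contC_mult.
    + apply (contC_compC (edge_pt y) g); [|apply Hg; auto].
      unfold edge_pt. apply contC_plus; [apply contC_const|].
      apply contC_mult; [apply contC_const|]. apply contC_minus; [apply Hcl|apply contC_const].
    + apply contC_mult; [apply contC_const|]. apply contC_inv; [apply Hs|].
      apply contC_minus; [apply Hcl|apply contC_const].
  - intros t Ht. apply contC_mult; [|apply contC_const].
    assert (Hut : U (edge_pt l t)).
    { apply HU; [|lra]. replace (l - l) with 0 by ring. rewrite Rabs_R0; auto. }
    apply (contC_compC (U := prod_UniformSpace R_UniformSpace R_UniformSpace)
       (fun p => edge_pt (fst p) (snd p)) g'); [|apply Hg; auto].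
    unfold edge_pt. apply contC_plus; [apply contC_const|].
    apply contC_mult; [apply contC_RtoC; apply continuous_fst|].
    apply contC_minus; [|apply contC_const].
    apply (contC_comp (U := prod_UniformSpace R_UniformSpace R_UniformSpace) (V := R_UniformSpace) snd e);
      [apply continuous_snd|apply Hcl].
Qed.

(** [l g' w] is the derivative of [g (edge_pt l t)] in [t]. Keeping the factor [l] on the left
    avoids a division, but makes [l = 0] a separate case. *)
Lemma edge_FTC (l : R) :
  (forall t, Rmin al be <= t <= Rmax al be -> U (edge_pt l t)) ->
  (RtoC l * RIntC (fun t => g' (edge_pt l t) * w) al be = g (edge_pt l be) - g (edge_pt l al))%C.
Proof.
  intros HU.
  assert (Hc : forall t, Rmin al be <= t <= Rmax al be -> contC (fun t => g' (edge_pt l t) * w)%C t).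
  { intros t Ht. apply contC_mult; [|apply contC_const].
    apply (contC_compC (edge_pt l) g'); [|apply Hg; auto].
    unfold edge_pt. apply contC_plus; [apply contC_const|].
    apply contC_mult; [apply contC_const|]. apply contC_minus; [|apply contC_const].
    apply contC_ext with (fun t => z0 + RtoC t * w)%C. { intros; symmetry; apply He. }
    eapply dC_contC. apply dC_line. }
  transitivity (RIntC (fun t => RtoC l * (g' (edge_pt l t) * w))%C al be).
  - symmetry. apply is_RIntC_eq. apply is_RIntC_scal. apply contC_ex. auto.
  - apply is_RIntC_eq.
    apply (is_RIntC_FTC (fun t => g (edge_pt l t))).
    + intros t Ht.
      assert (E : forall t, edge_pt l t = ((s + RtoC l * (z0 - s)) + RtoC t * (RtoC l * w))%C).
      { intros; unfold edge_pt; rewrite He; ring. }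
      apply dC_ext with (fun t => g ((s + RtoC l * (z0 - s)) + RtoC t * (RtoC l * w))%C).
      { intros; rewrite E; auto. }
      eapply dC_eq; [|apply hol_line; rewrite <- E; apply HU; auto].
      rewrite <- E. ring.
    + intros t Ht. apply contC_mult; [apply contC_const|apply Hc; auto].
Qed.

Lemma edge_int_0 : RIntC (fun t => g' (edge_pt 0 t) * w)%C al be = (RtoC (be - al) * w * g' s)%C.
Proof.
  assert (E : forall t, edge_pt 0 t = s) by (intros; unfold edge_pt; ring).
  apply is_RIntC_eq.
  apply (is_RIntC_ext (fun _ => g' s * w)%C). { intros; rewrite E; auto. }
  replace (RtoC (be - al) * w * g' s)%C with (RtoC be * (g' s * w) - RtoC al * (g' s * w))%C.
  2: rewrite RtoC_minus; ring.
  apply (is_RIntC_FTC (fun t => RtoC t * (g' s * w))%C).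
  - intros. eapply dC_eq; [|apply dC_mult; [apply dC_id|apply dC_const]]. cbv beta; ring.
  - intros; apply contC_const.
Qed.

Lemma edge_at_1 : RIntC (fun t => g (edge_pt 1 t) * (w / (e t - s)))%C al be
   = RIntC (fun t => g (e t) / (e t - s) * w)%C al be.
Proof.
  apply RInt_ext. intros t _. unfold edge_pt.
  replace (s + RtoC 1 * (e t - s))%C with (e t) by ring. unfold Cdiv.
  match goal with |- ?x = ?y => change (@eq C x y) end. ring.
Qed.

Lemma edge_at_0 (I : C) : is_RIntC (fun t => w / (e t - s))%C al be I ->
  RIntC (fun t => g (edge_pt 0 t) * (w / (e t - s)))%C al be = (g s * I)%C.
Proof.
  intros HI. apply is_RIntC_eq.
  apply (is_RIntC_ext (fun t => g s * (w / (e t - s)))%C).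
  { intros; unfold edge_pt. f_equal. f_equal. ring. }
  apply is_RIntC_scal; auto.
Qed.
End Edge.

Definition rect_int (f : C -> C) (a b c d : R) : C :=
  (RIntC (fun x => f (x, c)) a b + Ci * RIntC (fun y => f (b, y)) c d
   - RIntC (fun x => f (x, d)) a b - Ci * RIntC (fun y => f (a, y)) c d)%C.

Lemma Cmult_l_cancel (k x : C) : k <> 0 -> (k * x = 0)%C -> x = 0.
Proof.
  intros Hk H. replace x with (/ k * (k * x))%C by (field; auto). rewrite H. ring.
Qed.

Lemma is_RIntC_swap (f : R -> C) a b l : is_RIntC f a b l -> is_RIntC f b a (- l)%C.
Proof. apply (is_RInt_swap (V := C_R_NormedModule)). Qed.

(** Let [Phi l] be the boundary integral of [g (s + l (t - s)) / (t - s)].  Then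
    [Phi' l] is the integral of the derivative of [t |-> g (s + l (t - s)) / l], which
    vanishes on a closed contour; so [Phi 1 = Phi 0 = g s * Phi_1], where [Phi_1] is the
    integral of [1 / (t - s)]. *)
Theorem cauchy_formula (U : C -> Prop) (g : C -> C) (a b c d e : R) (s : C) :
  hol U g -> 0 < e ->
  (forall z : C, a - e <= fst z <= b + e -> c - e <= snd z <= d + e -> U z) ->
  a < fst s < b -> c < snd s < d ->
  rect_int (fun t => g t / (t - s))%C a b c d = (RtoC (2 * PI) * Ci * g s)%C.
Proof.
  intros [g' Hg] He HU Hx Hy.
  assert (Hab : a < b) by lra. assert (Hcd : c < d) by lra.
  set (M := 3 + (b - a) + (d - c)).
  (* Small enough for [scale_between] in both coordinates: the dilated rectangle stays within the
     margin [e] for all [l] within [e1] of [[0, 1]]. *)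
  set (e1 := Rmin 1 (e / M)).
  assert (HM : 0 < M) by (unfold M; lra).
  assert (He1 : 0 < e1 <= 1).
  { unfold e1. split; [apply Rmin_pos; [lra|apply Rdiv_lt_0_compat; lra]|apply Rmin_l]. }
  assert (He1M : e1 * M <= e).
  { unfold e1. apply Rle_trans with (e / M * M); [apply Rmult_le_compat_r; [lra|apply Rmin_r]|].
    right; field; lra. }
  assert (Hin : forall (l x y : R), - e1 <= l <= 1 + e1 -> a - e1 <= x <= b + e1 -> c - e1 <= y <= d + e1 ->
     U (s + RtoC l * ((x, y) - s))%C).
  { intros l x y Hl Hx' Hy'. apply HU; simpl.
    - replace (fst s + (l * (x + - fst s) - 0 * (y + - snd s))) with (fst s + l * (x - fst s)) by ring.
      apply scale_between with e1; auto. unfold M in He1M. nra.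
    - replace (snd s + (l * (y + - snd s) + 0 * (x + - fst s))) with (snd s + l * (y - snd s)) by ring.
      apply scale_between with e1; auto. unfold M in He1M. nra. }
  set (eB := fun x : R => (x, c) : C). set (eR := fun y : R => (b, y) : C).
  set (eT := fun x : R => (x, d) : C). set (eL := fun y : R => (a, y) : C).
  assert (EB : forall t, eB t = ((0, c) + RtoC t * RtoC 1)%C) by (intros; apply C_ext; simpl; ring).
  assert (ER : forall t, eR t = ((b, 0) + RtoC t * Ci)%C) by (intros; apply C_ext; simpl; ring).
  assert (GH_main : forall t, eT t = ((0, d) + RtoC t * RtoC 1)%C) by (intros; apply C_ext; simpl; ring).
  assert (EL : forall t, eL t = ((a, 0) + RtoC t * Ci)%C) by (intros; apply C_ext; simpl; ring).
  assert (NB : forall t, (eB t - s)%C <> 0) by (intros t E; injection E; simpl; lra).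
  assert (NR : forall t, (eR t - s)%C <> 0) by (intros t E; injection E; simpl; lra).
  assert (NT : forall t, (eT t - s)%C <> 0) by (intros t E; injection E; simpl; lra).
  assert (NL : forall t, (eL t - s)%C <> 0) by (intros t E; injection E; simpl; lra).
  set (Phi := fun l : R => (RIntC (fun t => g (edge_pt s eB l t) * (RtoC 1 / (eB t - s))) a b
     + RIntC (fun t => g (edge_pt s eR l t) * (Ci / (eR t - s))) c d
     + RIntC (fun t => g (edge_pt s eT l t) * (RtoC 1 / (eT t - s))) b a
     + RIntC (fun t => g (edge_pt s eL l t) * (Ci / (eL t - s))) d c)%C).
  assert (HPhi : Cmod (Phi 1 - Phi 0) <= 2 * 0 * Rabs (1 - 0)).
  { apply (dC_bound Phi (fun _ => 0)). intros l Hl. rewrite Rmin_left, Rmax_right in Hl by lra.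
    split; [|rewrite Cmod_0; lra].
    assert (He2 : 0 < e1) by lra. set (ep := mkposreal e1 He2).
    assert (Hb1 : forall y, Rabs (y - l) < ep -> - e1 <= y <= 1 + e1).
    { intros y Hy1. simpl in Hy1. apply Rabs_def2 in Hy1. lra. }
    assert (Mab : Rmin a b = a /\ Rmax a b = b) by (split; [apply Rmin_left|apply Rmax_right]; lra).
    assert (Mba : Rmin b a = a /\ Rmax b a = b) by (split; [apply Rmin_right|apply Rmax_left]; lra).
    assert (Mcd : Rmin c d = c /\ Rmax c d = d) by (split; [apply Rmin_left|apply Rmax_right]; lra).
    assert (Mdc : Rmin d c = c /\ Rmax d c = d) by (split; [apply Rmin_right|apply Rmax_left]; lra).
    destruct Mab as [Ma1 Ma2], Mba as [Mb1 Mb2], Mcd as [Mc1 Mc2], Mdc as [Md1 Md2].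
    eapply dC_eq; cycle 1.
    - unfold Phi. apply dC_plus; [apply dC_plus; [apply dC_plus|]|].
      + apply (edge_derive U g g' Hg s 1 eB (0, c) a b EB NB l ep).
        intros y t H1 H2. rewrite Ma1, Ma2 in H2. simpl in H2. apply Hin; auto; lra.
      + apply (edge_derive U g g' Hg s Ci eR (b, 0) c d ER NR l ep).
        intros y t H1 H2. rewrite Mc1, Mc2 in H2. simpl in H2. apply Hin; auto; lra.
      + apply (edge_derive U g g' Hg s 1 eT (0, d) b a GH_main NT l ep).
        intros y t H1 H2. rewrite Mb1, Mb2 in H2. simpl in H2. apply Hin; auto; lra.
      + apply (edge_derive U g g' Hg s Ci eL (a, 0) d c EL NL l ep).
        intros y t H1 H2. rewrite Md1, Md2 in H2. simpl in H2. apply Hin; auto; lra.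
    (* For [l = 0] the integrands are constant and the edge vectors add up to [0]; otherwise the
       increments of [g] telescope around the rectangle. *)
    - destruct (Req_dec l 0) as [->|Hl0].
      + rewrite !edge_int_0. rewrite !RtoC_minus. ring.
      + apply (Cmult_l_cancel (RtoC l)). { intros E; apply Hl0. apply RtoC_inj; auto. }
        rewrite !Cmult_plus_distr_l.
        rewrite (edge_FTC U g g' Hg s 1 eB (0, c) a b EB l).
        2: { intros t H2. rewrite Ma1, Ma2 in H2. apply Hin; lra. }
        rewrite (edge_FTC U g g' Hg s Ci eR (b, 0) c d ER l).
        2: { intros t H2. rewrite Mc1, Mc2 in H2. apply Hin; lra. }
        rewrite (edge_FTC U g g' Hg s 1 eT (0, d) b a GH_main l).
        2: { intros t H2. rewrite Mb1, Mb2 in H2. apply Hin; lra. }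
        rewrite (edge_FTC U g g' Hg s Ci eL (a, 0) d c EL l).
        2: { intros t H2. rewrite Md1, Md2 in H2. apply Hin; lra. }
        unfold edge_pt, eB, eR, eT, eL. ring. }
  assert (H10 : Phi 1 = Phi 0).
  { assert (Hz : (Phi 1 - Phi 0)%C = 0).
    { apply Cmod_eq_0. generalize (Cmod_ge_0 (Phi 1 - Phi 0)); lra. }
    replace (Phi 1) with ((Phi 1 - Phi 0) + Phi 0)%C by ring. rewrite Hz. ring. }
  assert (Hcont : forall (ee : R -> C) (z1 w1 : C), (forall t, ee t = (z1 + RtoC t * w1)%C) -> forall t, contC ee t).
  { intros ee z1 w1 E t. apply contC_ext with (fun t => z1 + RtoC t * w1)%C. { intros; symmetry; apply E. }
    eapply dC_contC. apply dC_line. }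
  assert (Hint : forall (ee : R -> C) (z1 w1 : C) al be,
     (forall t, ee t = (z1 + RtoC t * w1)%C) -> (forall t, (ee t - s)%C <> 0) ->
     (forall t, Rmin al be <= t <= Rmax al be -> slit (ee t - s)%C) ->
     is_RIntC (fun t => w1 / (ee t - s))%C al be (clog (ee be - s) - clog (ee al - s))%C).
  { intros ee z1 w1 al be E N S. apply (is_RIntC_FTC (fun t => clog (ee t - s))).
    - intros t Ht. apply (dC_clog (fun t => ee t - s)%C); auto.
      apply dC_ext with (fun t => (z1 - s) + RtoC t * w1)%C. { intros; rewrite E; ring. }
      apply dC_line.
    - intros t Ht. apply contC_mult; [apply contC_const|]. apply contC_inv; auto.
      apply contC_minus; [apply (Hcont ee z1 w1 E)|apply contC_const]. }
  assert (IB := Hint eB (0, c) (RtoC 1) a b EB NB).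
  assert (IR := Hint eR (b, 0) Ci c d ER NR).
  assert (IT := Hint eT (0, d) (RtoC 1) b a GH_main NT).
  (* The left edge crosses the cut of [clog (t - s)]. There [clog (- (t - s))] serves as primitive,
     since [- (t - s)] has positive real part. *)
  assert (IL : is_RIntC (fun t => Ci / (eL t - s))%C d c (clog (- (eL c - s)) - clog (- (eL d - s)))%C).
  { apply (is_RIntC_FTC (fun t => clog (- (eL t - s)))).
    - intros t Ht. eapply dC_eq; [|apply (dC_clog (fun t => - (eL t - s))%C)].
      2: left; simpl; lra.
      2: { apply dC_opp. apply dC_ext with (fun t => ((a, 0) - s) + RtoC t * Ci)%C. { intros; apply C_ext; simpl; ring. }
           apply dC_line. }
      field. apply NL.
    - intros t Ht. apply contC_mult; [apply contC_const|]. apply contC_inv; auto.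
      apply contC_minus; [apply (Hcont eL (a, 0) Ci EL)|apply contC_const]. }
  specialize (IB ltac:(intros; right; simpl; lra)). specialize (IR ltac:(intros; left; simpl; lra)).
  specialize (IT ltac:(intros; right; simpl; lra)).
  assert (P0 : Phi 0 = (RtoC (2 * PI) * Ci * g s)%C).
  { unfold Phi. rewrite (edge_at_0 g s 1 eB a b _ IB), (edge_at_0 g s Ci eR c d _ IR),
      (edge_at_0 g s 1 eT b a _ IT), (edge_at_0 g s Ci eL d c _ IL).
    change (eR d) with (eT b). change (eR c) with (eB b). change (eL c) with (eB a). change (eL d) with (eT a).
    assert (T1 := clog_antipodal (eT a - s)%C). assert (T2 := clog_antipodal (- (eB a - s))%C).
    replace (- - (eB a - s))%C with (eB a - s)%C in T2 by ring.
    specialize (T1 ltac:(simpl; lra)). specialize (T2 ltac:(simpl; lra)).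
    (* The logarithms at the two right corners cancel. At each left corner two different primitives
       meet, and their difference is the jump computed in [clog_antipodal]. *)
    transitivity (g s * ((clog (eT a - s) - clog (- (eT a - s))) + (clog (- (eB a - s)) - clog (eB a - s))))%C.
    { ring. }
    rewrite T1, T2. apply C_ext; simpl; ring. }
  rewrite <- P0, <- H10. unfold Phi.
  rewrite !edge_at_1.
  assert (Q : forall (ee : R -> C) (z1 w1 : C) al be,
     (forall t, ee t = (z1 + RtoC t * w1)%C) -> (forall t, (ee t - s)%C <> 0) ->
     (forall t, Rmin al be <= t <= Rmax al be -> U (ee t)) ->
     RIntC (fun t => g (ee t) / (ee t - s) * w1)%C al be =
     (w1 * RIntC (fun t => g (ee t) / (ee t - s))%C al be)%C /\
     RIntC (fun t => g (ee t) / (ee t - s))%C be al = (- RIntC (fun t => g (ee t) / (ee t - s))%C al be)%C).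
  { intros ee z1 w1 al be E N HUe.
    assert (Hi : is_RIntC (fun t => g (ee t) / (ee t - s))%C al be (RIntC (fun t => g (ee t) / (ee t - s))%C al be)).
    { apply contC_ex. intros t Ht. assert (Hc1 := Hcont ee z1 w1 E t).
      apply contC_mult.
      - apply (contC_compC ee g); auto. apply Hg; auto.
      - apply contC_inv; auto. apply contC_minus; auto. apply contC_const. }
    split; apply is_RIntC_eq.
    - apply is_RIntC_ext with (fun t => w1 * (g (ee t) / (ee t - s)))%C.
      { intros; apply Cmult_comm. }
      apply is_RIntC_scal. auto.
    - apply is_RIntC_swap; auto. }
  assert (Hin1 : forall x y, a <= x <= b -> c <= y <= d -> U (x, y)).
  { intros x y H1 H2. apply HU; simpl; lra. }
  destruct (Q eB (0, c) (RtoC 1) a b EB NB) as [QB _].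
  { rewrite Rmin_left, Rmax_right by lra. intros; apply Hin1; lra. }
  destruct (Q eR (b, 0) Ci c d ER NR) as [QR _].
  { rewrite Rmin_left, Rmax_right by lra. intros; apply Hin1; lra. }
  destruct (Q eT (0, d) (RtoC 1) b a GH_main NT) as [QT QT'].
  { rewrite Rmin_right, Rmax_left by lra. intros; apply Hin1; lra. }
  destruct (Q eL (a, 0) Ci d c EL NL) as [QL QL'].
  { rewrite Rmin_right, Rmax_left by lra. intros; apply Hin1; lra. }
  rewrite QB, QR, QT, QL. unfold rect_int.
  unfold eT in QT'. unfold eL in QL'. rewrite QT', QL'. unfold eB, eR, eT, eL. ring.
Qed.

(** Cauchy's formula at the centre [s] of the rectangle for the function [g t * (t - s)], which
    vanishes at [s]. *)
Theorem cauchy_rect (U : C -> Prop) (g : C -> C) (a b c d e : R) :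
  hol U g -> 0 < e -> a < b -> c < d ->
  (forall z : C, a - e <= fst z <= b + e -> c - e <= snd z <= d + e -> U z) ->
  rect_int g a b c d = 0.
Proof.
  intros Hg He Hab Hcd HU.
  set (s := ((a + b) / 2, (c + d) / 2) : C).
  assert (H := cauchy_formula U (fun t => g t * (t - s))%C a b c d e s).
  cbv beta in H.
  replace (RtoC (2 * PI) * Ci * (g s * (s - s)))%C with (RtoC 0) in H by ring.
  rewrite <- H; auto.
  - assert (K : forall t : C, (t - s)%C <> 0 -> g t = (g t * (t - s) / (t - s))%C).
    { intros t Ht. field; auto. }
    unfold rect_int.
    (* Multiplying and dividing by [t - s] is harmless on the edges only, as none of them contains
       the centre. *)
    assert (E1 : forall y, y <> snd s -> RIntC (fun x => g (x, y)) a b = RIntC (fun x => g (x, y) * ((x, y) - s) / ((x, y) - s))%C a b).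
    { intros y Hy. apply RInt_ext. intros x _. apply K. intros E. injection E. unfold s in Hy; simpl in *. lra. }
    assert (E2 : forall x, x <> fst s -> RIntC (fun y => g (x, y)) c d = RIntC (fun y => g (x, y) * ((x, y) - s) / ((x, y) - s))%C c d).
    { intros x Hx. apply RInt_ext. intros y _. apply K. intros E. injection E. unfold s in Hx; simpl in *. lra. }
    rewrite (E1 c), (E1 d), (E2 a), (E2 b) by (unfold s; simpl; lra). reflexivity.
  - apply hol_mult; auto. apply hol_minus; [apply hol_id|apply hol_const].
  - unfold s; simpl; lra.
  - unfold s; simpl; lra.
Qed.

(** * Bernoulli polynomials and the Wallis product *)

Lemma rsum_ext n f g : (forall k, (k < n)%nat -> f k = g k) -> rsum n f = rsum n g.
Proof. intros H; induction n; simpl; auto. rewrite IHn, H; auto. Qed.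

Lemma rsum_S_l n f : rsum (S n) f = f 0%nat + rsum n (fun k => f (S k)).
Proof. induction n; simpl in *; [ring|]. rewrite IHn. ring. Qed.

Lemma rsum_rev n f : rsum n f = rsum n (fun k => f (n - 1 - k)%nat).
Proof.
  induction n; auto. rewrite (rsum_S_l n (fun k => f (S n - 1 - k)%nat)).
  replace (S n - 1 - 0)%nat with n by lia. simpl rsum at 1. rewrite IHn.
  rewrite Rplus_comm. f_equal. apply rsum_ext. intros; f_equal; lia.
Qed.

Lemma rsum_le n f g : (forall k, (k < n)%nat -> f k <= g k) -> rsum n f <= rsum n g.
Proof. intros H; induction n; simpl; [lra|]. apply Rplus_le_compat; auto. Qed.

Lemma rsum_scal n c f : rsum n (fun k => c * f k) = c * rsum n f.
Proof. induction n; simpl; [ring|rewrite IHn; ring]. Qed.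

Lemma rsum_Rabs n f : Rabs (rsum n f) <= rsum n (fun k => Rabs (f k)).
Proof.
  induction n; simpl; [rewrite Rabs_R0; lra|]. eapply Rle_trans; [apply Rabs_triang|lra].
Qed.

Lemma rsum_sum_f n f : rsum (S n) f = sum_f_R0 f n.
Proof. induction n; simpl in *; [ring|rewrite <- IHn; reflexivity]. Qed.

Section Bern.
Variable a : R.
(** [bern_tab l] lists [bern_coef (l - 1), ..., bern_coef 0]; the recursion makes
    [bern_coef n] the coefficients of the power series whose product with
    [(e^t - 1) / t] is [e^(a t)]. *)
Fixpoint bern_tab (l : nat) : list R :=
  match l with
  | O => nil
  | S l' => let prev := bern_tab l' in
      (a ^ l' / INR (fact l') - rsum l' (fun i => nth i prev 0 / INR (fact (S (S i))))) :: prev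
  end.
Definition bern_coef (n : nat) : R := hd 0 (bern_tab (S n)).
Lemma bern_tab_nth l i : (i < l)%nat -> nth i (bern_tab l) 0 = bern_coef (l - 1 - i).
Proof.
  revert i; induction l; intros i Hi; [lia|].
  destruct i.
  - replace (S l - 1 - 0)%nat with l by lia. reflexivity.
  - replace (S l - 1 - S i)%nat with (l - 1 - i)%nat by lia.
    simpl nth. apply IHl. lia.
Qed.

Lemma bern_coef_rec l : bern_coef l = a ^ l / INR (fact l)
  - rsum l (fun n => bern_coef n / INR (fact (S l - n))).
Proof.
  unfold bern_coef at 1. cbn [bern_tab hd]. f_equal. rewrite rsum_rev.
  apply rsum_ext. intros k Hk. rewrite bern_tab_nth by lia.
  replace (l - 1 - (l - 1 - k))%nat with k by lia.
  replace (S (S (l - 1 - k)))%nat with (S l - k)%nat by lia. reflexivity.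
Qed.

Lemma bern_coef_conv l : rsum (S l) (fun n => bern_coef n / INR (fact (S l - n))) = a ^ l / INR (fact l).
Proof.
  cbn [rsum]. rewrite (bern_coef_rec l) at 1.
  replace (S l - l)%nat with 1%nat by lia.
  change (fact 1) with 1%nat. simpl (INR 1). field. apply INR_fact_neq_0.
Qed.

Lemma fact_ge_geom k : 2 * 3 ^ k <= INR (fact (S (S k))).
Proof.
  induction k; [simpl; lra|].
  replace (fact (S (S (S k)))) with (S (S (S k)) * fact (S (S k)))%nat by reflexivity.
  rewrite mult_INR. simpl pow.
  assert (3 <= INR (S (S (S k)))). { rewrite !S_INR. generalize (pos_INR k); lra. }
  assert (0 < 3 ^ k) by (apply pow_lt; lra). nra.
Qed.

(** Comparison with a geometric series of ratio [1 / 3]. What matters is that the bound is below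
    [1]: it is the contraction constant in [bern_coef_bound]. *)
Lemma inv_fact_sum l : rsum l (fun i => / INR (fact (S (S i)))) <= 3 / 4.
Proof.
  assert (H : rsum l (fun i => / INR (fact (S (S i)))) <= 3 / 4 * (1 - / 3 ^ l)).
  { induction l; cbn [rsum]; [simpl; lra|].
    assert (0 < 3 ^ l) by (apply pow_lt; lra).
    assert (/ INR (fact (S (S l))) <= / (2 * 3 ^ l)).
    { apply Rinv_le_contravar; [lra|apply fact_ge_geom]. }
    assert (E : / (2 * 3 ^ l) = / 2 * / 3 ^ l) by (field; lra).
    assert (E2 : / 3 ^ S l = / 3 * / 3 ^ l) by (simpl; field; lra).
    rewrite E2. lra. }
  assert (0 < / 3 ^ l) by (apply Rinv_0_lt_compat, pow_lt; lra). lra.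
Qed.

Lemma exp_term_le l : Rabs (a ^ l / INR (fact l)) <= exp (Rabs a).
Proof.
  unfold Rdiv. rewrite Rabs_mult, <- RPow_abs, (Rabs_pos_eq (/ _)).
  2: left; apply Rinv_0_lt_compat, INR_fact_lt_0.
  eapply Rle_trans; [|apply (exp_ge_taylor (Rabs a) l (Rabs_pos a))].
  assert (P : forall n, 0 <= Rabs a ^ n / INR (fact n)).
  { intros n. apply Rmult_le_pos; [apply pow_le, Rabs_pos|left; apply Rinv_0_lt_compat, INR_fact_lt_0]. }
  assert (P2 : forall n, 0 <= sum_f_R0 (fun k => Rabs a ^ k / INR (fact k)) n).
  { induction n; [exact (P 0%nat)|]. rewrite tech5. generalize (P (S n)); lra. }
  destruct l; [simpl; right; auto|]. rewrite tech5. generalize (P2 l). unfold Rdiv; lra.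
Qed.

(** Strong induction closes because [exp |a| + (3 / 4) * 4 exp |a| = 4 exp |a|]. A bounded
    coefficient sequence gives a radius of convergence of at least [1], enough to compute
    derivatives at [0]. *)
Lemma bern_coef_bound n : Rabs (bern_coef n) <= 4 * exp (Rabs a).
Proof.
  induction n as [n IH] using (well_founded_induction Wf_nat.lt_wf).
  rewrite bern_coef_rec. unfold Rminus. eapply Rle_trans; [apply Rabs_triang|].
  rewrite Rabs_Ropp. assert (H1 := exp_term_le n).
  assert (H2 : Rabs (rsum n (fun k => bern_coef k / INR (fact (S n - k)))) <= 4 * exp (Rabs a) * (3 / 4)).
  { eapply Rle_trans; [apply rsum_Rabs|].
    eapply Rle_trans.
    - apply rsum_le with (g := fun k => 4 * exp (Rabs a) * / INR (fact (S n - k))).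
      intros k Hk. unfold Rdiv. rewrite Rabs_mult, (Rabs_pos_eq (/ _)).
      2: left; apply Rinv_0_lt_compat, INR_fact_lt_0.
      apply Rmult_le_compat_r; [left; apply Rinv_0_lt_compat, INR_fact_lt_0|apply IH; auto].
    - rewrite rsum_scal. apply Rmult_le_compat_l; [generalize (exp_pos (Rabs a)); lra|].
      rewrite rsum_rev. eapply Rle_trans; [|apply (inv_fact_sum n)]. right.
      apply rsum_ext. intros k Hk. repeat f_equal. lia. }
  lra.
Qed.

Lemma CV_radius_ge_1 (c : nat -> R) M : (forall n, Rabs (c n) <= M) -> Rbar_le 1 (CV_radius c).
Proof.
  intros H. apply (proj1 (CV_radius_bounded c)). exists M. intros n. rewrite pow1, Rmult_1_r. auto.
Qed.

Lemma bern_gen_PSeries t : Rabs t < 1 -> bern_gen a t = PSeries bern_coef t.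
Proof.
  intros Ht. unfold bern_gen. destruct (Req_EM_T t 0) as [->|Hn].
  - rewrite PSeries_0. unfold bern_coef; simpl. field.
  (* The coefficients of [(e^t - 1) / t]. *)
  - set (u := PS_decr_1 (fun n => / INR (fact n)) : nat -> R).
    assert (Hu : is_pseries u t ((exp t - 1) / t)).
    { evar_last; [apply (is_pseries_decr_1 (fun n => / INR (fact n)) t (/ t))|].
      - unfold mult, one; simpl. field; auto.
      - apply is_exp_Reals.
      - unfold scal, plus, opp; simpl; unfold mult; simpl. field; auto. }
    assert (Ru : Rbar_lt (Rabs t) (CV_radius u)).
    { apply Rbar_lt_le_trans with 1; [exact Ht|]. apply CV_radius_ge_1 with 1.
      intros n. unfold u, PS_decr_1. rewrite Rabs_pos_eq.
      2: left; apply Rinv_0_lt_compat, INR_fact_lt_0.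
      rewrite <- Rinv_1. apply Rinv_le_contravar; [lra|].
      change 1 with (INR 1). apply le_INR. apply lt_O_fact. }
    assert (Rg : Rbar_lt (Rabs t) (CV_radius bern_coef)).
    { apply Rbar_lt_le_trans with 1; [exact Ht|]. apply CV_radius_ge_1 with (4 * exp (Rabs a)).
      apply bern_coef_bound. }
    assert (Hg := PSeries_correct _ _ (CV_radius_inside _ _ Rg)).
    assert (Hm := is_pseries_mult _ _ _ _ _ Hg Hu Rg Ru).
    (* The Cauchy product with [u] has the coefficients [a^l / l!], by [bern_coef_conv]; dividing by
       [(e^t - 1) / t] then identifies the series. *)
    assert (He : is_pseries (PS_mult bern_coef u) t (exp (a * t))).
    { assert (E := is_exp_Reals (a * t)). revert E. apply is_series_ext.
      intros n. unfold scal; simpl; unfold mult; simpl.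
      unfold PS_mult. rewrite <- rsum_sum_f.
      rewrite (rsum_ext (S n) _ (fun k => bern_coef k / INR (fact (S n - k)))).
      2: { intros k Hk. unfold u, PS_decr_1, Rdiv. repeat f_equal. lia. }
      rewrite bern_coef_conv. rewrite (pow_n_pow (a * t)), (pow_n_pow t), Rpow_mult_distr. unfold Rdiv. ring. }
    assert (E := is_pseries_unique _ _ _ Hm). rewrite (is_pseries_unique _ _ _ He) in E.
    rewrite E.
    assert (exp t - 1 <> 0).
    { intros Hx. apply Hn. apply exp_inv. rewrite exp_0. lra. }
    field. auto.
Qed.

Lemma bernoulli_coef n : bernoulli_poly n a = bern_coef n * INR (fact n).
Proof.
  unfold bernoulli_poly. rewrite (Derive_n_ext_loc _ (PSeries bern_coef)).
  - apply Derive_n_coef. apply Rbar_lt_le_trans with 1; [simpl; lra|].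
    apply CV_radius_ge_1 with (4 * exp (Rabs a)). apply bern_coef_bound.
  - exists (mkposreal 1 Rlt_0_1). intros t Ht. apply bern_gen_PSeries.
    change (Rabs (t - 0) < 1) in Ht. rewrite Rminus_0_r in Ht. auto.
Qed.
End Bern.

(** The coefficient of [t^(l+1)] in [t e^(a t) = (e^t - 1) sum_n B_n(a) t^n / n!]. This identity
    makes the Taylor terms of the Stirling defect cancel. *)
Theorem bernoulli_conv (a : R) (l : nat) :
  rsum (S l) (fun n => bernoulli_poly n a / INR (fact n) / INR (fact (S l - n))) = a ^ l / INR (fact l).
Proof.
  rewrite <- bern_coef_conv. apply rsum_ext. intros k _. rewrite bernoulli_coef.
  field. split; apply INR_fact_neq_0.
Qed.

Lemma bernoulli_0 a : bernoulli_poly 0 a = 1.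
Proof. rewrite bernoulli_coef. unfold bern_coef; simpl. field. Qed.

Lemma bernoulli_1 a : bernoulli_poly 1 a = a - 1 / 2.
Proof. rewrite bernoulli_coef. unfold bern_coef; simpl. field. Qed.

(** * Wallis's integrals and the constant in Stirling's formula *)

Definition wallis (n : nat) : R := RInt (fun x => sin x ^ n) 0 (PI / 2).
Lemma sin_pow_cont n x : continuous (fun x => sin x ^ n) x.
Proof.
  apply (ex_derive_continuous (fun x => sin x ^ n)). eexists. apply is_derive_pow, is_derive_sin.
Qed.

Lemma wallis_is n : is_RInt (fun x => sin x ^ n) 0 (PI / 2) (wallis n).
Proof.
  unfold wallis. apply (RInt_correct (fun x => sin x ^ n)).
  apply (ex_RInt_continuous (fun x => sin x ^ n)). intros; apply sin_pow_cont.
Qed.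

(** The difference of the two integrands is the derivative of [- cos x * sin x ^ (n + 1)], which
    vanishes at both ends. *)
Lemma wallis_rec n : INR (n + 2) * wallis (n + 2) = INR (n + 1) * wallis n.
Proof.
  set (I := is_RInt_derive (fun x => - cos x * sin x ^ (n + 1))
      (fun x => INR (n + 2) * sin x ^ (n + 2) - INR (n + 1) * sin x ^ n) 0 (PI / 2)).
  assert (H : is_RInt (fun x => INR (n + 2) * sin x ^ (n + 2) - INR (n + 1) * sin x ^ n) 0 (PI / 2)
     (minus (- cos (PI / 2) * sin (PI / 2) ^ (n + 1)) (- cos 0 * sin 0 ^ (n + 1)))).
  { apply I.
    - intros x _.
      evar_last.
      + apply (is_derive_mult (fun x => - cos x) (fun x => sin x ^ (n + 1))).
        * apply @is_derive_opp. apply is_derive_cos.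
        * apply is_derive_pow. apply is_derive_sin.
        * intros; apply Rmult_comm.
      + unfold plus, mult, opp; simpl.
        replace (Init.Nat.pred (n + 1)) with n by lia.
        rewrite !plus_INR; simpl INR. rewrite !pow_add. simpl pow.
        assert (E := sin2_cos2 x). unfold Rsqr in E.
        replace (cos x * cos x) with (1 - sin x * sin x) by lra.
        transitivity (sin x ^ n * (sin x * sin x + - (INR n + 1) * (cos x * cos x))); [ring|].
        replace (cos x * cos x) with (1 - sin x * sin x) by lra. ring.
    - intros x _. apply (continuous_minus (fun x => INR (n + 2) * sin x ^ (n + 2)) (fun x => INR (n + 1) * sin x ^ n)).
      + apply (continuous_scal_r (INR (n + 2)) (fun x => sin x ^ (n + 2))). apply sin_pow_cont.
      + apply (continuous_scal_r (INR (n + 1)) (fun x => sin x ^ n)). apply sin_pow_cont. }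
  assert (H2 : is_RInt (fun x => INR (n + 2) * sin x ^ (n + 2) - INR (n + 1) * sin x ^ n) 0 (PI / 2)
     (INR (n + 2) * wallis (n + 2) - INR (n + 1) * wallis n)).
  { apply (is_RInt_minus (fun x => INR (n + 2) * sin x ^ (n + 2)) (fun x => INR (n + 1) * sin x ^ n));
    apply (is_RInt_scal (V := R_NormedModule)); apply wallis_is. }
  assert (E := is_RInt_unique _ _ _ _ H). rewrite (is_RInt_unique _ _ _ _ H2) in E.
  rewrite cos_PI2, sin_0, pow_i in E by lia. unfold minus, plus, opp in E; simpl in E. lra.
Qed.

Lemma wallis_pos n : 0 < wallis n.
Proof.
  apply RInt_gt_0; [generalize PI_RGT_0; lra| |intros; apply sin_pow_cont].
  intros x Hx. apply pow_lt. apply sin_gt_0; generalize PI_RGT_0; lra.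
Qed.

Lemma wallis_decr n : wallis (S n) <= wallis n.
Proof.
  apply RInt_le.
  - generalize PI_RGT_0; lra.
  - eexists; apply wallis_is.
  - eexists; apply wallis_is.
  - intros x Hx. simpl. assert (0 < sin x) by (apply sin_gt_0; generalize PI_RGT_0; lra).
    assert (0 < sin x ^ n) by (apply pow_lt; auto). generalize (SIN_bound x). intros. nra.
Qed.

Lemma wallis_0 : wallis 0 = PI / 2.
Proof.
  apply is_RInt_unique. simpl. evar_last; [apply (is_RInt_const (V := R_NormedModule))|].
  unfold scal; simpl; unfold mult; simpl. ring.
Qed.

Lemma wallis_1 : wallis 1 = 1.
Proof.
  apply is_RInt_unique.
  evar_last; [apply (is_RInt_derive (fun x => - cos x) (fun x => sin x ^ 1))|].
  - intros x _. evar_last; [apply @is_derive_opp; apply is_derive_cos|]. unfold opp; simpl; ring.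
  - intros; apply sin_pow_cont.
  - unfold minus, plus, opp; simpl. rewrite cos_PI2, cos_0. ring.
Qed.

Lemma wallis_prod n : INR (S n) * wallis (S n) * wallis n = PI / 2.
Proof.
  induction n.
  - rewrite wallis_0, wallis_1. simpl. ring.
  - assert (E := wallis_rec n). replace (n + 2)%nat with (S (S n)) in E by lia.
    replace (n + 1)%nat with (S n) in E by lia. rewrite E. rewrite <- IHn. ring.
Qed.

Lemma wallis_even n : wallis (2 * n) = INR (fact (2 * n)) / (4 ^ n * INR (fact n) ^ 2) * (PI / 2).
Proof.
  induction n.
  - rewrite Nat.mul_0_r, wallis_0. simpl. field.
  - assert (E := wallis_rec (2 * n)). rewrite IHn in E.
    replace (2 * n + 2)%nat with (2 * S n)%nat in E by lia.
    replace (2 * S n)%nat with (S (S (2 * n))) at 2 by lia.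
    replace (fact (S (S (2 * n)))) with (S (S (2 * n)) * (S (2 * n) * fact (2 * n)))%nat by reflexivity.
    replace (fact (S n)) with (S n * fact n)%nat by reflexivity.
    assert (Hn : INR (2 * S n) = 2 * (INR n + 1)) by (rewrite mult_INR, (S_INR n); simpl; ring).
    rewrite Hn in E.
    assert (P := pos_INR n). assert (F := INR_fact_lt_0 n). assert (G : 0 < 4 ^ n) by (apply pow_lt; lra).
    apply (Rmult_eq_reg_l (2 * (INR n + 1))); [|lra]. rewrite E.
    rewrite !mult_INR, !S_INR, plus_INR, !mult_INR. simpl INR. simpl pow. field. repeat split; lra.
Qed.

(** Write [W_n] for [wallis n] and [N = 2 n + 1]. Monotonicity squeezes [W_(2n)] between [W_(2n+1)]
    and [(1 + 1 / N) W_(2n+1)], and [N W_(2n+1) W_(2n) = PI / 2]. *)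
Lemma wallis_lim : is_lim_seq (fun n => INR (2 * n + 1) * wallis (2 * n) ^ 2) (PI / 2).
Proof.
  apply is_lim_seq_le_le with (u := fun _ => PI / 2) (w := fun n => PI / 2 * (1 + / INR (2 * n + 1))).
  - intros n. assert (E := wallis_prod (2 * n)). replace (S (2 * n)) with (2 * n + 1)%nat in E by lia.
    assert (D1 := wallis_decr (2 * n)). replace (S (2 * n)) with (2 * n + 1)%nat in D1 by lia.
    assert (D2 := wallis_decr (2 * n + 1)).
    assert (E2 := wallis_rec (2 * n)). replace (S (2 * n + 1)) with (2 * n + 2)%nat in D2 by lia.
    assert (P0 := wallis_pos (2 * n)). assert (P1 := wallis_pos (2 * n + 1)).
    set (N := INR (2 * n + 1)) in *.
    assert (HN : INR (2 * n + 2) = N + 1). { unfold N. replace (2 * n + 2)%nat with (S (2 * n + 1)) by lia. apply S_INR. }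
    assert (HN0 : 0 < N) by (unfold N; apply lt_0_INR; lia).
    rewrite HN in E2. split.
    + rewrite <- E. rewrite Rmult_assoc. apply Rmult_le_compat_l; [lra|].
      rewrite <- Rsqr_pow2. apply Rmult_le_compat_r; lra.
    + apply (Rmult_le_reg_l N); auto.
      replace (N * (PI / 2 * (1 + / N))) with ((N + 1) * (PI / 2)) by (field; lra).
      rewrite <- E.
      apply Rle_trans with ((N + 1) * (N * wallis (2 * n + 2) * wallis (2 * n))).
      * replace ((N + 1) * (N * wallis (2 * n + 2) * wallis (2 * n))) with (N * ((N + 1) * wallis (2 * n + 2)) * wallis (2 * n)) by ring.
        rewrite E2. right; ring.
      * apply Rmult_le_compat_l; [lra|]. apply Rmult_le_compat_r; [lra|]. apply Rmult_le_compat_l; lra.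
  - apply is_lim_seq_const.
  - replace (PI / 2) with (PI / 2 * (1 + 0)) at 1 by ring.
    apply (is_lim_seq_scal_l _ (PI / 2) (1 + 0)).
    apply is_lim_seq_plus'; [apply is_lim_seq_const|].
    replace (Finite 0) with (Rbar_inv p_infty) by reflexivity.
    apply is_lim_seq_inv; [|discriminate].
    apply (is_lim_seq_subseq INR p_infty (fun n => (2 * n + 1)%nat)).
    + apply eventually_subseq. intros; lia.
    + apply is_lim_seq_INR.
Qed.

(** Taking logarithms in Wallis's product gives an expression in [2 u(2n) - 4 u(n)] in which the
    growing terms cancel. Its limit is a linear equation with [l] as the only unknown. *)
Lemma stirling_const (l : R) :
  is_lim_seq (fun n => ln (INR (fact n)) - (INR n + 1 / 2) * ln (INR n) + INR n) l ->
  l = ln (2 * PI) / 2.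
Proof.
  set (u := fun n => ln (INR (fact n)) - (INR n + 1 / 2) * ln (INR n) + INR n).
  intros Hl. assert (HPI := PI_RGT_0).
  assert (H2l : is_lim_seq (fun n => u (2 * n)%nat) l).
  { apply (is_lim_seq_subseq u l (fun n => (2 * n)%nat)); auto. apply eventually_subseq; intros; lia. }
  assert (L1 : is_lim_seq (fun n => ln (INR (2 * n + 1) * wallis (2 * n) ^ 2)) (ln (PI / 2))).
  { apply is_lim_seq_continuous; [|apply wallis_lim].
    apply derivable_continuous_pt. exists (/ (PI / 2)). apply derivable_pt_lim_ln. lra. }
  assert (L2 : is_lim_seq (fun n => 2 * ln 2 + ln (1 + / (2 * INR n)) + 2 * u (2 * n)%nat - 4 * u n + 2 * ln (PI / 2))
     (2 * ln 2 + 0 + 2 * l - 4 * l + 2 * ln (PI / 2))).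
  { apply is_lim_seq_plus'; [|apply is_lim_seq_const].
    apply is_lim_seq_minus'; [|apply (is_lim_seq_scal_l _ 4 l Hl)].
    apply is_lim_seq_plus'; [|apply (is_lim_seq_scal_l _ 2 l H2l)].
    apply is_lim_seq_plus'; [apply is_lim_seq_const|].
    replace 0 with (ln (1 + 0)) by (rewrite Rplus_0_r; apply ln_1).
    apply (is_lim_seq_continuous ln (fun n => 1 + / (2 * INR n))).
    - apply derivable_continuous_pt. exists (/ (1 + 0)). apply derivable_pt_lim_ln. lra.
    - apply is_lim_seq_plus'; [apply is_lim_seq_const|].
      replace (Finite 0) with (Rbar_inv p_infty) by reflexivity.
      apply is_lim_seq_inv; [|discriminate].
      evar_last; [apply (is_lim_seq_scal_l INR 2 p_infty is_lim_seq_INR)|].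
      simpl. case Rle_dec; [intros H; case Rle_lt_or_eq_dec; auto; intros; lra|intros; lra]. }
  assert (L3 : is_lim_seq (fun n => ln (INR (2 * n + 1) * wallis (2 * n) ^ 2))
     (2 * ln 2 + 0 + 2 * l - 4 * l + 2 * ln (PI / 2))).
  { apply is_lim_seq_ext_loc with (2 := L2). exists 1%nat. intros n Hn.
    assert (HN : 0 < INR n) by (apply lt_0_INR; lia).
    assert (F := INR_fact_lt_0 n). assert (F2 := INR_fact_lt_0 (2 * n)). assert (G : 0 < 4 ^ n) by (apply pow_lt; lra).
    assert (W := wallis_pos (2 * n)).
    rewrite ln_mult; [|apply lt_0_INR; lia|apply pow_lt; auto].
    rewrite ln_pow by auto. rewrite wallis_even.
    assert (Hd : 0 < 4 ^ n * INR (fact n) ^ 2) by (apply Rmult_lt_0_compat; auto; apply pow_lt; auto).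
    rewrite (ln_mult (INR (fact (2 * n)) / _)); [|apply Rdiv_lt_0_compat; auto|lra].
    rewrite (ln_div (INR (fact (2 * n))) (4 ^ n * INR (fact n) ^ 2)) by auto.
    rewrite (ln_mult (4 ^ n)); auto; [|apply pow_lt; auto].
    rewrite (ln_pow 4) by lra. rewrite (ln_pow (INR (fact n))) by auto.
    unfold u. rewrite plus_INR, mult_INR. simpl INR.
    replace ((1 + 1) * INR n + 1) with ((2 * INR n) * (1 + / (2 * INR n))) by (field; lra).
    assert (0 < / (2 * INR n)) by (apply Rinv_0_lt_compat; lra).
    rewrite (ln_mult (2 * INR n)); [|lra|lra].
    replace ((1 + 1) * INR n) with (2 * INR n) by ring.
    rewrite (ln_mult 2 (INR n)); [|lra|auto].
    replace 4 with (2 * 2) by ring. rewrite (ln_mult 2 2) by lra. field. }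
  assert (E : Finite (ln (PI / 2)) = Finite (2 * ln 2 + 0 + 2 * l - 4 * l + 2 * ln (PI / 2))).
  { rewrite <- (is_lim_seq_unique _ _ L1). apply is_lim_seq_unique. auto. }
  injection E; intros E'.
  rewrite ln_div in E' by lra.
  rewrite ln_mult by lra. lra.
Qed.

(** * The Stirling series of [ln Gamma (z + a)] *)

Lemma csum_ext n f g : (forall k, (k < n)%nat -> f k = g k) -> csum n f = csum n g.
Proof. intros H; induction n; simpl; auto. rewrite IHn, H; auto. Qed.

Lemma csum_S_l n f : (csum (S n) f = f 0%nat + csum n (fun k => f (S k)))%C.
Proof. induction n; cbn [csum] in *; [ring|]. rewrite IHn. ring. Qed.

Lemma csum_plus n f g : (csum n (fun k => f k + g k) = csum n f + csum n g)%C.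
Proof. induction n; simpl; [ring|rewrite IHn; ring]. Qed.

Lemma csum_minus n f g : (csum n (fun k => f k - g k) = csum n f - csum n g)%C.
Proof. induction n; simpl; [ring|rewrite IHn; ring]. Qed.

Lemma csum_scal n c f : (csum n (fun k => c * f k) = c * csum n f)%C.
Proof. induction n; simpl; [ring|rewrite IHn; ring]. Qed.

Lemma csum_RtoC n f : csum n (fun k => RtoC (f k)) = RtoC (rsum n f).
Proof. induction n; simpl; auto. rewrite IHn, RtoC_plus; auto. Qed.

Lemma csum_bound n f b : (forall k, (k < n)%nat -> Cmod (f k) <= b k) -> Cmod (csum n f) <= rsum n b.
Proof.
  intros H; induction n; simpl; [rewrite Cmod_0; lra|].
  eapply Rle_trans; [apply Cmod_triangle|]. apply Rplus_le_compat; auto.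
Qed.

(** Regrouping by the total index [n + i]. It serves both for the Bernoulli convolution and for the
    recursion of the [l_r]. *)
Lemma csum_triangle K (g : nat -> nat -> C) :
  csum K (fun n => csum (K - n) (fun i => g n (n + i)%nat)) = csum K (fun l => csum (S l) (fun n => g n l)).
Proof.
  induction K; auto. cbn [csum]. replace (S K - K)%nat with 1%nat by lia. cbn [csum].
  rewrite Nat.add_0_r.
  rewrite (csum_ext K _ (fun n => csum (K - n) (fun i => g n (n + i)%nat) + g n K)%C).
  - rewrite csum_plus, IHK. cbn [csum]. ring.
  - intros k Hk. replace (S K - k)%nat with (S (K - k)) by lia. cbn [csum].
    replace (k + (K - k))%nat with K by lia. reflexivity.
Qed.

(** The [n]-th derivative of [z ln z - z]. *)
Definition psi (n : nat) (z : C) : C :=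
  match n with
  | O => z * clog z - z
  | S O => clog z
  | S (S k) => RtoC ((-1) ^ k * INR (fact k)) / Cpow z (S k)
  end%C.
Lemma dC_psi n (f : R -> C) x l : slit (f x) -> dC f x l ->
  dC (fun t => psi n (f t)) x (l * psi (S n) (f x))%C.
Proof.
  intros Hs Hf. assert (Hn := slit_neq_0 _ Hs).
  destruct n as [|[|k]]; unfold psi; fold psi.
  - eapply dC_eq; [|apply dC_minus; [apply dC_mult; [apply Hf|apply dC_clog; eauto]|apply Hf]].
    cbv beta. field. auto.
  - eapply dC_eq; [|apply dC_clog; eauto]. simpl. rewrite Rmult_1_r. field. auto.
  - eapply dC_eq; [|apply dC_scal; apply dC_inv; [apply Cpow_nz; auto|apply dC_pow; apply Hf]].
    assert (Hp : Cpow (f x) k <> 0) by (apply Cpow_nz; auto).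
    replace ((-1) ^ S k * INR (fact (S k))) with (- ((-1) ^ k * INR (fact k)) * INR (S k)).
    2: { change (fact (S k)) with (S k * fact k)%nat. rewrite mult_INR. simpl pow. ring. }
    set (q := (-1) ^ k * INR (fact k)).
    rewrite !Cpow_S, (RtoC_mult (- q)), RtoC_opp. field. auto.
Qed.

(** The sequence [f] lists successive derivatives. The derivative of a Taylor remainder is the
    remainder of one order less for the shifted sequence, and each integration by [dC_bound]
    contributes a factor [2]. *)
Lemma taylor_bound (T M : R) (N : nat) : forall (f : nat -> R -> C),
  (forall i t, (i < N)%nat -> Rmin 0 T <= t <= Rmax 0 T -> dC (f i) t (f (S i) t)) ->
  (forall t, Rmin 0 T <= t <= Rmax 0 T -> Cmod (f N t) <= M) ->
  forall x, Rmin 0 T <= x <= Rmax 0 T ->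
  Cmod (f 0%nat x - csum N (fun i => RtoC (x ^ i / INR (fact i)) * f i 0))%C <= 2 ^ N * M * Rabs x ^ N.
Proof.
  induction N; intros f Hd Hb x Hx.
  - simpl. replace (f 0%nat x - 0)%C with (f 0%nat x) by ring. rewrite Rmult_1_r, Rmult_1_l. auto.
  - set (h := fun t => (f 0%nat t - csum (S N) (fun i => RtoC (t ^ i / INR (fact i)) * f i 0))%C).
    set (h' := fun t => (f 1%nat t - csum N (fun i => RtoC (t ^ i / INR (fact i)) * f (S i) 0))%C).
    assert (HM : 0 <= M) by (eapply Rle_trans; [apply Cmod_ge_0|apply (Hb x); auto]).
    assert (I0 : Rmin 0 T <= 0 <= Rmax 0 T) by (split; [apply Rmin_l|apply Rmax_l]).
    assert (Hh : Cmod (h x - h 0) <= 2 * (2 ^ N * M * Rabs x ^ N) * Rabs (x - 0)).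
    { apply (dC_bound h h'). intros t Ht.
      assert (It : Rmin 0 T <= t <= Rmax 0 T).
      { split; eapply Rle_trans; [|apply Ht|apply Ht|]; [apply Rmin_glb|apply Rmax_lub]; lra. }
      assert (Htx : Rabs t <= Rabs x).
      { unfold Rabs. destruct (Rcase_abs t), (Rcase_abs x); unfold Rmin, Rmax in Ht;
        destruct (Rle_dec 0 x); lra. }
      split.
      - unfold h, h'. apply dC_minus; [apply Hd; [lia|auto]|].
        apply dC_ext with (fun t => RtoC (0 ^ 0 / INR (fact 0)) * f 0%nat 0 + csum N (fun i => RtoC (t ^ S i / INR (fact (S i))) * f (S i) 0))%C.
        { intros u. rewrite csum_S_l. simpl. reflexivity. }
        eapply dC_eq; [apply Cplus_0_l|]. apply dC_plus; [apply dC_const|].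
        apply (dC_csum N (fun i u => RtoC (u ^ S i / INR (fact (S i))) * f (S i) 0)%C). intros i Hi.
        apply dC_ext with (fun u => (RtoC (/ INR (fact (S i))) * f (S i) 0) * Cpow (RtoC u) (S i))%C.
        { intros u. rewrite <- RtoC_pow. unfold Rdiv. rewrite RtoC_mult. ring. }
        eapply dC_eq; [|apply dC_scal; apply dC_pow; apply dC_id].
        rewrite <- RtoC_pow. unfold Rdiv. rewrite RtoC_mult.
        replace (RtoC (/ INR (fact i))) with (RtoC (INR (S i)) * RtoC (/ INR (fact (S i))))%C; [ring|].
        rewrite <- RtoC_mult. f_equal. change (fact (S i)) with (S i * fact i)%nat. rewrite mult_INR.
        field. split; [apply INR_fact_neq_0|apply not_0_INR; lia].
      - eapply Rle_trans; [apply (IHN (fun i => f (S i))); auto|].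
        + intros i u Hi Hu. apply Hd; auto. lia.
        + apply Rmult_le_compat_l; [apply Rmult_le_pos; auto; apply pow_le; lra|].
          apply pow_incr. split; auto. apply Rabs_pos. }
    assert (h0 : h 0 = 0).
    { unfold h. rewrite csum_S_l. rewrite (csum_ext N _ (fun _ => 0)).
      - replace (csum N (fun _ => 0)) with (RtoC 0).
        + simpl. replace (1 / 1) with 1 by field. ring.
        + clear. induction N; simpl; auto. rewrite <- IHN. ring.
      - intros k _. rewrite pow_i by lia. unfold Rdiv. rewrite Rmult_0_l. ring. }
    rewrite h0 in Hh. replace (h x - 0)%C with (h x) in Hh by ring. rewrite Rminus_0_r in Hh.
    unfold h in Hh. eapply Rle_trans; [apply Hh|]. simpl. right; ring.
Qed.

Section Stirling.
Variables (a : R) (K : nat).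
Hypothesis HK : (2 <= K)%nat.

Definition bcoef (n : nat) : R := bernoulli_poly n a / INR (fact n).
(** Formally [stirling_sum = (D / (e^D - 1)) e^(a D) (z ln z - z)] with [D = d/dz], so that
    [(e^D - 1) stirling_sum = D e^(a D) (z ln z - z) = ln (z + a)]. *)
Definition stirling_sum (z : C) : C := csum K (fun n => RtoC (bcoef n) * psi n z)%C.
(** The error in the difference equation [F (z + 1) - F z = ln (z + a)] satisfied by
    [ln Gamma (z + a)]. *)
Definition stirling_defect (z : C) : C := (stirling_sum (z + 1) - stirling_sum z - clog (z + RtoC a))%C.

Lemma psi_taylor (z : C) (T M : R) (n N : nat) :
  (forall t, Rmin 0 T <= t <= Rmax 0 T -> slit (z + RtoC t) /\ Cmod (psi (n + N) (z + RtoC t)) <= M) ->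
  Cmod (psi n (z + RtoC T) - csum N (fun i => RtoC (T ^ i / INR (fact i)) * psi (n + i) z))%C
    <= 2 ^ N * M * Rabs T ^ N.
Proof.
  intros H. assert (X := taylor_bound T M N (fun i t => psi (n + i) (z + RtoC t))).
  cbv beta in X. rewrite Nat.add_0_r in X.
  replace (z + 0)%C with z in X by ring. apply X.
  - intros i t Hi Ht. eapply dC_eq; [|apply dC_psi; [apply H; auto|apply dC_plus; [apply dC_const|apply dC_id]]].
    rewrite Nat.add_succ_r. ring.
  - intros t Ht. apply H; auto.
  - split; [apply Rmin_r|apply Rmax_r].
Qed.

(** Beyond this radius the shifts by real numbers of absolute value at most [1 + |a|] change [z] by
    at most [|z| / 2]. *)
Definition stirling_radius : R := 2 * (1 + Rabs a).

(** Collecting the multiples of [psi (S l) z] leaves the convolution of [bernoulli_conv] as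
    coefficient. *)
Lemma stirling_defect_identity (z : C) :
  (csum K (fun n => RtoC (bcoef n) * csum (K - n) (fun i => RtoC (/ INR (fact (S i))) * psi (n + S i) z))
   = csum K (fun l => RtoC (a ^ l / INR (fact l)) * psi (S l) z))%C.
Proof.
  rewrite (csum_ext K _ (fun n => csum (K - n) (fun i =>
     (fun n l => RtoC (bcoef n * / INR (fact (S l - n))) * psi (S l) z) n (n + i)%nat))%C).
  - rewrite (csum_triangle K (fun n l => RtoC (bcoef n * / INR (fact (S l - n))) * psi (S l) z)%C).
    apply csum_ext. intros l Hl.
    rewrite (csum_ext (S l) _ (fun n => psi (S l) z * RtoC (bcoef n * / INR (fact (S l - n))))%C).
    2: intros; apply Cmult_comm.
    rewrite csum_scal, csum_RtoC. unfold bcoef.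
    change (rsum (S l) (fun k => bernoulli_poly k a / INR (fact k) * / INR (fact (S l - k))))
      with (rsum (S l) (fun k => bernoulli_poly k a / INR (fact k) / INR (fact (S l - k)))).
    rewrite bernoulli_conv. apply Cmult_comm.
  - intros n Hn. rewrite <- csum_scal. apply csum_ext. intros i Hi.
    replace (S (n + i) - n)%nat with (S i) by lia. rewrite Nat.add_succ_r, RtoC_mult. ring.
Qed.

(** Both [F (z + 1)] and [ln (z + a)] are expanded at [z] up to the order where the remainder
    involves [psi (K + 1)], of size [(K - 1)! / |z|^K]. All lower terms cancel by
    [stirling_defect_identity]. *)
Lemma stirling_defect_large : exists CD, 0 <= CD /\ forall z, slit z -> stirling_radius <= Cmod z ->
  Cmod (stirling_defect z) <= CD / Cmod z ^ K.
Proof.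
  destruct K as [|[|k]] eqn:EK; try lia. rewrite <- EK in *.
  set (P := INR (fact (S k)) * 2 ^ K).
  exists ((rsum K (fun n => Rabs (bcoef n)) * 2 ^ (K + 1) + 2 ^ K * Rabs a ^ K) * P).
  assert (HP : 0 <= P) by (apply Rmult_le_pos; [apply pos_INR|apply pow_le; lra]).
  assert (Hsum : 0 <= rsum K (fun n => Rabs (bcoef n))).
  { clear. induction K; simpl; [lra|]. generalize (Rabs_pos (bcoef n)); lra. }
  split.
  { apply Rmult_le_pos; auto. apply Rplus_le_le_0_compat; apply Rmult_le_pos; auto; try (apply pow_le; lra).
    apply pow_le, Rabs_pos. }
  intros z Hs Hz. unfold stirling_radius in Hz.
  assert (Ha := Rabs_pos a).
  assert (Hz0 : 0 < Cmod z) by lra.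
  (* The segments from [z] to [z + 1] and to [z + a] avoid the cut: a nonreal [z] keeps its
     imaginary part, and a real [z] in [slit] is positive and at least twice as large as the
     shift. *)
  assert (Seg : forall T, (T = 1 \/ T = a) -> forall t, Rmin 0 T <= t <= Rmax 0 T ->
     slit (z + RtoC t) /\ Cmod (psi (K + 1) (z + RtoC t)) <= P / Cmod z ^ K).
  { intros T HT t Ht.
    assert (Htb : Rabs t <= Cmod z / 2).
    { assert (Rabs t <= 1 + Rabs a); [|lra].
      destruct HT as [-> | ->].
      - rewrite Rmin_left, Rmax_right in Ht by lra. rewrite Rabs_pos_eq; lra.
      - unfold Rmin, Rmax in Ht. destruct (Rle_dec 0 a).
        + rewrite !Rabs_pos_eq by lra. lra.
        + rewrite !Rabs_left1 by lra. lra. }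
    assert (Hsl : slit (z + RtoC t)).
    { destruct Hs as [Hx|Hy]; [|right; simpl; lra].
      destruct (Req_dec (snd z) 0) as [E|E]; [|right; simpl; lra].
      left. simpl. assert (Cmod z = fst z).
      { unfold Cmod. rewrite E. replace (fst z ^ 2 + 0 ^ 2) with (fst z ^ 2) by ring. rewrite sqrt_pow2; lra. }
      apply Rabs_le_between in Htb. lra. }
    split; auto.
    assert (Hm : Cmod z / 2 <= Cmod (z + RtoC t)).
    { eapply Rle_trans; [|apply Cmod_triangle_rev]. rewrite Cmod_R. lra. }
    replace (K + 1)%nat with (S (S (S k))) by lia. unfold psi.
    rewrite Cmod_div by (apply Cpow_nz, slit_neq_0; auto).
    rewrite Cmod_R, Cmod_pow. rewrite Rabs_mult, pow_1_abs, Rmult_1_l, (Rabs_pos_eq (INR _)) by apply pos_INR.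
    replace (S (S k)) with K by lia.
    unfold P, Rdiv. rewrite Rmult_assoc. apply Rmult_le_compat_l; [apply pos_INR|].
    apply Rle_trans with (/ (Cmod z / 2) ^ K).
    - apply Rinv_le_contravar; [apply pow_lt; lra|]. apply pow_incr. lra.
    - right. unfold Rdiv. rewrite Rpow_mult_distr, pow_inv. field. split; apply pow_nonzero; lra. }
  set (M := P / Cmod z ^ K) in *.
  assert (HM : 0 <= M) by (apply Rmult_le_pos; auto; left; apply Rinv_0_lt_compat, pow_lt; auto).
  set (rem := fun n => (psi n (z + 1) - csum (K + 1 - n) (fun i => RtoC (1 ^ i / INR (fact i)) * psi (n + i) z))%C).
  assert (Hrem : forall n, (n < K)%nat -> Cmod (rem n) <= 2 ^ (K + 1) * M).
  { intros n Hn. unfold rem. eapply Rle_trans; [apply (psi_taylor z 1 M n (K + 1 - n))|].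
    - replace (n + (K + 1 - n))%nat with (K + 1)%nat by lia. apply Seg. auto.
    - rewrite Rabs_R1, pow1, Rmult_1_r. apply Rmult_le_compat_r; auto.
      apply Rle_pow; [lra|lia]. }
  assert (Hrem' : Cmod (psi 1 (z + RtoC a) - csum K (fun i => RtoC (a ^ i / INR (fact i)) * psi (1 + i) z))%C
     <= 2 ^ K * M * Rabs a ^ K).
  { apply psi_taylor. replace (1 + K)%nat with (K + 1)%nat by lia. apply Seg. auto. }
  (* The defect consists of Taylor remainders only. *)
  assert (E : stirling_defect z = (csum K (fun n => RtoC (bcoef n) * rem n)
      - (psi 1 (z + RtoC a) - csum K (fun i => RtoC (a ^ i / INR (fact i)) * psi (1 + i) z)))%C).
  { unfold stirling_defect, stirling_sum. change (psi 1 (z + RtoC a)) with (clog (z + RtoC a)).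
    change (csum K (fun i => RtoC (a ^ i / INR (fact i)) * psi (1 + i) z)%C)
      with (csum K (fun l => RtoC (a ^ l / INR (fact l)) * psi (S l) z)%C).
    rewrite <- stirling_defect_identity.
    assert (E1 : forall n, (n < K)%nat -> rem n = (psi n (z + 1) - psi n z -
       csum (K - n) (fun i => RtoC (/ INR (fact (S i))) * psi (n + S i) z))%C).
    { intros n Hn. unfold rem. replace (K + 1 - n)%nat with (S (K - n)) by lia. rewrite csum_S_l.
      rewrite Nat.add_0_r. replace (1 ^ 0 / INR (fact 0)) with 1 by (simpl; field).
      rewrite (csum_ext (K - n) _ (fun i => RtoC (/ INR (fact (S i))) * psi (n + S i) z)%C).
      - ring.
      - intros i _. rewrite pow1. unfold Rdiv. rewrite Rmult_1_l. auto. }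
    rewrite (csum_ext K (fun n => RtoC (bcoef n) * rem n)%C (fun n => (RtoC (bcoef n) * psi n (z + 1) - RtoC (bcoef n) * psi n z)
       - RtoC (bcoef n) * csum (K - n) (fun i => RtoC (/ INR (fact (S i))) * psi (n + S i) z))%C).
    2: { intros n Hn. rewrite E1 by auto. ring. }
    rewrite !csum_minus. ring. }
  rewrite E. eapply Rle_trans; [apply Cmod_triangle_sub|].
  assert (B1 : Cmod (csum K (fun n => RtoC (bcoef n) * rem n)%C) <= rsum K (fun n => Rabs (bcoef n)) * (2 ^ (K + 1) * M)).
  { rewrite Rmult_comm, <- rsum_scal. apply csum_bound. intros n Hn. rewrite Cmod_mult, Cmod_R, Rmult_comm.
    apply Rmult_le_compat_r; [apply Rabs_pos|auto]. }
  unfold M in *. unfold Rdiv in *. nra.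
Qed.

Lemma psi_bounded (n : nat) (lo hi : R) : 0 < lo ->
  exists Bd, 0 <= Bd /\ forall z, lo <= Cmod z <= hi -> Cmod (psi n z) <= Bd.
Proof.
  intros Hlo.
  assert (Hlog : forall z, lo <= Cmod z <= hi -> Cmod (clog z) <= Rabs (ln lo) + Rabs (ln hi) + PI).
  { intros z Hz. eapply Rle_trans; [apply clog_bound|]. apply Rplus_le_compat_r.
    assert (ln lo <= ln (Cmod z)) by (apply ln_le; lra).
    assert (ln (Cmod z) <= ln hi) by (apply ln_le; lra).
    generalize (Rle_abs (- ln lo)) (Rle_abs (ln hi)) (Rabs_pos (ln lo)) (Rabs_pos (ln hi)). rewrite Rabs_Ropp.
    intros. apply Rabs_le. lra. }
  set (LB := Rabs (ln lo) + Rabs (ln hi) + PI) in *.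
  assert (HLB : 0 <= LB) by (unfold LB; generalize (Rabs_pos (ln lo)) (Rabs_pos (ln hi)) PI_RGT_0; lra).
  assert (Hhi : forall z, lo <= Cmod z <= hi -> Cmod z <= Rabs hi).
  { intros z Hz. generalize (Rle_abs hi); lra. }
  destruct n as [|[|k]].
  - exists (Rabs hi * LB + Rabs hi). split. { generalize (Rabs_pos hi); nra. }
    intros z Hz. unfold psi. eapply Rle_trans; [apply Cmod_triangle_sub|]. rewrite Cmod_mult.
    apply Rplus_le_compat; auto. apply Rmult_le_compat; auto; apply Cmod_ge_0.
  - exists LB; auto.
  - exists (INR (fact k) * / lo ^ S k). split.
    { apply Rmult_le_pos; [apply pos_INR|left; apply Rinv_0_lt_compat, pow_lt; auto]. }
    intros z Hz. unfold psi.
    rewrite Cmod_div by (apply Cpow_nz, Cmod_gt_0; lra).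
    rewrite Cmod_R, Cmod_pow, Rabs_mult, pow_1_abs, Rmult_1_l, (Rabs_pos_eq (INR _)) by apply pos_INR.
    apply Rmult_le_compat_l; [apply pos_INR|]. apply Rinv_le_contravar; [apply pow_lt; auto|].
    apply pow_incr. lra.
Qed.

Lemma stirling_sum_bounded (lo hi : R) : 0 < lo ->
  exists Bd, 0 <= Bd /\ forall z, lo <= Cmod z <= hi -> Cmod (stirling_sum z) <= Bd.
Proof.
  intros Hlo. unfold stirling_sum. clear HK. induction K as [|k [B [HB IH]]].
  - exists 0. split; [lra|]. intros; simpl. rewrite Cmod_0; lra.
  - destruct (psi_bounded k lo hi Hlo) as [B2 [HB2 H2]].
    exists (B + Rabs (bcoef k) * B2). split.
    { generalize (Rabs_pos (bcoef k)); nra. }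
    intros z Hz. cbn [csum]. eapply Rle_trans; [apply Cmod_triangle|].
    apply Rplus_le_compat; auto. rewrite Cmod_mult, Cmod_R.
    apply Rmult_le_compat_l; auto. apply Rabs_pos.
Qed.

Lemma abs_im_le (z : C) (t : R) : Rabs (snd z) <= Cmod (z + RtoC t).
Proof. generalize (abs_snd_le (z + RtoC t)%C). simpl. rewrite Rplus_0_r. auto. Qed.

(** A distance [eta] from the real axis excludes both the cut and the singularity at [0]. For [|z|]
    below [stirling_radius] the defect is merely bounded, and the constant absorbs the factor
    [|z|^K]. The real part of [z] is unrestricted. *)
Lemma stirling_defect_im (eta : R) : 0 < eta -> exists CD, 0 <= CD /\ forall z, eta <= Rabs (snd z) ->
  Cmod (stirling_defect z) <= CD / Cmod z ^ K.
Proof.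
  intros He. destruct stirling_defect_large as [C1 [HC1 H1]].
  set (hi := stirling_radius + 1 + Rabs a).
  destruct (stirling_sum_bounded eta hi He) as [B1 [HB1 HF]].
  destruct (psi_bounded 1 eta hi He) as [B2 [HB2 HL]].
  assert (Ha := Rabs_pos a).
  assert (HR : 0 < stirling_radius) by (unfold stirling_radius; lra).
  exists (C1 + (2 * B1 + B2) * stirling_radius ^ K).
  assert (HRK : 0 < stirling_radius ^ K) by (apply pow_lt; auto).
  split; [nra|].
  intros z Hz.
  assert (Hzm : eta <= Cmod z) by (eapply Rle_trans; [apply Hz|apply abs_snd_le]).
  assert (Hzk : 0 < Cmod z ^ K) by (apply pow_lt; lra).
  destruct (Rle_lt_dec stirling_radius (Cmod z)) as [H|H].
  - eapply Rle_trans; [apply H1; auto|].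
    + right. intros E. rewrite E, Rabs_R0 in Hz. lra.
    + apply Rmult_le_compat_r; [left; apply Rinv_0_lt_compat; auto|nra].
  - assert (HD : Cmod (stirling_defect z) <= 2 * B1 + B2).
    { unfold stirling_defect. eapply Rle_trans; [apply Cmod_triangle_sub|].
      apply Rplus_le_compat.
      - eapply Rle_trans; [apply Cmod_triangle_sub|].
        assert (Cmod (stirling_sum (z + 1)) <= B1).
        { apply HF. split; [eapply Rle_trans; [apply Hz|apply (abs_im_le z 1)]|].
          eapply Rle_trans; [apply Cmod_triangle|]. rewrite Cmod_1. unfold hi; lra. }
        assert (Cmod (stirling_sum z) <= B1) by (apply HF; unfold hi; lra). lra.
      - apply HL. split; [eapply Rle_trans; [apply Hz|apply abs_im_le]|].
        eapply Rle_trans; [apply Cmod_triangle|]. rewrite Cmod_R. unfold hi; lra. }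
    eapply Rle_trans; [apply HD|].
    apply (Rmult_le_reg_r (Cmod z ^ K)); auto.
    replace ((C1 + (2 * B1 + B2) * stirling_radius ^ K) / Cmod z ^ K * Cmod z ^ K) with (C1 + (2 * B1 + B2) * stirling_radius ^ K) by (field; lra).
    assert (Cmod z ^ K <= stirling_radius ^ K) by (apply pow_incr; split; [apply Cmod_ge_0|lra]).
    nra.
Qed.
End Stirling.

(** * Limits and series of complex numbers *)

Definition limC (u : nat -> C) (l : C) : Prop :=
  is_lim_seq (fun n => fst (u n)) (fst l) /\ is_lim_seq (fun n => snd (u n)) (snd l).
Lemma limC_const c : limC (fun _ => c) c.
Proof. split; apply is_lim_seq_const. Qed.

Lemma limC_ext_loc u v l : eventually (fun n => u n = v n) -> limC u l -> limC v l.
Proof.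
  intros H [a b]; split.
  - eapply is_lim_seq_ext_loc; [|apply a]. apply filter_imp with (2 := H). intros n ->; auto.
  - eapply is_lim_seq_ext_loc; [|apply b]. apply filter_imp with (2 := H). intros n ->; auto.
Qed.

Lemma limC_plus u v l m : limC u l -> limC v m -> limC (fun n => u n + v n)%C (l + m).
Proof. intros [] []; split; simpl; apply is_lim_seq_plus'; auto. Qed.

Lemma limC_minus u v l m : limC u l -> limC v m -> limC (fun n => u n - v n)%C (l - m).
Proof. intros [] []; split; simpl; apply is_lim_seq_minus'; auto. Qed.

Lemma limC_mult u v l m : limC u l -> limC v m -> limC (fun n => u n * v n)%C (l * m).
Proof.
  intros [] []; split; simpl; [apply is_lim_seq_minus'|apply is_lim_seq_plus'];
  apply is_lim_seq_mult'; auto.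
Qed.

Lemma limC_cexp u l : limC u l -> limC (fun n => cexp (u n)) (cexp l).
Proof.
  intros [a b]; split; unfold cexp, Re, Im; simpl; apply is_lim_seq_mult'.
  - apply (is_lim_seq_continuous exp); auto. apply derivable_continuous_pt, derivable_pt_exp.
  - apply (is_lim_seq_continuous cos); auto. apply continuity_cos.
  - apply (is_lim_seq_continuous exp); auto. apply derivable_continuous_pt, derivable_pt_exp.
  - apply (is_lim_seq_continuous sin); auto. apply continuity_sin.
Qed.

Lemma limC_RtoC u l : is_lim_seq u (Finite l) -> limC (fun n => RtoC (u n)) (RtoC l).
Proof. intros H; split; simpl; auto. apply is_lim_seq_const. Qed.

Lemma limC_incr u l : limC (fun n => u (S n)) l <-> limC u l.
Proof.
  unfold limC.
  rewrite (is_lim_seq_incr_1 (fun n => fst (u n))), (is_lim_seq_incr_1 (fun n => snd (u n))).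
  reflexivity.
Qed.

Lemma limC_squeeze u l (e : nat -> R) :
  eventually (fun n => Cmod (u n - l) <= e n) -> is_lim_seq e 0 -> limC u l.
Proof.
  intros H He.
  assert (K : forall p : C -> R, (forall z, Rabs (p z) <= Cmod z) -> (forall z w, p (z - w)%C = p z - p w) ->
     is_lim_seq (fun n => p (u n)) (p l)).
  { intros p Hp Hm. apply is_lim_seq_ext with (fun n => p (u n - l)%C + p l).
    { intros n. rewrite Hm. ring. }
    replace (Finite (p l)) with (Finite (0 + p l)) by (f_equal; ring).
    apply is_lim_seq_plus'; [|apply is_lim_seq_const].
    apply is_lim_seq_abs_0.
    apply is_lim_seq_le_le_loc with (fun _ => 0) e; auto; [|apply is_lim_seq_const].
    apply filter_imp with (2 := H). intros n Hn. split; [apply Rabs_pos|].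
    eapply Rle_trans; [apply Hp|auto]. }
  split.
  - apply (K fst); [apply abs_fst_le|intros; reflexivity].
  - apply (K snd); [apply abs_snd_le|intros; reflexivity].
Qed.

Lemma limC_dist u l : limC u l -> is_lim_seq (fun n => Cmod (u n - l)) 0.
Proof.
  intros [a b].
  apply is_lim_seq_le_le with (fun _ => 0) (fun n => Rabs (fst (u n) - fst l) + Rabs (snd (u n) - snd l)).
  - intros n. split; [apply Cmod_ge_0|]. apply (Cmod_le_abs (u n - l)%C).
  - apply is_lim_seq_const.
  - replace (Finite 0) with (Finite (Rabs 0 + Rabs 0)) by (rewrite Rabs_R0; f_equal; ring).
    apply is_lim_seq_plus'; apply (is_lim_seq_abs _ (Finite 0)).
    + replace (Finite 0) with (Finite (fst l - fst l)) by (f_equal; ring).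
      apply is_lim_seq_minus'; auto. apply is_lim_seq_const.
    + replace (Finite 0) with (Finite (snd l - snd l)) by (f_equal; ring).
      apply is_lim_seq_minus'; auto. apply is_lim_seq_const.
Qed.

Lemma limC_bound u l B : limC u l -> eventually (fun n => Cmod (u n) <= B) -> Cmod l <= B.
Proof.
  intros H HB. apply limC_dist in H.
  assert (X : is_lim_seq (fun n => B + Cmod (u n - l)%C) (B + 0)).
  { apply is_lim_seq_plus'; auto. apply is_lim_seq_const. }
  rewrite Rplus_0_r in X.
  assert (Y := is_lim_seq_const (Cmod l)).
  apply (is_lim_seq_le_loc (fun _ => Cmod l) (fun n => B + Cmod (u n - l)%C) (Cmod l) B); auto.
  apply filter_imp with (2 := HB). intros n Hn.
  replace l with (u n - (u n - l))%C at 1 by ring.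
  eapply Rle_trans; [apply Cmod_triangle_sub|lra].
Qed.

Lemma limC_filterlim u l : limC u l -> filterlim u eventually (locally (T := C_UniformSpace) l).
Proof.
  intros [a b] P [eps HP].
  assert (A1 : eventually (fun n => ball (fst l) eps (fst (u n)))).
  { apply a. apply locally_ball. }
  assert (A2 : eventually (fun n => ball (snd l) eps (snd (u n)))).
  { apply b. apply locally_ball. }
  unfold filtermap. generalize (filter_and _ _ A1 A2). apply filter_imp.
  intros n [h1 h2]. apply HP. split; auto.
Qed.

(** [lim] is specified on proper Cauchy filters only, so the image filter is first shown to be one;
    uniqueness of limits does the rest. *)
Lemma lim_limC u l :
  limC u l -> @lim C_R_CompleteNormedModule (filtermap u eventually) = l.
Proof.
  intros H. apply limC_filterlim in H.
  set (F := filtermap u eventually).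
  assert (PF : ProperFilter F) by (apply filtermap_proper_filter; apply eventually_filter).
  assert (Cy : cauchy (T := C_R_CompleteNormedModule) F).
  { intros eps. exists l. apply H. apply (locally_ball (T := C_UniformSpace)). }
  assert (X := complete_cauchy (T := C_R_CompleteNormedModule) F PF Cy).
  symmetry.
  apply (filterlim_locally_unique (V := C_R_NormedModule) (F := eventually) u); auto.
  intros P [eps HP]. unfold filtermap. generalize (X eps). unfold F, filtermap. apply filter_imp.
  intros n Hn. apply HP. auto.
Qed.

Lemma CGamma_lim z l : limC (gauss_seq z) l -> CGamma z = l.
Proof. apply lim_limC. Qed.

Lemma rsum_nonneg_incr (b : nat -> R) : (forall k, 0 <= b k) -> forall n, rsum n b <= rsum (S n) b.
Proof. intros H n; simpl. generalize (H n); lra. Qed.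

Lemma series_bounded (f : nat -> C) (b : nat -> R) (B : R) :
  (forall k, Cmod (f k) <= b k) -> (forall n, rsum n b <= B) ->
  exists e, limC (fun n => csum n f) e /\ Cmod e <= B.
Proof.
  intros Hf HB.
  assert (Hb : forall k, 0 <= b k) by (intros k; eapply Rle_trans; [apply Cmod_ge_0|apply Hf]).
  assert (Eb : ex_series b).
  { destruct (ex_finite_lim_seq_incr (fun n => rsum (S n) b) B) as [l Hl].
    - intros n. apply rsum_nonneg_incr; auto.
    - intros n; apply HB.
    - exists l. change (is_lim_seq (sum_n b) l).
      apply (is_lim_seq_ext (fun n => rsum (S n) b)); auto.
      intros n. rewrite rsum_sum_f. rewrite sum_n_Reals. reflexivity. }
  assert (K : forall p : C -> R, (forall z, Rabs (p z) <= Cmod z) -> (forall z w, p (z + w)%C = p z + p w) -> p 0 = 0 ->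
     exists l : R, is_lim_seq (fun n => p (csum n f)) l).
  { intros p Hp Hm H0. destruct (ex_series_le (fun k => p (f k)) b) as [l Hl]; auto.
    { intros n. eapply Rle_trans; [apply Hp|apply Hf]. }
    exists l. apply is_lim_seq_incr_1.
    apply (is_lim_seq_ext (sum_n (fun k => p (f k)))); [|exact Hl].
    intros n. rewrite sum_n_Reals, <- rsum_sum_f.
    generalize (S n). clear n. induction n; simpl; auto. rewrite Hm, IHn. reflexivity. }
  destruct (K fst) as [l1 H1]; [apply abs_fst_le|reflexivity|reflexivity|].
  destruct (K snd) as [l2 H2]; [apply abs_snd_le|reflexivity|reflexivity|].
  exists (l1, l2). assert (L : limC (fun n => csum n f) (l1, l2)) by (split; auto).
  split; auto. apply (limC_bound _ _ _ L). exists 0%nat. intros n _.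
  eapply Rle_trans; [apply csum_bound; intros; apply Hf|apply HB].
Qed.

(** Comparison with the integral of [1 / (v^2 + eta^2)]. The arctangent is bounded on the whole
    line, so the bound does not depend on [x]; this is where uniformity as [Re z -> -oo] comes
    from. *)
Lemma atan_sum_bound (eta : R) : 0 < eta -> exists CB, 0 <= CB /\ forall (x : R) (n : nat),
  rsum n (fun k => / ((x + INR k) ^ 2 + eta ^ 2)) <= CB.
Proof.
  (* Chosen so that [c^2 + eta^2 <= kap (X^2 + eta^2)] whenever [|c - X| <= 1], using
     [c^2 <= 2 X^2 + 2]. *)
  intros He. set (kap := 2 + 2 / eta ^ 2).
  assert (He2 : 0 < eta ^ 2) by (apply pow_lt; auto).
  assert (Hk : 0 < kap).
  { unfold kap. assert (0 < 2 / eta ^ 2) by (apply Rdiv_lt_0_compat; lra). lra. }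
  exists (kap * PI / eta). split.
  { apply Rmult_le_pos; [apply Rmult_le_pos; [lra|generalize PI_RGT_0; lra]|left; apply Rinv_0_lt_compat; auto]. }
  intros x n.
  assert (H : rsum n (fun k => / ((x + INR k) ^ 2 + eta ^ 2)) <=
     kap / eta * (atan ((x + INR n) / eta) - atan (x / eta))).
  { induction n.
    - simpl. rewrite Rplus_0_r. right; ring.
    - cbn [rsum]. set (X := x + INR n) in *.
      replace (x + INR (S n)) with (X + 1) by (unfold X; rewrite S_INR; ring).
      assert (D : / (X ^ 2 + eta ^ 2) <= kap / eta * (atan ((X + 1) / eta) - atan (X / eta))).
      { destruct (MVT_gen (fun v => atan (v / eta)) X (X + 1) (fun v => eta / (v ^ 2 + eta ^ 2))) as [c [Hc E]].
        - intros v _. evar_last.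
          + apply (is_derive_comp atan (fun v => v / eta)); [apply is_derive_atan|].
            apply (is_derive_scal_l (fun v => v) v 1 (/ eta)). apply @is_derive_id.
          + unfold scal; simpl; unfold mult; simpl. unfold Rsqr. field. split; [|lra].
            generalize (Rle_0_sqr v). unfold Rsqr. simpl in He2. lra.
        - intros v _. apply continuity_pt_filterlim.
          apply (ex_derive_continuous (fun v => atan (v / eta))).
          eexists. apply (is_derive_comp atan (fun v => v / eta)); [apply is_derive_atan|].
            apply (is_derive_scal_l (fun v => v) v 1 (/ eta)). apply @is_derive_id.
        - rewrite E. rewrite Rmin_left, Rmax_right in Hc by lra.
          replace (X + 1 - X) with 1 by ring. rewrite Rmult_1_r.
          replace (kap / eta * (eta / (c ^ 2 + eta ^ 2))) with (/ ((c ^ 2 + eta ^ 2) / kap)).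
          2: { field. repeat split; try lra. generalize (pow2_ge_0 c). lra. }
          apply Rinv_le_contravar.
          + apply Rdiv_lt_0_compat; auto. generalize (pow2_ge_0 c). lra.
          + apply (Rmult_le_reg_r kap); auto.
            replace ((c ^ 2 + eta ^ 2) / kap * kap) with (c ^ 2 + eta ^ 2) by (field; lra).
            unfold kap.
            replace ((X ^ 2 + eta ^ 2) * (2 + 2 / eta ^ 2)) with (2 * X ^ 2 + 2 * eta ^ 2 + 2 + 2 * X ^ 2 / eta ^ 2) by (field; lra).
            assert (0 <= 2 * X ^ 2 / eta ^ 2).
            { apply Rmult_le_pos; [generalize (pow2_ge_0 X); lra|left; apply Rinv_0_lt_compat; auto]. }
            assert (0 <= (X - (c - X)) ^ 2) by apply pow2_ge_0.
            assert ((c - X) ^ 2 <= 1) by nra.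
            assert (c ^ 2 <= 2 * X ^ 2 + 2) by nra. lra. }
      lra. }
  eapply Rle_trans; [apply H|].
  replace (kap * PI / eta) with (kap / eta * PI) by (field; lra).
  apply Rmult_le_compat_l.
  - left; apply Rdiv_lt_0_compat; auto.
  - destruct (atan_bound ((x + INR n) / eta)), (atan_bound (x / eta)). lra.
Qed.

(** Along the segment from [0] to [v] the derivative is [- t v^2 / (1 + t v)], at most [2 |v|^2] in
    absolute value since [|1 + t v| >= 1 / 2]. *)
Lemma clog1p_bound (v : C) : Cmod v <= 1 / 2 -> Cmod (clog (1 + v) - v) <= 4 * Cmod v ^ 2.
Proof.
  intros Hv.
  assert (S1 : forall t, 0 <= t <= 1 -> 1 / 2 <= fst (1 + RtoC t * v)%C /\ 1 / 2 <= Cmod (1 + RtoC t * v)).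
  { intros t Ht. assert (Hf : 1 / 2 <= fst (1 + RtoC t * v)%C).
    { simpl. generalize (abs_fst_le v) (Rle_abs (- fst v)). rewrite Rabs_Ropp. intros. nra. }
    split; auto. eapply Rle_trans; [apply Hf|]. eapply Rle_trans; [apply Rle_abs|apply abs_fst_le]. }
  assert (H : Cmod ((clog (1 + RtoC 1 * v) - RtoC 1 * v) - (clog (1 + RtoC 0 * v) - RtoC 0 * v))
     <= 2 * (2 * Cmod v ^ 2) * Rabs (1 - 0)).
  { apply (dC_bound (fun t => clog (1 + RtoC t * v) - RtoC t * v)%C (fun t => v / (1 + RtoC t * v) - v)%C).
    intros t Ht. rewrite Rmin_left, Rmax_right in Ht by lra. destruct (S1 t Ht) as [Hf Hm].
    assert (Hsl : slit (1 + RtoC t * v)) by (left; lra).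
    assert (Hn := slit_neq_0 _ Hsl).
    split.
    - apply dC_minus.
      + apply (dC_clog (fun t => 1 + RtoC t * v)%C); auto. apply dC_line.
      + eapply dC_eq; [|apply dC_mult; [apply dC_id|apply dC_const]]. cbv beta; ring.
    - replace (v / (1 + RtoC t * v) - v)%C with (- (RtoC t * v * v) / (1 + RtoC t * v))%C by (field; auto).
      rewrite Cmod_div, Cmod_opp, !Cmod_mult, Cmod_R by auto. rewrite Rabs_pos_eq by lra.
      apply (Rmult_le_reg_r (Cmod (1 + RtoC t * v))); [lra|].
      unfold Rdiv. rewrite Rmult_assoc, Rinv_l, Rmult_1_r by lra.
      generalize (Cmod_ge_0 v). intros.
      apply Rle_trans with (Cmod v ^ 2); [simpl; nra|]. generalize (pow2_ge_0 (Cmod v)). nra. }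
  rewrite Cmult_1_l, Cmult_0_l in H.
  replace (clog (1 + 0)) with (RtoC 0) in H.
  2: { replace (1 + 0)%C with (RtoC 1) by ring. rewrite clog_RtoC by lra. rewrite ln_1; auto. }
  replace (clog (1 + v) - v - (0 - 0))%C with (clog (1 + v) - v)%C in H by ring.
  replace (1 - 0) with 1 in H by ring. rewrite Rabs_R1 in H. lra.
Qed.

Lemma lim_inv_INR c : is_lim_seq (fun n => c / INR n) 0.
Proof.
  replace (Finite 0) with (Rbar_mult c (Rbar_inv p_infty)) by (simpl; f_equal; ring).
  apply is_lim_seq_scal_l. apply is_lim_seq_inv; [apply is_lim_seq_INR|discriminate].
Qed.

Section Gauss.
Variables (a : R) (K : nat).
Hypothesis HK : (2 <= K)%nat.
Lemma stirling_telescope (z : C) (N : nat) :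
  csum N (fun k => clog (z + RtoC a + RtoC (INR k)))
  = (stirling_sum a K (z + RtoC (INR N)) - stirling_sum a K z - csum N (fun k => stirling_defect a K (z + RtoC (INR k))))%C.
Proof.
  induction N.
  - simpl. replace (z + 0)%C with z by ring. ring.
  - cbn [csum]. rewrite IHN. unfold stirling_defect.
    replace (z + RtoC (INR N) + 1)%C with (z + RtoC (INR (S N)))%C by (rewrite S_INR, RtoC_plus; ring).
    replace (z + RtoC (INR N) + RtoC a)%C with (z + RtoC a + RtoC (INR N))%C by ring. ring.
Qed.

Definition stirling_tail (z : C) : C := csum (K - 2) (fun j => RtoC (bcoef a (S (S j))) * psi (S (S j)) z)%C.
Lemma stirling_sum_split (z : C) : stirling_sum a K z = ((z + RtoC (a - 1 / 2)) * clog z - z + stirling_tail z)%C.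
Proof.
  unfold stirling_sum. replace K with (S (S (K - 2))) at 1 by lia. rewrite !csum_S_l.
  change (psi 0 z) with (z * clog z - z)%C. change (psi 1 z) with (clog z).
  unfold stirling_tail. unfold bcoef at 1 2. rewrite bernoulli_0, bernoulli_1. simpl (INR (fact 0)). simpl (INR (fact 1)).
  replace (1 / 1) with 1 by field. replace ((a - 1 / 2) / 1) with (a - 1 / 2) by field. ring.
Qed.

Lemma stirling_tail_lim (z : C) : limC (fun n => stirling_tail (z + RtoC (INR n))) 0.
Proof.
  unfold stirling_tail. induction (K - 2)%nat as [|j IH]; [apply limC_const|].
  cbn [csum]. replace (RtoC 0) with (RtoC 0 + RtoC (bcoef a (S (S j))) * RtoC 0)%C by ring.
  apply limC_plus; auto. apply limC_mult; [apply limC_const|].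
  apply limC_squeeze with (fun n => (2 * INR (fact j)) / INR n); [|apply lim_inv_INR].
  destruct (nfloor_ex (2 * Cmod z + 2)) as [N [_ HN]]. { generalize (Cmod_ge_0 z); lra. }
  exists (S N). intros n Hn.
  assert (Hn2 : 2 * Cmod z + 2 <= INR n).
  { apply le_INR in Hn. rewrite S_INR in Hn. lra. }
  assert (Hz := Cmod_ge_0 z).
  assert (Hm : INR n / 2 <= Cmod (z + RtoC (INR n))).
  { rewrite Cplus_comm. eapply Rle_trans; [|apply Cmod_triangle_rev]. rewrite Cmod_R, Rabs_pos_eq by lra. lra. }
  replace (psi (S (S j)) (z + RtoC (INR n)) - 0)%C with (psi (S (S j)) (z + RtoC (INR n))) by ring.
  unfold psi. rewrite Cmod_div by (apply Cpow_nz, Cmod_gt_0; lra).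
  rewrite Cmod_R, Cmod_pow, Rabs_mult, pow_1_abs, Rmult_1_l, (Rabs_pos_eq (INR (fact j))) by apply pos_INR.
  replace (2 * INR (fact j) / INR n) with (INR (fact j) * / (INR n / 2)) by (field; lra).
  apply Rmult_le_compat_l; [apply pos_INR|]. apply Rinv_le_contravar; [lra|].
  simpl. assert (1 <= Cmod (z + RtoC (INR n)) ^ j) by (apply pow_R1_Rle; lra). nra.
Qed.

(** The logarithm of [n!] minus the growing terms of Stirling's formula. *)
Definition ell (n : nat) : R := ln (INR (fact n)) - (INR n + 1 / 2) * ln (INR n) + INR n.
(** This is the part of the logarithm of Gauss's sequence for [z + a] that depends on neither [F z]
    nor the defects. Its growing terms cancel, and so do all contributions of [z] and [a], leaving
    the constant of Stirling's formula. *)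
Lemma bracket_lim (z : C) (l : R) : slit (z + 1) -> is_lim_seq ell l ->
  limC (fun n => (z + RtoC a) * RtoC (ln (INR n)) + RtoC (ln (INR (fact n)))
     - stirling_sum a K (z + RtoC (INR (S n))))%C (RtoC l).
Proof.
  intros Hs Hl.
  (* Defined by [z + (n + 1) = n (1 + v n)], so that the logarithm splits into [ln n] and a term of
     order [1 / n]. *)
  set (v := fun n => ((z + 1) * RtoC (/ INR n))%C).
  assert (Hv : forall n, Cmod (v n) = Cmod (z + 1) * / INR n \/ n = 0%nat).
  { intros n. destruct n; [right; auto|left]. unfold v. rewrite Cmod_mult, Cmod_R, Rabs_pos_eq; auto.
    left. apply Rinv_0_lt_compat, lt_0_INR. lia. }
  destruct (nfloor_ex (2 * Cmod (z + 1) + 2)) as [N [_ HN]]. { generalize (Cmod_ge_0 (z + 1)); lra. }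
  assert (Ev : eventually (fun n => 0 < INR n /\ Cmod (v n) <= 1 / 2 /\ Cmod (v n) = Cmod (z + 1) / INR n)).
  { exists (S N). intros n Hn.
    assert (Hn2 : 2 * Cmod (z + 1) + 2 <= INR n).
    { apply le_INR in Hn. rewrite S_INR in Hn. lra. }
    assert (Hz := Cmod_ge_0 (z + 1)).
    destruct (Hv n) as [E|E]; [|lia]. repeat split; auto; [lra|].
    rewrite E. apply (Rmult_le_reg_r (INR n)); [lra|]. rewrite Rmult_assoc, Rinv_l, Rmult_1_r by lra. lra. }
  set (Lg := fun n => clog (1 + v n)).
  assert (L1 : limC (fun n => RtoC (INR n) * Lg n - (z + 1))%C 0).
  { apply limC_squeeze with (fun n => 4 * Cmod (z + 1) ^ 2 / INR n); [|apply lim_inv_INR].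
    apply filter_imp with (2 := Ev). intros n (H0 & H1 & H2).
    replace (RtoC (INR n) * Lg n - (z + 1) - 0)%C with (RtoC (INR n) * (Lg n - v n))%C.
    2: { unfold v. rewrite RtoC_inv by lra. field. intros E; apply RtoC_inj in E; lra. }
    rewrite Cmod_mult, Cmod_R, Rabs_pos_eq by lra.
    apply Rle_trans with (INR n * (4 * Cmod (v n) ^ 2)).
    - apply Rmult_le_compat_l; [lra|]. apply clog1p_bound; auto.
    - rewrite H2. right. field. lra. }
  assert (L2 : limC Lg 0).
  { apply limC_squeeze with (fun n => 3 * Cmod (z + 1) / INR n); [|apply lim_inv_INR].
    apply filter_imp with (2 := Ev). intros n (H0 & H1 & H2).
    replace (Lg n - 0)%C with ((Lg n - v n) + v n)%C by ring.
    eapply Rle_trans; [apply Cmod_triangle|]. assert (B := clog1p_bound (v n) H1). fold (Lg n) in B.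
    replace (3 * Cmod (z + 1) / INR n) with (3 * Cmod (v n)) by (rewrite H2; field; lra).
    generalize (Cmod_ge_0 (v n)). nra. }
  assert (L3 : limC (fun n => RtoC (ell n) - (RtoC (INR n) * Lg n - (z + 1)) - (z + RtoC a + RtoC (1 / 2)) * Lg n
      - stirling_tail (z + RtoC (INR (S n))))%C (RtoC l)).
  { replace (RtoC l) with (RtoC l - 0 - (z + RtoC a + RtoC (1 / 2)) * 0 - 0)%C by ring.
    apply limC_minus; [apply limC_minus; [apply limC_minus|]|].
    - apply limC_RtoC; auto.
    - auto.
    - apply limC_mult; auto. apply limC_const.
    - apply (limC_incr (fun n => stirling_tail (z + RtoC (INR n)))). apply stirling_tail_lim. }
  apply limC_ext_loc with (2 := L3).
  apply filter_imp with (2 := Ev). intros n (H0 & H1 & H2).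
  rewrite stirling_sum_split.
  assert (EZ : (z + RtoC (INR (S n)) = RtoC (INR n) * (1 + v n))%C).
  { unfold v. rewrite S_INR, RtoC_plus, RtoC_inv by lra. field. intros E; apply RtoC_inj in E; lra. }
  assert (Hs1 : slit (1 + v n)).
  { left. simpl. generalize (abs_fst_le (v n)) (Rle_abs (- fst (v n))). rewrite Rabs_Ropp. simpl. lra. }
  assert (EL : clog (z + RtoC (INR (S n))) = (RtoC (ln (INR n)) + Lg n)%C).
  { rewrite EZ. apply clog_scale; auto. }
  rewrite EL. unfold ell.
  (* With [1 / 2] as an opaque atom, [ring] has to be told how it relates to [1]. *)
  assert (E1 : RtoC 1 = (RtoC (1 / 2) + RtoC (1 / 2))%C) by (rewrite <- RtoC_plus; f_equal; field).
  rewrite S_INR, !RtoC_plus, !RtoC_minus, RtoC_mult, !RtoC_plus.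
  revert E1. generalize (RtoC (1 / 2)). intros hf E1. rewrite !E1. ring.
Qed.
End Gauss.

(** * The Gamma function *)

(** Of the [K] powers of [1 / |z + k|], two make the series converge and the other [K - 2] provide
    the decay in [M]. The division by [2] in the last hypothesis is slack for [Re z] large, where
    the imaginary part may vanish and cannot supply [eta]. *)
Lemma stirling_defect_series (a : R) (K : nat) (HK : (2 <= K)%nat) (eta CB CD M : R) (z : C) :
  (forall (x : R) (n : nat), rsum n (fun k => / ((x + INR k) ^ 2 + eta ^ 2)) <= CB) ->
  0 < eta -> 0 <= CD -> 0 < M ->
  (forall k, Cmod (stirling_defect a K (z + RtoC (INR k))) <= CD / Cmod (z + RtoC (INR k)) ^ K) ->
  (forall k, M <= Cmod (z + RtoC (INR k))) ->
  (forall k, ((fst z + INR k) ^ 2 + eta ^ 2) / 2 <= Cmod (z + RtoC (INR k)) ^ 2) ->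
  exists e, limC (fun n => csum n (fun k => stirling_defect a K (z + RtoC (INR k)))) e /\
     Cmod e <= 2 * CD * CB / M ^ (K - 2).
Proof.
  intros HCB He HCD HM HD Hm Hq.
  apply series_bounded with (fun k => 2 * CD / M ^ (K - 2) * / ((fst z + INR k) ^ 2 + eta ^ 2)).
  - intros k. eapply Rle_trans; [apply HD|].
    set (r := Cmod (z + RtoC (INR k))) in *.
    assert (Hr : 0 < r) by (unfold r; generalize (Hm k); fold r; lra).
    assert (Hx : 0 < (fst z + INR k) ^ 2 + eta ^ 2).
    { generalize (pow2_ge_0 (fst z + INR k)). assert (0 < eta ^ 2) by (apply pow_lt; auto). lra. }
    replace (r ^ K) with (r ^ (K - 2) * r ^ 2) by (rewrite <- pow_add; f_equal; lia).
    assert (P1 : 0 < M ^ (K - 2)) by (apply pow_lt; auto).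
    assert (P2 : M ^ (K - 2) <= r ^ (K - 2)) by (apply pow_incr; split; [lra|apply Hm]).
    assert (P3 := Hq k). fold r in P3.
    apply Rle_trans with (CD / (M ^ (K - 2) * (((fst z + INR k) ^ 2 + eta ^ 2) / 2))).
    + apply Rmult_le_compat_l; auto. apply Rinv_le_contravar.
      * apply Rmult_lt_0_compat; lra.
      * apply Rmult_le_compat; lra.
    + right. field. lra.
  - intros n. rewrite rsum_scal.
    replace (2 * CD * CB / M ^ (K - 2)) with (2 * CD / M ^ (K - 2) * CB).
    2: field; apply pow_nonzero; lra.
    apply Rmult_le_compat_l; [|apply HCB].
    apply Rmult_le_pos; [lra|left; apply Rinv_0_lt_compat, pow_lt; auto].
Qed.

Lemma Cmod_shift_re (z : C) (k : nat) : 0 <= fst z -> fst z + INR k <= Cmod (z + RtoC (INR k)).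
Proof.
  intros H. eapply Rle_trans; [apply Rle_abs|]. apply (abs_fst_le (z + RtoC (INR k))%C).
Qed.

(** Convergence is obtained from the defect series itself, at [z = 2] with [a = 0], where the
    telescoped sum of logarithms is that of a factorial. Only then can [stirling_const] identify the
    limit. *)
Lemma ell_lim : is_lim_seq ell (ln (2 * PI) / 2).
Proof.
  assert (X : exists l : R, is_lim_seq ell l).
  2: { destruct X as [l Hl]. rewrite <- (stirling_const l Hl). exact Hl. }
  destruct (stirling_defect_large 0 2) as [CD [HCD HD]]; [lia|].
  destruct (atan_sum_bound 1) as [CB [HCB HB]]; [lra|].
  assert (H2 : forall k, 2 + INR k <= Cmod (RtoC 2 + RtoC (INR k))).
  { intros k. apply (Cmod_shift_re (RtoC 2) k). simpl; lra. }
  destruct (stirling_defect_series 0 2 ltac:(lia) 1 CB CD 2 (RtoC 2)) as [e [He _]]; auto; try lra.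
  - intros k. apply HD.
    + left. simpl. generalize (pos_INR k); lra.
    + unfold stirling_radius. rewrite Rabs_R0. generalize (pos_INR k) (H2 k). lra.
  - intros k. generalize (pos_INR k) (H2 k). lra.
  - intros k. generalize (pos_INR k) (H2 k). intros P1 P2. simpl fst.
    apply Rle_trans with ((2 + INR k) ^ 2).
    + nra.
    + apply pow_incr. lra.
  - exists (- fst (stirling_sum 0 2 (RtoC 2)) - fst e).
    apply (is_lim_seq_incr_n ell 2).
    apply is_lim_seq_ext with (fun n => - fst (stirling_sum 0 2 (RtoC 2)) - fst (csum n (fun k => stirling_defect 0 2 (RtoC 2 + RtoC (INR k))))).
    2: { apply is_lim_seq_minus'; [apply is_lim_seq_const|apply He]. }
    intros n.
    assert (T := stirling_telescope 0 2 (RtoC 2) n). apply (f_equal fst) in T.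
    (* The factors are [2, 3, ..., n + 1], so the sequence obtained is [ell] shifted by [2], up to
       one factor [n + 2]. *)
    assert (E1 : fst (csum n (fun k => clog (RtoC 2 + 0 + RtoC (INR k)))) = ln (INR (fact (n + 1)))).
    { clear. induction n; [simpl; rewrite ln_1; auto|].
      cbn [csum]. change (fst (?x + ?y)%C) with (fst x + fst y). rewrite IHn.
      replace (RtoC 2 + 0 + RtoC (INR n))%C with (RtoC (2 + INR n)) by (rewrite RtoC_plus; ring).
      rewrite clog_RtoC by (generalize (pos_INR n); lra). simpl fst.
      replace (S n + 1)%nat with (S (n + 1)) by lia.
      change (fact (S (n + 1))) with (S (n + 1) * fact (n + 1))%nat.
      rewrite mult_INR, ln_mult; [|apply lt_0_INR; lia|apply INR_fact_lt_0].
      replace (INR (S (n + 1))) with (2 + INR n) by (rewrite S_INR, plus_INR; simpl; ring). ring. }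
    rewrite E1 in T.
    assert (E2 : fst (stirling_sum 0 2 (RtoC 2 + RtoC (INR n))) = (INR n + 3 / 2) * ln (INR n + 2) - (INR n + 2)).
    { rewrite stirling_sum_split by lia. unfold stirling_tail. replace (2 - 2)%nat with 0%nat by lia. cbn [csum].
      rewrite <- RtoC_plus. rewrite clog_RtoC by (generalize (pos_INR n); lra).
      simpl. rewrite (Rplus_comm 2 (INR n)). field. }
    change (fst (?x - ?y)%C) with (fst x - fst y) in T.
    change (fst (?x - ?y)%C) with (fst x - fst y) in T. rewrite E2 in T.
    unfold ell. replace (n + 2)%nat with (S (n + 1)) by lia.
    change (fact (S (n + 1))) with (S (n + 1) * fact (n + 1))%nat.
    rewrite mult_INR, ln_mult; [|apply lt_0_INR; lia|apply INR_fact_lt_0].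
    rewrite T. replace (INR (S (n + 1))) with (INR n + 2) by (rewrite S_INR, plus_INR; simpl; ring).
    field.
Qed.

Lemma cprod_ext n f g : (forall k, (k < n)%nat -> f k = g k) -> cprod n f = cprod n g.
Proof. intros H; induction n; simpl; auto. rewrite IHn, H; auto. Qed.

Lemma cprod_S_l n f : (cprod (S n) f = f 0%nat * cprod n (fun k => f (S k)))%C.
Proof. induction n; cbn [cprod] in *; [ring|]. rewrite IHn. ring. Qed.

Lemma cprod_cexp n f : cprod n (fun k => cexp (f k)) = cexp (csum n f).
Proof. induction n; simpl; [rewrite cexp_0; auto|]. rewrite IHn, cexp_plus. auto. Qed.

Lemma cprod_inv n f : (cprod n (fun k => / f k) = / cprod n f)%C.
Proof. induction n; simpl; [|rewrite IHn, Cinv_mult_tot; auto]. apply C_ext; simpl; field. Qed.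

Lemma cprod_neq_0 n f : (forall k, (k < n)%nat -> f k <> RtoC 0) -> cprod n f <> 0.
Proof.
  intros H; induction n; simpl. { intros E. apply RtoC_inj in E. lra. }
  apply Cmult_neq_0; auto.
Qed.

Lemma cprod_eq_0 n f j : (j < n)%nat -> f j = RtoC 0 -> cprod n f = 0.
Proof.
  intros Hj E. induction n; [lia|]. simpl. destruct (Nat.eq_dec j n) as [->|Hn].
  - rewrite E. ring.
  - rewrite IHn by lia. ring.
Qed.

(** Every factor [w] of Gauss's denominator is written as [cexp (clog w)], so no branch of the
    logarithm of a product has to be chosen. *)
Theorem gauss_stirling (a : R) (K : nat) (z e : C) :
  (2 <= K)%nat -> slit (z + 1) ->
  (forall k, slit (z + RtoC a + RtoC (INR k))) ->
  limC (fun n => csum n (fun k => stirling_defect a K (z + RtoC (INR k)))) e ->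
  limC (gauss_seq (z + RtoC a)) (cexp (stirling_sum a K z + RtoC (ln (2 * PI) / 2) + e)).
Proof.
  intros HK Hs1 Hs He.
  assert (Hb := bracket_lim a K HK z _ Hs1 ell_lim).
  (* Gauss's denominator has [n + 1] factors, so the partial sums have to be shifted by one. *)
  apply limC_incr in He.
  assert (H := limC_cexp _ _ (limC_plus _ _ _ _ (limC_plus _ _ _ _ (limC_const (stirling_sum a K z)) Hb) He)).
  apply limC_ext_loc with (2 := H). exists 1%nat. intros n Hn.
  unfold gauss_seq, cpow.
  rewrite (cprod_ext (S n) _ (fun k => cexp (clog (z + RtoC a + RtoC (INR k))))).
  2: { intros k _. symmetry. apply cexp_clog. auto. }
  rewrite cprod_cexp, (stirling_telescope a K).
  rewrite <- (exp_ln (INR (fact n))) at 2 by apply INR_fact_lt_0.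
  rewrite <- cexp_RtoC. unfold Cdiv. rewrite <- cexp_opp, <- !cexp_plus. f_equal. ring.
Qed.

(** The threshold [eta] is free because the expansion will be used at [A k * t] with [|Im t| >= 1],
    whose imaginary part is only known to be at least [A k]. *)
Theorem stirling_im (a : R) (K : nat) (eta : R) : (2 <= K)%nat -> 0 < eta ->
  exists CS, 0 <= CS /\ forall z, eta <= Rabs (snd z) -> exists e,
    CGamma (z + RtoC a) = cexp (stirling_sum a K z + RtoC (ln (2 * PI) / 2) + e) /\
    Cmod e <= CS / Rabs (snd z) ^ (K - 2).
Proof.
  intros HK He.
  destruct (stirling_defect_im a K HK eta He) as [CD [HCD HD]].
  destruct (atan_sum_bound eta He) as [CB [HCB HB]].
  exists (2 * CD * CB). split; [nra|].
  intros z Hz.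
  assert (Hsz : snd z <> 0) by (intros E; rewrite E, Rabs_R0 in Hz; lra).
  destruct (stirling_defect_series a K HK eta CB CD (Rabs (snd z)) z) as [e [Hl Hb]]; auto; try lra.
  - intros k. apply HD. simpl. rewrite Rplus_0_r. auto.
  - intros k. apply abs_im_le.
  - intros k. rewrite Cmod_sqr. simpl fst; simpl snd. rewrite Rplus_0_r.
    assert (eta ^ 2 <= snd z ^ 2). { rewrite <- (pow2_abs (snd z)). apply pow_incr. lra. }
    generalize (pow2_ge_0 (fst z + INR k)) (pow2_ge_0 eta). lra.
  - exists e. split; auto. apply CGamma_lim. apply gauss_stirling; auto.
    + right; simpl; lra.
    + intros k; right; simpl; lra.
Qed.

(** Needed on the right edge of the large loop, which meets the real axis: there the decay must come
    from the real part. *)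
Theorem stirling_re (a : R) (K : nat) : (2 <= K)%nat ->
  exists CS R1, 0 <= CS /\ 0 < R1 /\ forall z, R1 <= fst z -> exists e,
    CGamma (z + RtoC a) = cexp (stirling_sum a K z + RtoC (ln (2 * PI) / 2) + e) /\
    Cmod e <= CS / fst z ^ (K - 2).
Proof.
  intros HK.
  destruct (stirling_defect_large a K HK) as [CD [HCD HD]].
  destruct (atan_sum_bound 1 ltac:(lra)) as [CB [HCB HB]].
  assert (Ha := Rabs_pos a).
  exists (2 * CD * CB), (stirling_radius a). split; [nra|]. split; [unfold stirling_radius; lra|].
  intros z Hz.
  assert (HR : 2 + 2 * Rabs a <= fst z) by (unfold stirling_radius in Hz; lra).
  assert (Hk : forall k, fst z <= fst z + INR k <= Cmod (z + RtoC (INR k))).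
  { intros k. generalize (pos_INR k) (Cmod_shift_re z k). lra. }
  destruct (stirling_defect_series a K HK 1 CB CD (fst z) z) as [e [Hl Hb]]; auto; try lra.
  - intros k. apply HD.
    + left. simpl. generalize (Hk k); lra.
    + generalize (Hk k); lra.
  - intros k. generalize (Hk k). lra.
  - intros k. apply Rle_trans with ((fst z + INR k) ^ 2).
    + assert (1 <= fst z + INR k) by (generalize (Hk k); lra). nra.
    + apply pow_incr. generalize (Hk k); lra.
  - exists e. split; auto. apply CGamma_lim. apply gauss_stirling; auto.
    + left; simpl; lra.
    + intros k; left; simpl. generalize (Hk k) (Rle_abs (- a)). rewrite Rabs_Ropp. lra.
Qed.

(** The functional equation of Gamma on the level of Gauss's sequences: shifting [z] by [1]
    multiplies the term of index [n] by a factor [n z / (z + 1 + n)]. *)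
Lemma gauss_step (z l : C) : (forall k, (z + RtoC (INR k))%C <> 0) -> limC (gauss_seq (z + 1)) l -> limC (gauss_seq z) (l / z)%C.
Proof.
  intros Hzk Hl.
  assert (Hz : z <> 0). { intros E. apply (Hzk 0%nat). rewrite E. simpl. ring. }
  assert (L : limC (fun n => gauss_seq (z + 1) n * ((1 + (z + 1) * RtoC (1 / INR n)) / z))%C (l * ((1 + (z + 1) * 0) / z))%C).
  { apply limC_mult; auto. apply limC_mult; [|apply limC_const].
    apply limC_plus; [apply limC_const|]. apply limC_mult; [apply limC_const|].
    apply limC_RtoC. apply lim_inv_INR. }
  replace (l * ((1 + (z + 1) * 0) / z))%C with (l / z)%C in L by (field; auto).
  apply limC_ext_loc with (2 := L). exists 1%nat. intros n Hn.
  assert (HN : 0 < INR n) by (apply lt_0_INR; lia).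
  assert (HNC : RtoC (INR n) <> 0) by (intros E; apply RtoC_inj in E; lra).
  unfold gauss_seq, cpow.
  rewrite Cmult_plus_distr_r, cexp_plus, Cmult_1_l, cexp_RtoC, exp_ln by auto.
  set (P := cprod (S n) (fun k => z + 1 + RtoC (INR k))%C).
  set (Q := cprod (S n) (fun k => z + RtoC (INR k))%C).
  assert (E : (P * z = Q * (z + 1 + RtoC (INR n)))%C).
  { assert (E1 := cprod_S_l (S n) (fun k => z + RtoC (INR k))%C).
    cbn [cprod] in E1. fold (cprod (S n) (fun k => z + RtoC (INR k))%C) in E1.
    unfold P, Q.
    rewrite (cprod_ext (S n) (fun k => z + 1 + RtoC (INR k))%C (fun k => z + RtoC (INR (S k)))%C).
    2: { intros k _. rewrite S_INR, RtoC_plus. ring. }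
    replace (z + 1 + RtoC (INR n))%C with (z + RtoC (INR (S n)))%C by (rewrite S_INR, RtoC_plus; ring).
    replace (z + RtoC (INR 0))%C with z in E1 by (simpl; ring).
    rewrite Cmult_comm. cbn [cprod]. rewrite <- E1. ring. }
  unfold Rdiv. rewrite Rmult_1_l, RtoC_inv by lra.
  replace ((1 + (z + 1) * / RtoC (INR n)) / z)%C with ((z + 1 + RtoC (INR n)) * / z * / RtoC (INR n))%C by (field; auto).
  unfold Cdiv.
  assert (HQ : Q <> 0) by (apply cprod_neq_0; intros; apply Hzk).
  assert (HP : P <> 0).
  { apply cprod_neq_0; intros k _. replace (z + 1 + RtoC (INR k))%C with (z + RtoC (INR (S k)))%C by (rewrite S_INR, RtoC_plus; ring).
    apply Hzk. }
  assert (HT : (z + 1 + RtoC (INR n))%C <> 0).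
  { replace (z + 1 + RtoC (INR n))%C with (z + RtoC (INR (S n)))%C by (rewrite S_INR, RtoC_plus; ring). apply Hzk. }
  replace (/ Q)%C with ((z + 1 + RtoC (INR n)) * / (P * z))%C by (rewrite E; field; auto).
  field. auto.
Qed.

Lemma CGamma_pole (z : C) (j : nat) : (z + RtoC (INR j))%C = 0 -> CGamma z = 0.
Proof.
  intros E. apply CGamma_lim. apply limC_ext_loc with (fun _ => RtoC 0); [|apply limC_const].
  exists j. intros n Hn. unfold gauss_seq. rewrite (cprod_eq_0 (S n) _ j); [|lia|auto].
  unfold Cdiv. rewrite Cinv_0. ring.
Qed.

(** A bound of second order passes to the limit of partial sums. A series can thus be differentiated
    from such bounds on its terms alone. *)
Lemma is_derive_quadratic (g : R -> R) (l M d : R) : 0 < d -> 0 <= M ->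
  (forall t, Rabs t <= d -> Rabs (g t - g 0 - t * l) <= M * t ^ 2) -> is_derive g 0 l.
Proof.
  intros Hd HM H. apply is_derive_Reals. intros eps Heps.
  assert (Hp : 0 < Rmin d (eps / (M + 1))).
  { apply Rmin_pos; auto. apply Rdiv_lt_0_compat; lra. }
  exists (mkposreal _ Hp). intros t Ht0 Ht. simpl in Ht. rewrite Rplus_0_l.
  assert (Ht1 : Rabs t <= d) by (left; eapply Rlt_le_trans; [apply Ht|apply Rmin_l]).
  assert (Ht2 : Rabs t < eps / (M + 1)) by (eapply Rlt_le_trans; [apply Ht|apply Rmin_r]).
  assert (Hat := Rabs_pos_lt t Ht0).
  replace ((g t - g 0) / t - l) with ((g t - g 0 - t * l) / t) by (field; auto).
  unfold Rdiv. rewrite Rabs_mult, Rabs_inv.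
  apply (Rmult_lt_reg_r (Rabs t)); auto. rewrite Rmult_assoc, Rinv_l, Rmult_1_r by lra.
  eapply Rle_lt_trans; [apply H; auto|]. rewrite <- pow2_abs.
  assert (Rabs t * (M + 1) < eps).
  { apply (Rmult_lt_compat_r (M + 1)) in Ht2; [|lra]. replace (eps / (M + 1) * (M + 1)) with eps in Ht2 by (field; lra). auto. }
  nra.
Qed.

Lemma dC_quadratic (g : R -> C) (l : C) (M d : R) : 0 < d -> 0 <= M ->
  (forall t, Rabs t <= d -> Cmod (g t - g 0%R - RtoC t * l) <= M * t ^ 2) -> dC g 0 l.
Proof.
  intros Hd HM H. split; apply is_derive_quadratic with M d; auto; intros t Ht;
    (eapply Rle_trans; [|apply (H t Ht)]).
  - eapply Rle_trans; [|apply abs_fst_le]. right. f_equal. simpl. ring.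
  - eapply Rle_trans; [|apply abs_snd_le]. right. f_equal. simpl. ring.
Qed.

Lemma contC_lipschitz (f : C -> C) (z : C) (M d : R) : 0 < d -> 0 <= M ->
  (forall w, Cmod w <= d -> Cmod (f (z + w)%C - f z)%C <= M * Cmod w) -> contC (U := C_UniformSpace) f z.
Proof.
  intros Hd HM H. apply contC_continuous. intros P [eps HP]. unfold filtermap.
  assert (Hp : 0 < Rmin (d / 2) (eps / (2 * (M + 1)))).
  { apply Rmin_pos; [lra|]. apply Rdiv_lt_0_compat; [apply cond_pos|lra]. }
  exists (mkposreal _ Hp). intros y [Hy1 Hy2]. apply HP.
  change (Rabs (fst y - fst z) < Rmin (d / 2) (eps / (2 * (M + 1)))) in Hy1.
  change (Rabs (snd y - snd z) < Rmin (d / 2) (eps / (2 * (M + 1)))) in Hy2.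
  assert (L1 := Rmin_l (d / 2) (eps / (2 * (M + 1)))). assert (L2 := Rmin_r (d / 2) (eps / (2 * (M + 1)))).
  set (w := (y - z)%C).
  assert (Hw : Cmod w <= Rabs (fst y - fst z) + Rabs (snd y - snd z)) by apply (Cmod_le_abs w).
  assert (Hfy : Cmod (f y - f z) < eps).
  { replace y with (z + w)%C by (unfold w; ring). eapply Rle_lt_trans; [apply H; lra|].
    assert (Cmod w < eps / (M + 1)).
    { replace (eps / (M + 1)) with (eps / (2 * (M + 1)) + eps / (2 * (M + 1))) by (field; lra). lra. }
    assert (Cmod w * (M + 1) < eps).
    { apply (Rmult_lt_compat_r (M + 1)) in H0; [|lra]. replace (eps / (M + 1) * (M + 1)) with (pos eps) in H0 by (field; lra). auto. }
    generalize (Cmod_ge_0 w). nra. }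
  split.
  - change (Rabs (fst (f y) - fst (f z)) < eps). eapply Rle_lt_trans; [apply (abs_fst_le (f y - f z)%C)|auto].
  - change (Rabs (snd (f y) - snd (f z)) < eps). eapply Rle_lt_trans; [apply (abs_snd_le (f y - f z)%C)|auto].
Qed.

(** [ln Gamma] is holomorphic on a half-plane as [stirling_sum] (for [a = 0]) plus the sum
    of the defects at [z, z + 1, ...]; the second derivative of a defect is the explicit
    rational function [binet_step_d2]. *)
Definition binet_step (z : C) : C := stirling_defect 0 2 z.
Definition binet_step_d1 (z : C) : C := (clog (z + 1) - clog z - / (RtoC 2 * (z + 1)) - / (RtoC 2 * z))%C.
Definition binet_step_d2 (z : C) : C := (/ (RtoC 2 * z ^ 2 * (z + 1) ^ 2))%C.
Lemma RtoC_2_neq_0 : RtoC 2 <> 0.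
Proof. intros E; apply RtoC_inj in E; lra. Qed.

Lemma binet_step_eq (z : C) : binet_step z = ((z + RtoC (1 / 2)) * (clog (z + 1) - clog z) - 1)%C.
Proof.
  unfold binet_step, stirling_defect. rewrite !stirling_sum_split by lia. unfold stirling_tail. replace (2 - 2)%nat with 0%nat by lia. cbn [csum].
  replace (0 - 1 / 2) with (- (1 / 2)) by ring. rewrite RtoC_opp.
  replace (z + 0)%C with z by ring.
  assert (Eh : RtoC 1 = (RtoC (1 / 2) + RtoC (1 / 2))%C) by (rewrite <- RtoC_plus; f_equal; field).
  generalize (clog (z + 1)) (clog z). intros u v.
  transitivity (z * u + (RtoC 1 - RtoC (1 / 2)) * u - z * v + RtoC (1 / 2) * v - RtoC 1 * v - 1)%C; [ring|].
  rewrite Eh at 1 2. ring.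
Qed.

Lemma slit_p1 (z : C) : 0 < fst z -> slit (z + 1).
Proof. left. simpl. lra. Qed.

Lemma dC_binet_step (f : R -> C) x l : 0 < fst (f x) -> dC f x l -> dC (fun t => binet_step (f t)) x (l * binet_step_d1 (f x))%C.
Proof.
  intros Hs Hf.
  assert (N1 : f x <> 0) by (apply slit_neq_0; left; auto).
  assert (N2 : (f x + 1)%C <> 0) by (apply slit_neq_0, slit_p1; auto).
  assert (Hf1 : dC (fun t => f t + 1)%C x l).
  { eapply dC_eq; [apply Cplus_0_r|]. apply dC_plus; [auto|apply dC_const]. }
  apply dC_ext with (fun t => (f t + RtoC (1 / 2)) * (clog (f t + 1) - clog (f t)) - 1)%C.
  { intros; symmetry; apply binet_step_eq. }
  eapply dC_eq; [|apply dC_minus; [apply dC_mult; [apply dC_plus; [apply Hf|apply dC_const]|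
     apply dC_minus; [apply (dC_clog (fun t => f t + 1)%C); [apply slit_p1; auto|apply Hf1]|apply dC_clog; [left; auto|apply Hf]]]|apply dC_const]].
  cbv beta. unfold binet_step_d1.
  assert (Eh : RtoC (1 / 2) = (/ RtoC 2)%C) by (rewrite <- RtoC_inv by lra; f_equal; field).
  rewrite Eh. field. auto.
Qed.

Lemma dC_binet_step_d1 (f : R -> C) x l : 0 < fst (f x) -> dC f x l -> dC (fun t => binet_step_d1 (f t)) x (l * binet_step_d2 (f x))%C.
Proof.
  intros Hs Hf.
  assert (N1 : f x <> 0) by (apply slit_neq_0; left; auto).
  assert (N2 : (f x + 1)%C <> 0) by (apply slit_neq_0, slit_p1; auto).
  assert (N3 := RtoC_2_neq_0).
  assert (Hf1 : dC (fun t => f t + 1)%C x l).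
  { eapply dC_eq; [apply Cplus_0_r|]. apply dC_plus; [auto|apply dC_const]. }
  unfold binet_step_d1, binet_step_d2.
  eapply dC_eq; [|apply dC_minus; [apply dC_minus; [apply dC_minus;
     [apply (dC_clog (fun t => f t + 1)%C); [apply slit_p1; auto|apply Hf1]|apply dC_clog; [left; auto|apply Hf]]|
      apply (dC_inv (fun t => RtoC 2 * (f t + 1))%C); [apply Cmult_neq_0; auto|apply dC_scal; apply Hf1]]|
      apply (dC_inv (fun t => RtoC 2 * f t)%C); [apply Cmult_neq_0; auto|apply dC_scal; apply Hf]]].
  cbv beta. simpl Cpow. field. repeat split; auto.
Qed.

Lemma Cmod_shift_le (z : C) (t : R) : 0 <= fst z -> 0 <= t -> Cmod z <= Cmod (z + RtoC t).
Proof.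
  intros Hz Ht. unfold Cmod. apply sqrt_le_1_alt. simpl. nra.
Qed.

(** The function is [ln (z + 1) - ln z - 1 / z], a Taylor remainder bounded by [4 / |z|^2], plus
    [1 / (2 z (z + 1))]. The bound is not sharp; order [2] suffices for summability. *)
Lemma binet_step_d1_bound (z : C) : 2 <= fst z -> Cmod (binet_step_d1 z) <= 5 / Cmod z ^ 2.
Proof.
  intros Hz.
  assert (Hzm : 2 <= Cmod z) by (eapply Rle_trans; [apply Hz|]; eapply Rle_trans; [apply Rle_abs|apply abs_fst_le]).
  assert (N1 : z <> 0) by (apply Cmod_gt_0; lra).
  assert (N2 : (z + 1)%C <> 0) by (apply slit_neq_0, slit_p1; lra).
  assert (T := psi_taylor z 1 (/ Cmod z ^ 2) 1 2).
  rewrite Rabs_R1 in T.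
  assert (T' : Cmod (psi 1 (z + 1) - csum 2 (fun i => RtoC (1 ^ i / INR (fact i)) * psi (1 + i) z))%C <= 2 ^ 2 * / Cmod z ^ 2 * 1 ^ 2).
  { apply T. intros t Ht. rewrite Rmin_left, Rmax_right in Ht by lra.
    split; [left; simpl; lra|]. change (1 + 2)%nat with 3%nat. unfold psi.
    assert (Hm := Cmod_shift_le z t ltac:(lra) ltac:(lra)).
    rewrite Cmod_div by (apply Cpow_nz, Cmod_gt_0; lra). rewrite Cmod_R, Cmod_pow.
    replace ((-1) ^ 1 * INR (fact 1)) with (- (1)) by (simpl; ring). rewrite Rabs_Ropp, Rabs_R1.
    unfold Rdiv. rewrite Rmult_1_l. apply Rinv_le_contravar; [apply pow_lt; lra|]. apply pow_incr; lra. }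
  assert (E : binet_step_d1 z = ((psi 1 (z + 1) - csum 2 (fun i => RtoC (1 ^ i / INR (fact i)) * psi (1 + i) z)) + / (RtoC 2 * z * (z + 1)))%C).
  { unfold binet_step_d1. cbn [csum]. unfold psi; simpl Nat.add.
    replace (1 ^ 0 / INR (fact 0)) with 1 by (simpl; field).
    replace (1 ^ 1 / INR (fact 1)) with 1 by (simpl; field).
    replace ((-1) ^ 0 * INR (fact 0)) with 1 by (simpl; ring). simpl Cpow. field.
    auto. }
  rewrite E. eapply Rle_trans; [apply Cmod_triangle|].
  assert (Hm := Cmod_shift_le z 1 ltac:(lra) ltac:(lra)).
  assert (B : Cmod (/ (RtoC 2 * z * (z + 1))) <= / Cmod z ^ 2).
  { rewrite Cmod_inv_tot, !Cmod_mult, Cmod_R, Rabs_pos_eq by lra.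
    apply Rinv_le_contravar; [apply pow_lt; lra|]. simpl. nra. }
  unfold Rdiv. simpl pow at 1 in T'. lra.
Qed.

Lemma binet_step_d2_bound (z : C) : 2 <= fst z -> Cmod (binet_step_d2 z) <= / Cmod z ^ 2.
Proof.
  intros Hz.
  assert (Hzm : 2 <= Cmod z) by (eapply Rle_trans; [apply Hz|]; eapply Rle_trans; [apply Rle_abs|apply abs_fst_le]).
  assert (Hm := Cmod_shift_le z 1 ltac:(lra) ltac:(lra)).
  unfold binet_step_d2. rewrite Cmod_inv_tot, !Cmod_mult, !Cmod_pow, Cmod_R, Rabs_pos_eq by lra.
  apply Rinv_le_contravar; [apply pow_lt; lra|].
  assert (1 <= Cmod (z + 1) ^ 2) by (apply pow_R1_Rle; lra).
  assert (0 < Cmod z ^ 2) by (apply pow_lt; lra). nra.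
Qed.

Definition sumC (f : nat -> C) : C :=
  (real (Lim_seq (fun n => fst (csum n f))), real (Lim_seq (fun n => snd (csum n f)))).
Lemma sumC_eq f e : limC (fun n => csum n f) e -> sumC f = e.
Proof.
  intros [a b]. unfold sumC. rewrite (is_lim_seq_unique _ _ a), (is_lim_seq_unique _ _ b). destruct e; auto.
Qed.

Definition binet_sum (z : C) : C := sumC (fun k => binet_step (z + RtoC (INR k))).
Definition binet_sum_d1 (z : C) : C := sumC (fun k => binet_step_d1 (z + RtoC (INR k))).
(** A summable bound for [1 / |z + k|^2], uniform on the half-plane [2 <= Re z]. *)
Definition majorant (k : nat) : R := 2 * / ((2 + INR k) ^ 2 + 1 ^ 2).

Lemma inv_sq_majorant (z : C) k : 2 <= fst z -> / Cmod (z + RtoC (INR k)) ^ 2 <= majorant k.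
Proof.
  intros Hz. assert (H := Cmod_shift_re z k ltac:(lra)). assert (P := pos_INR k).
  unfold majorant. replace (2 * / ((2 + INR k) ^ 2 + 1 ^ 2)) with (/ (((2 + INR k) ^ 2 + 1 ^ 2) / 2)).
  2: { field. nra. }
  apply Rinv_le_contravar; [nra|].
  apply Rle_trans with ((2 + INR k) ^ 2); [nra|]. apply pow_incr; lra.
Qed.

Lemma majorant_series : exists B, 0 <= B /\ (forall n, rsum n majorant <= B).
Proof.
  destruct (atan_sum_bound 1 ltac:(lra)) as [CB [HCB HB]].
  exists (2 * CB). split; [lra|]. intros n. unfold majorant. rewrite rsum_scal. apply Rmult_le_compat_l; [lra|apply HB].
Qed.

Lemma majorant_scal c B : 0 <= c -> (forall n, rsum n majorant <= B) -> forall n, rsum n (fun k => c * majorant k) <= c * B.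
Proof. intros Hc HB n. rewrite rsum_scal. apply Rmult_le_compat_l; auto. Qed.

Lemma binet_sum_lim z : 2 <= fst z -> limC (fun n => csum n (fun k => binet_step (z + RtoC (INR k)))) (binet_sum z).
Proof.
  intros Hz. destruct majorant_series as [B [HB0 HB]].
  destruct (stirling_defect_large 0 2) as [CD [HCD HD]]; [lia|].
  destruct (series_bounded (fun k => binet_step (z + RtoC (INR k))) (fun k => CD * majorant k) (CD * B)) as [e [He _]].
  - intros k. assert (H := Cmod_shift_re z k ltac:(lra)). assert (P := pos_INR k).
    eapply Rle_trans; [apply HD|].
    + left; simpl; lra.
    + unfold stirling_radius. rewrite Rabs_R0. lra.
    + apply Rmult_le_compat_l; auto. apply inv_sq_majorant; auto.
  - apply majorant_scal; auto.
  - unfold binet_sum. rewrite (sumC_eq _ _ He). auto.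
Qed.

Lemma binet_sum_d1_lim z : 2 <= fst z -> limC (fun n => csum n (fun k => binet_step_d1 (z + RtoC (INR k)))) (binet_sum_d1 z).
Proof.
  intros Hz. destruct majorant_series as [B [HB0 HB]].
  destruct (series_bounded (fun k => binet_step_d1 (z + RtoC (INR k))) (fun k => 5 * majorant k) (5 * B)) as [e [He _]].
  - intros k. assert (P := pos_INR k).
    eapply Rle_trans; [apply binet_step_d1_bound; simpl; lra|].
    apply Rmult_le_compat_l; [lra|]. apply inv_sq_majorant; auto.
  - apply majorant_scal; auto. lra.
  - unfold binet_sum_d1. rewrite (sumC_eq _ _ He). auto.
Qed.

Lemma binet_step_d1_diff (z w : C) k : 3 <= fst z -> Cmod w <= 1 ->
  Cmod (binet_step_d1 (z + w + RtoC (INR k)) - binet_step_d1 (z + RtoC (INR k))) <= 2 * majorant k * Cmod w.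
Proof.
  intros Hz Hw. assert (P := pos_INR k). assert (Hfw := abs_fst_le w). assert (Hfw2 := Rle_abs (- fst w)). rewrite Rabs_Ropp in Hfw2.
  assert (H : Cmod (binet_step_d1 (z + RtoC (INR k) + RtoC 1 * w) - binet_step_d1 (z + RtoC (INR k) + RtoC 0 * w)) <= 2 * (majorant k * Cmod w) * Rabs (1 - 0)).
  { apply (dC_bound (fun t => binet_step_d1 (z + RtoC (INR k) + RtoC t * w)) (fun t => w * binet_step_d2 (z + RtoC (INR k) + RtoC t * w))%C).
    intros t Ht. rewrite Rmin_left, Rmax_right in Ht by lra.
    assert (F : 2 <= fst (z + RtoC t * w)%C) by (simpl; nra).
    assert (F2 : 2 <= fst (z + RtoC (INR k) + RtoC t * w)%C) by (simpl in *; lra).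
    split.
    - apply (dC_binet_step_d1 (fun t => z + RtoC (INR k) + RtoC t * w)%C); [lra|apply dC_line].
    - rewrite Cmod_mult, Rmult_comm. apply Rmult_le_compat_r; [apply Cmod_ge_0|].
      eapply Rle_trans; [apply binet_step_d2_bound; auto|].
      replace (z + RtoC (INR k) + RtoC t * w)%C with ((z + RtoC t * w) + RtoC (INR k))%C by ring.
      apply inv_sq_majorant; auto. }
  replace (1 - 0) with 1 in H by ring. rewrite Rabs_R1 in H.
  replace (z + w + RtoC (INR k))%C with (z + RtoC (INR k) + RtoC 1 * w)%C by ring.
  rewrite line_0 in H. lra.
Qed.

Lemma binet_step_diff (z w : C) k : 3 <= fst z -> Cmod w <= 1 ->
  Cmod (binet_step (z + w + RtoC (INR k)) - binet_step (z + RtoC (INR k)) - w * binet_step_d1 (z + RtoC (INR k))) <= 4 * Cmod w ^ 2 * majorant k.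
Proof.
  intros Hz Hw. assert (P := pos_INR k). assert (Hfw := abs_fst_le w). assert (Hfw2 := Rle_abs (- fst w)). rewrite Rabs_Ropp in Hfw2.
  assert (Pm : 0 <= majorant k).
  { eapply Rle_trans; [|apply (inv_sq_majorant z k); lra]. left. apply Rinv_0_lt_compat, pow_lt.
    generalize (Cmod_shift_re z k ltac:(lra)); lra. }
  set (d := binet_step_d1 (z + RtoC (INR k))).
  assert (H : Cmod ((binet_step (z + RtoC (INR k) + RtoC 1 * w) - RtoC 1 * (w * d)) - (binet_step (z + RtoC (INR k) + RtoC 0 * w) - RtoC 0 * (w * d)))
     <= 2 * (2 * majorant k * Cmod w * Cmod w) * Rabs (1 - 0)).
  { apply (dC_bound (fun t => binet_step (z + RtoC (INR k) + RtoC t * w) - RtoC t * (w * d))%C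
       (fun t => w * binet_step_d1 (z + RtoC (INR k) + RtoC t * w) - w * d)%C).
    intros t Ht. rewrite Rmin_left, Rmax_right in Ht by lra.
    assert (F : 2 <= fst (z + RtoC t * w)%C) by (simpl; nra).
    assert (F2 : 2 <= fst (z + RtoC (INR k) + RtoC t * w)%C) by (simpl in *; lra).
    split.
    - apply dC_minus; [apply (dC_binet_step (fun t => z + RtoC (INR k) + RtoC t * w)%C); [lra|apply dC_line]|].
      eapply dC_eq; [|apply dC_mult; [apply dC_id|apply dC_const]]. cbv beta; ring.
    - replace (w * binet_step_d1 (z + RtoC (INR k) + RtoC t * w) - w * d)%C with (w * (binet_step_d1 (z + RtoC t * w + RtoC (INR k)) - d))%C.
      2: { replace (z + RtoC t * w + RtoC (INR k))%C with (z + RtoC (INR k) + RtoC t * w)%C by ring. ring. }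
      rewrite Cmod_mult, Rmult_comm. apply Rmult_le_compat_r; [apply Cmod_ge_0|].
      assert (Ht2 : Cmod (RtoC t * w) <= Cmod w).
      { rewrite Cmod_mult, Cmod_R, Rabs_pos_eq by lra. generalize (Cmod_ge_0 w). nra. }
      eapply Rle_trans; [apply binet_step_d1_diff; lra|]. apply Rmult_le_compat_l; lra. }
  replace (1 - 0) with 1 in H by ring. rewrite Rabs_R1 in H.
  replace (z + w + RtoC (INR k))%C with (z + RtoC (INR k) + RtoC 1 * w)%C by ring.
  rewrite line_0 in H.
  replace (binet_step (z + RtoC (INR k) + RtoC 1 * w) - binet_step (z + RtoC (INR k)) - w * d)%C with
    (binet_step (z + RtoC (INR k) + RtoC 1 * w) - RtoC 1 * (w * d) - (binet_step (z + RtoC (INR k)) - RtoC 0 * (w * d)))%C by ring.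
  eapply Rle_trans; [apply H|]. right. ring.
Qed.

(** Only majorized bounds on increments of the partial sums are passed to the limit. The abscissa
    [3] leaves room for increments of modulus [1] within the half-plane [2 <= Re z] of the
    estimates. *)
Lemma hol_binet_sum : hol (fun z => 3 < fst z) binet_sum.
Proof.
  destruct majorant_series as [B [HB0 HB]].
  assert (Q1 : forall z w : C, 3 <= fst z -> Cmod w <= 1 -> Cmod (binet_sum_d1 (z + w) - binet_sum_d1 z) <= 2 * B * Cmod w).
  { intros z w Hz Hw. assert (Hfw := abs_fst_le w). assert (Hfw2 := Rle_abs (- fst w)). rewrite Rabs_Ropp in Hfw2.
    assert (L := limC_minus _ _ _ _ (binet_sum_d1_lim (z + w)%C ltac:(simpl; lra)) (binet_sum_d1_lim z ltac:(lra))).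
    apply (limC_bound _ _ _ L). exists 0%nat. intros n _. rewrite <- csum_minus.
    eapply Rle_trans; [apply csum_bound with (b := fun k => (2 * Cmod w) * majorant k)|].
    - intros k _. eapply Rle_trans; [apply binet_step_d1_diff; auto|]. right; ring.
    - eapply Rle_trans; [apply majorant_scal; [|apply HB]|right; ring]. generalize (Cmod_ge_0 w); lra. }
  assert (Q0 : forall z w : C, 3 <= fst z -> Cmod w <= 1 -> Cmod (binet_sum (z + w) - binet_sum z - w * binet_sum_d1 z) <= 4 * B * Cmod w ^ 2).
  { intros z w Hz Hw. assert (Hfw := abs_fst_le w). assert (Hfw2 := Rle_abs (- fst w)). rewrite Rabs_Ropp in Hfw2.
    assert (L := limC_minus _ _ _ _ (limC_minus _ _ _ _ (binet_sum_lim (z + w)%C ltac:(simpl; lra)) (binet_sum_lim z ltac:(lra)))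
       (limC_mult _ _ _ _ (limC_const w) (binet_sum_d1_lim z ltac:(lra)))).
    apply (limC_bound _ _ _ L). exists 0%nat. intros n _. rewrite <- csum_scal, <- !csum_minus.
    eapply Rle_trans; [apply csum_bound with (b := fun k => (4 * Cmod w ^ 2) * majorant k)|].
    - intros k _. apply binet_step_diff; auto.
    - eapply Rle_trans; [apply majorant_scal; [|apply HB]|right; ring]. generalize (pow2_ge_0 (Cmod w)); lra. }
  exists binet_sum_d1. intros z Hz. split; [|split].
  - intros w. set (d := / (Cmod w + 1)).
    assert (Hw0 := Cmod_ge_0 w).
    assert (Hd : 0 < d) by (apply Rinv_0_lt_compat; lra).
    apply dC_quadratic with (4 * B * Cmod w ^ 2) d; auto.
    { apply Rmult_le_pos; [lra|apply pow2_ge_0]. }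
    intros t Ht. rewrite line_0.
    assert (Hm : Cmod (RtoC t * w) <= 1).
    { rewrite Cmod_mult, Cmod_R. apply Rle_trans with (d * (Cmod w + 1)).
      - apply Rmult_le_compat; try lra. apply Rabs_pos.
      - unfold d. right; field. lra. }
    replace (RtoC t * (w * binet_sum_d1 z))%C with (RtoC t * w * binet_sum_d1 z)%C by ring.
    eapply Rle_trans; [apply Q0; auto; lra|]. rewrite Cmod_mult, Cmod_R, Rpow_mult_distr, pow2_abs. right; ring.
  - apply contC_lipschitz with (Cmod (binet_sum_d1 z) + 4 * B) 1; [lra| |].
    { generalize (Cmod_ge_0 (binet_sum_d1 z)); lra. }
    intros w Hw. replace (binet_sum (z + w) - binet_sum z)%C with ((binet_sum (z + w) - binet_sum z - w * binet_sum_d1 z) + w * binet_sum_d1 z)%C by ring.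
    eapply Rle_trans; [apply Cmod_triangle|]. rewrite Cmod_mult.
    assert (X := Q0 z w ltac:(lra) Hw). generalize (Cmod_ge_0 w). intros.
    assert (4 * B * Cmod w ^ 2 <= 4 * B * Cmod w) by (apply Rmult_le_compat_l; [lra|simpl; nra]). lra.
  - apply contC_lipschitz with (2 * B) 1; [lra|lra|]. intros w Hw. apply Q1; auto; lra.
Qed.

Definition lnGamma (z : C) : C := ((z + RtoC (- (1 / 2))) * clog z - z + RtoC (ln (2 * PI) / 2) + binet_sum z)%C.
Lemma hol_lnGamma : hol (fun z => 3 < fst z) lnGamma.
Proof.
  unfold lnGamma. apply hol_plus; [|apply hol_binet_sum]. apply hol_plus; [|apply hol_const].
  apply hol_minus; [|apply hol_id]. apply hol_mult.
  - apply hol_plus; [apply hol_id|apply hol_const].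
  - apply hol_subset with slit; [|apply hol_clog]. intros z Hz. left; lra.
Qed.

Lemma gauss_lnGamma (z : C) : 3 < fst z -> limC (gauss_seq z) (cexp (lnGamma z)).
Proof.
  intros Hz. assert (H := gauss_stirling 0 2 z (binet_sum z)).
  replace (z + 0)%C with z in H by ring.
  rewrite stirling_sum_split in H by lia. unfold stirling_tail in H. replace (2 - 2)%nat with 0%nat in H by lia. cbn [csum] in H.
  replace (0 - 1 / 2) with (- (1 / 2)) in H by ring.
  replace ((z + RtoC (- (1 / 2))) * clog z - z + 0 + RtoC (ln (2 * PI) / 2) + binet_sum z)%C with (lnGamma z) in H by (unfold lnGamma; ring).
  apply H; [lia|apply slit_p1; lra| |apply binet_sum_lim; lra].
  intros k. left. simpl. generalize (pos_INR k); lra.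
Qed.

Lemma gauss_lnGamma_shift n : forall z : C, 3 - INR n < fst z -> (forall k, (z + RtoC (INR k))%C <> 0) ->
  limC (gauss_seq z) (cexp (lnGamma (z + RtoC (INR n))) / cprod n (fun k => z + RtoC (INR k)))%C.
Proof.
  induction n; intros z Hz Hk.
  - simpl in Hz. simpl. replace (z + 0)%C with z by ring.
    replace (cexp (lnGamma z) / 1)%C with (cexp (lnGamma z)) by (field). apply gauss_lnGamma; lra.
  - assert (Hz0 : z <> 0). { intros E. apply (Hk 0%nat). rewrite E. simpl. ring. }
    assert (HS : forall k, (z + 1 + RtoC (INR k) = z + RtoC (INR (S k)))%C) by (intros; rewrite S_INR, RtoC_plus; ring).
    assert (H := IHn (z + 1)%C). specialize (H ltac:(rewrite S_INR in Hz; simpl; lra)).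
    specialize (H ltac:(intros k; rewrite HS; apply Hk)).
    apply gauss_step in H; auto. rewrite HS in H.
    rewrite cprod_S_l. rewrite (cprod_ext n _ (fun k => z + 1 + RtoC (INR k))%C) by (intros; symmetry; apply HS).
    replace (z + RtoC (INR 0))%C with z by (simpl; ring).
    assert (cprod n (fun k => z + 1 + RtoC (INR k))%C <> 0) by (apply cprod_neq_0; intros; rewrite HS; apply Hk).
    match goal with |- limC _ ?x => match type of H with limC _ ?y => replace x with y end end; auto.
    field. auto.
Qed.

(** At the poles of Gamma the Gauss sequence has denominator [0], so both [CGamma] and its
    inverse take the value [0] there: [rGamma] is the entire function [1 / Gamma]. *)
Definition rGamma (z : C) : C := (/ CGamma z)%C.
(** Off the poles this is the functional equation iterated [n] times. At a pole the left side is [0]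
    by convention and the product on the right contains a vanishing factor. *)
Lemma rGamma_formula n (z : C) : 3 - INR n < fst z ->
  rGamma z = (cprod n (fun k => z + RtoC (INR k)) * cexp (- lnGamma (z + RtoC (INR n))))%C.
Proof.
  intros Hz. unfold rGamma.
  destruct (Classical_Prop.classic (exists j, (z + RtoC (INR j))%C = 0)) as [[j Hj]|Hn].
  - rewrite (CGamma_pole z j Hj), Cinv_0.
    rewrite (cprod_eq_0 n _ j); [ring| |auto].
    (* Since [3 - n < Re z = - j], the vanishing factor has an index below [n]. *)
    apply (f_equal fst) in Hj. simpl in Hj. apply INR_lt. lra.
  - assert (Hk : forall k, (z + RtoC (INR k))%C <> 0) by (intros k E; apply Hn; eauto).
    rewrite (CGamma_lim _ _ (gauss_lnGamma_shift n z Hz Hk)). rewrite cexp_opp.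
    unfold Cdiv. rewrite Cinv_mult_tot, Cinv_inv_tot. ring.
Qed.

Lemma openC_re (c : R) : openC (fun z => c < fst z).
Proof.
  intros z Hz. assert (Hp : 0 < fst z - c) by lra. exists (mkposreal _ Hp).
  intros y [Hy _]. change (Rabs (fst y - fst z) < fst z - c) in Hy. apply Rabs_def2 in Hy. lra.
Qed.

Theorem hol_rGamma (x : R) : hol (fun z => x < fst z) rGamma.
Proof.
  destruct (nfloor_ex (Rabs (3 - x))) as [n [_ Hn]]; [apply Rabs_pos|].
  assert (Hx : 3 - INR (S n) < x).
  { rewrite S_INR. generalize (Rle_abs (3 - x)). lra. }
  apply hol_ext with (fun z => cprod (S n) (fun k => z + RtoC (INR k)) * cexp (- lnGamma (z + RtoC (INR (S n)))))%C.
  - apply openC_re.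
  - intros z Hz. symmetry. apply rGamma_formula. lra.
  - apply hol_mult.
    + apply (hol_cprod _ (S n) (fun k z => z + RtoC (INR k))%C). intros. apply hol_plus; [apply hol_id|apply hol_const].
    + apply hol_cexp, hol_opp.
      assert (H := hol_affine (fun z => x < fst z) (fun z => 3 < fst z) lnGamma 1 (RtoC (INR (S n)))).
      destruct H as [f' Hf].
      * intros z Hz. replace (fst (1 * z + RtoC (INR (S n)))%C) with (fst z + INR (S n)); [lra|]. generalize (INR (S n)). intros; simpl. ring.
      * apply hol_lnGamma.
      * assert (Hh : hol (fun z => x < fst z) (fun z => lnGamma (1 * z + RtoC (INR (S n)))%C)) by (exists f'; auto).
        revert Hh. apply hol_ext; [apply openC_re|]. intros z _. f_equal. ring.
Qed.

(** Neither the factors [z + k] nor the exponential vanish on the cut plane. This makes the Gamma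
    functions in the numerator of [GH] holomorphic, as inverses of [rGamma]. *)
Lemma rGamma_neq_0 (z : C) : slit z -> rGamma z <> 0.
Proof.
  intros Hs. destruct (nfloor_ex (Rabs (3 - fst z))) as [n [_ Hn]]; [apply Rabs_pos|].
  rewrite (rGamma_formula (S n)).
  2: { rewrite S_INR. generalize (Rle_abs (3 - fst z)). lra. }
  apply Cmult_neq_0; [|apply cexp_neq_0]. apply cprod_neq_0. intros k _.
  apply slit_neq_0, slit_shift; auto. apply pos_INR.
Qed.

(** * Asymptotics of the Gamma quotient *)

Lemma csum_extend n d f : (forall k, (n <= k)%nat -> f k = RtoC 0) -> csum (n + d) f = csum n f.
Proof.
  intros H. induction d; [rewrite Nat.add_0_r; auto|].
  rewrite Nat.add_succ_r. cbn [csum]. rewrite IHd, H by lia. ring.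
Qed.

Lemma csum_trunc n d f : csum n f = csum (n + d) (fun k => if Nat.ltb k n then f k else RtoC 0).
Proof.
  rewrite csum_extend.
  - apply csum_ext. intros k Hk. destruct (Nat.ltb_spec k n); auto; lia.
  - intros k Hk. destruct (Nat.ltb_spec k n); auto; lia.
Qed.

Lemma csum_rev n f : csum n f = csum n (fun k => f (n - 1 - k)%nat).
Proof.
  induction n; auto. rewrite (csum_S_l n (fun k => f (S n - 1 - k)%nat)).
  replace (S n - 1 - 0)%nat with n by lia. cbn [csum]. rewrite IHn.
  rewrite Cplus_comm. f_equal. apply csum_ext. intros; f_equal; lia.
Qed.

Lemma rsum_nonneg n f : (forall k, 0 <= f k) -> 0 <= rsum n f.
Proof. intros H; induction n; simpl; [lra|]. generalize (H n); lra. Qed.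

Lemma exp_le x y : x <= y -> exp x <= exp y.
Proof. intros [H|H]; [left; apply exp_increasing; auto|rewrite H; right; auto]. Qed.

(** * Taylor polynomials of the exponential of a polynomial *)

Section ExpPoly.
Variables (qc l : nat -> R) (m N : nat).
Hypothesis HN : (m <= N)%nat.
Hypothesis l0 : l 0%nat = 1.
Hypothesis lS : forall r, INR (S r) * l (S r) = rsum (S r) (fun i => qc (S i) * l (r - i)%nat).

Definition exp_arg (w : C) : C := csum N (fun j => RtoC (qc (S j) / INR (S j)) * Cpow w (S j))%C.
Definition exp_trunc (w : C) : C := csum (S m) (fun r => RtoC (l r) * Cpow w r)%C.
Definition exp_arg_d (w : C) : C := csum N (fun j => RtoC (qc (S j)) * Cpow w j)%C.
Definition exp_trunc_d (w : C) : C := csum m (fun r => RtoC (INR (S r) * l (S r)) * Cpow w r)%C.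

Lemma dC_exp_arg (f : R -> C) x d : dC f x d -> dC (fun t => exp_arg (f t)) x (d * exp_arg_d (f x))%C.
Proof.
  intros Hf. unfold exp_arg, exp_arg_d. rewrite <- csum_scal.
  apply (dC_csum N (fun j t => RtoC (qc (S j) / INR (S j)) * Cpow (f t) (S j))%C). intros j _.
  eapply dC_eq; [|apply dC_scal, dC_pow, Hf].
  assert (E : RtoC (qc (S j)) = (RtoC (qc (S j) / INR (S j)) * RtoC (INR (S j)))%C).
  { rewrite <- RtoC_mult. f_equal. field. apply not_0_INR; lia. }
  rewrite E. ring.
Qed.

Lemma dC_exp_trunc (f : R -> C) x d : dC f x d -> dC (fun t => exp_trunc (f t)) x (d * exp_trunc_d (f x))%C.
Proof.
  intros Hf. unfold exp_trunc, exp_trunc_d.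
  apply dC_ext with (fun t => RtoC (l 0%nat) + csum m (fun r => RtoC (l (S r)) * Cpow (f t) (S r)))%C.
  { intros t. rewrite csum_S_l. simpl. ring. }
  eapply dC_eq; [apply Cplus_0_l|]. apply dC_plus; [apply dC_const|].
  rewrite <- csum_scal.
  apply (dC_csum m (fun r t => RtoC (l (S r)) * Cpow (f t) (S r))%C). intros j _.
  eapply dC_eq; [|apply dC_scal, dC_pow, Hf]. rewrite RtoC_mult. ring.
Qed.

Lemma exp_arg_bound w : Cmod w <= 1 -> Cmod (exp_arg w) <= rsum N (fun j => Rabs (qc (S j))).
Proof.
  clear HN l0 lS. intros Hw. apply csum_bound. intros j _. rewrite Cmod_mult, Cmod_R, Cmod_pow.
  unfold Rdiv. rewrite Rabs_mult.
  assert (H1 : Rabs (/ INR (S j)) <= 1).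
  { rewrite Rabs_pos_eq by (left; apply Rinv_0_lt_compat, lt_0_INR; lia).
    rewrite <- Rinv_1. apply Rinv_le_contravar; [lra|]. rewrite S_INR. generalize (pos_INR j); lra. }
  assert (H2 : Cmod w ^ S j <= 1).
  { rewrite <- (pow1 (S j)). apply pow_incr. split; [apply Cmod_ge_0|auto]. }
  assert (0 <= Cmod w ^ S j) by (apply pow_le, Cmod_ge_0).
  generalize (Rabs_pos (qc (S j))) (Rabs_pos (/ INR (S j))). intros.
  assert (Rabs (qc (S j)) * Rabs (/ INR (S j)) <= Rabs (qc (S j))) by nra. nra.
Qed.

(** As sums over pairs [(i, k)], the product [Q' P] has all terms with [i < N], [k <= m], and by the
    recursion [P'] consists of exactly those with [i + k < m]. What remains has degree at least
    [m]. *)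
Lemma PQ_diff : exists CR, 0 <= CR /\ forall u, Cmod u <= 1 -> Cmod (exp_trunc_d u - exp_arg_d u * exp_trunc u) <= CR * Cmod u ^ m.
Proof.
  exists (rsum N (fun i => rsum (S m) (fun k => Rabs (qc (S i) * l k)))).
  split; [apply rsum_nonneg; intros; apply rsum_nonneg; intros; apply Rabs_pos|].
  intros u Hu. assert (Hu0 := Cmod_ge_0 u).
  set (g := fun i k => (RtoC (qc (S i) * l k) * Cpow u (i + k))%C).
  assert (EP : exp_trunc_d u = csum N (fun i => csum (S m) (fun k => if Nat.ltb k (m - i) then g i k else RtoC 0))).
  { transitivity (csum m (fun i => csum (m - i) (fun k => g i k))).
    - unfold exp_trunc_d.
      assert (X := csum_triangle m (fun i r => RtoC (qc (S i) * l (r - i)%nat) * Cpow u r)%C).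
      transitivity (csum m (fun r => csum (S r) (fun i => RtoC (qc (S i) * l (r - i)%nat) * Cpow u r)))%C.
      + apply csum_ext. intros r _. rewrite lS, <- csum_RtoC.
        rewrite Cmult_comm, <- csum_scal. apply csum_ext. intros; apply Cmult_comm.
      + rewrite <- X. apply csum_ext. intros i Hi. apply csum_ext. intros k Hk. unfold g.
        replace (i + k - i)%nat with k by lia. auto.
    - replace N with (m + (N - m))%nat by lia. rewrite csum_extend.
      + apply csum_ext. intros i Hi. rewrite (csum_trunc (m - i) (S i)).
        replace (m - i + S i)%nat with (S m) by lia. auto.
      + intros i Hi. replace (m - i)%nat with 0%nat by lia. rewrite (csum_ext (S m) _ (fun _ => RtoC 0)).
        * clear. induction (S m); simpl; auto. rewrite IHn. ring.
        * intros; auto. }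
  assert (EQ : (exp_arg_d u * exp_trunc u)%C = csum N (fun i => csum (S m) (fun k => g i k))).
  { unfold exp_arg_d, exp_trunc. rewrite Cmult_comm, <- csum_scal. apply csum_ext. intros i Hi.
    rewrite Cmult_comm, <- csum_scal. apply csum_ext. intros k Hk. unfold g.
    rewrite Cpow_add_r, RtoC_mult. ring. }
  rewrite EP, EQ, <- csum_minus.
  rewrite Rmult_comm, <- rsum_scal. apply csum_bound. intros i _.
  rewrite <- csum_minus, <- rsum_scal. apply csum_bound. intros k _.
  assert (Hp : 0 <= Cmod u ^ m) by (apply pow_le; auto).
  destruct (Nat.ltb_spec k (m - i)).
  - replace (g i k - g i k)%C with (RtoC 0) by ring. rewrite Cmod_0. apply Rmult_le_pos; auto. apply Rabs_pos.
  - replace (0 - g i k)%C with (- g i k)%C by ring. rewrite Cmod_opp. unfold g. rewrite Cmod_mult, Cmod_R, Cmod_pow.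
    rewrite Rmult_comm. apply Rmult_le_compat_r; [apply Rabs_pos|].
    replace (i + k)%nat with (m + (i + k - m))%nat by lia. rewrite pow_add.
    rewrite <- (Rmult_1_r (Cmod u ^ m)) at 2. apply Rmult_le_compat_l; auto.
    rewrite <- (pow1 (i + k - m)). apply pow_incr; lra.
Qed.

Lemma Cmod_cexp_le z M : Cmod z <= M -> Cmod (cexp z) <= exp M.
Proof.
  intros H. rewrite Cmod_cexp. apply exp_le. eapply Rle_trans; [|apply H].
  eapply Rle_trans; [apply Rle_abs|apply abs_fst_le].
Qed.

Lemma Cpow_0_S n : Cpow 0 (S n) = 0.
Proof. simpl. ring. Qed.

(** The recursion for [l] says that [P' - Q' P] has no terms of degree [< m], so
    [e^(-Q) P] differs from its value [1] at [0] by [O(w^(m+1))]. *)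
Theorem exp_poly : exists CE, 0 <= CE /\ forall w, Cmod w <= 1 ->
  Cmod (cexp (exp_arg w) - exp_trunc w) <= CE * Cmod w ^ S m.
Proof.
  destruct PQ_diff as [CR [HCR HR]].
  set (M := rsum N (fun j => Rabs (qc (S j)))).
  assert (HE := exp_pos M).
  exists (exp M * (2 * (exp M * CR))). split; [apply Rmult_le_pos; nra|].
  intros w Hw. assert (Hw0 := Cmod_ge_0 w).
  set (h := fun t : R => (cexp (- exp_arg (RtoC t * w)) * exp_trunc (RtoC t * w))%C).
  assert (H : Cmod (h 1 - h 0) <= 2 * (exp M * CR * Cmod w ^ S m) * Rabs (1 - 0)).
  { apply (dC_bound h (fun t => w * cexp (- exp_arg (RtoC t * w)) * (exp_trunc_d (RtoC t * w) - exp_arg_d (RtoC t * w) * exp_trunc (RtoC t * w)))%C).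
    intros t Ht. rewrite Rmin_left, Rmax_right in Ht by lra.
    assert (Hl : dC (fun t => RtoC t * w)%C t w).
    { eapply dC_eq; [|apply dC_mult; [apply dC_id|apply dC_const]]. cbv beta; ring. }
    assert (Htw : Cmod (RtoC t * w) <= Cmod w).
    { rewrite Cmod_mult, Cmod_R, Rabs_pos_eq by lra. nra. }
    split.
    - unfold h. eapply dC_eq; [|apply dC_mult; [apply dC_cexp, dC_opp, dC_exp_arg, Hl|apply dC_exp_trunc, Hl]].
      cbv beta. ring.
    - rewrite !Cmod_mult.
      assert (B1 : Cmod (cexp (- exp_arg (RtoC t * w))) <= exp M).
      { apply Cmod_cexp_le. rewrite Cmod_opp. apply exp_arg_bound. lra. }
      assert (B2 := HR (RtoC t * w)%C ltac:(lra)).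
      assert (B3 : Cmod (RtoC t * w) ^ m <= Cmod w ^ m) by (apply pow_incr; split; [apply Cmod_ge_0|auto]).
      assert (B4 : Cmod (exp_trunc_d (RtoC t * w) - exp_arg_d (RtoC t * w) * exp_trunc (RtoC t * w)) <= CR * Cmod w ^ m).
      { eapply Rle_trans; [apply B2|]. apply Rmult_le_compat_l; auto. }
      replace (exp M * CR * Cmod w ^ S m) with (Cmod w * exp M * (CR * Cmod w ^ m)) by (simpl; ring).
      apply Rmult_le_compat; auto; try apply Cmod_ge_0.
      + apply Rmult_le_pos; apply Cmod_ge_0.
      + apply Rmult_le_compat_l; auto. }
  replace (1 - 0) with 1 in H by ring. rewrite Rabs_R1, Rmult_1_r in H.
  assert (h0 : h 0 = 1).
  { unfold h. replace (RtoC 0 * w)%C with (RtoC 0) by ring.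
    assert (Q0 : exp_arg 0 = 0).
    { unfold exp_arg. rewrite (csum_ext N _ (fun _ => RtoC 0)).
      - clear. induction N; simpl; auto. rewrite IHn. ring.
      - intros. rewrite Cpow_0_S. ring. }
    rewrite Q0. replace (- 0)%C with (RtoC 0) by ring. rewrite cexp_0.
    unfold exp_trunc. rewrite csum_S_l, l0, (csum_ext m _ (fun _ => RtoC 0)).
    - replace (csum m (fun _ => RtoC 0)) with (RtoC 0); [simpl; ring|].
      clear. induction m; simpl; auto. rewrite <- IHn. ring.
    - intros. rewrite Cpow_0_S. ring. }
  assert (h1 : h 1 = (/ cexp (exp_arg w) * exp_trunc w)%C).
  { unfold h. rewrite Cmult_1_l, cexp_opp. auto. }
  assert (Hn := cexp_neq_0 (exp_arg w)).
  replace (cexp (exp_arg w) - exp_trunc w)%C with (- (cexp (exp_arg w) * (h 1 - h 0)))%C.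
  2: { rewrite h0, h1. field. auto. }
  rewrite Cmod_opp, Cmod_mult.
  replace (exp M * (2 * (exp M * CR)) * Cmod w ^ S m) with (exp M * (2 * (exp M * CR * Cmod w ^ S m))) by ring.
  apply Rmult_le_compat; auto; try apply Cmod_ge_0. apply Cmod_cexp_le, exp_arg_bound; auto.
Qed.
End ExpPoly.

Lemma lrev_nth p q A a B b r i : (i <= r)%nat -> nth i (lrev p q A a B b r) 0 = lcoef p q A a B b (r - i).
Proof.
  revert i; induction r; intros i Hi.
  - replace i with 0%nat by lia. reflexivity.
  - destruct i; [reflexivity|]. replace (S r - S i)%nat with (r - i)%nat by lia.
    cbn [lrev nth]. apply IHr. lia.
Qed.

Lemma lcoef_rec p q A a B b r : INR (S r) * lcoef p q A a B b (S r) =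
  rsum (S r) (fun i => qcoef p q A a B b (S i) * lcoef p q A a B b (r - i)).
Proof.
  unfold lcoef at 1. cbn [lrev hd]. rewrite <- Rmult_assoc, Rinv_r, Rmult_1_l by (apply not_0_INR; lia).
  apply rsum_ext. intros i Hi. rewrite lrev_nth by lia. auto.
Qed.

(** * Stirling's expansion for products of Gamma functions *)

Section ProdStirling.
Variables (K : nat).
Hypothesis HK : (2 <= K)%nat.
Definition half_ln_2pi : C := RtoC (ln (2 * PI) / 2).
Definition main_term (A a : R) (t : C) : C := (stirling_sum a K (RtoC A * t) + half_ln_2pi)%C.

(** [Reg t X] abstracts the two regions in use, with [X = |Im t|] or [X = Re t] as the large
    quantity, so that one induction serves both. *)
Lemma prod_stirling (n : nat) (A a : nat -> R) (Reg : C -> R -> Prop) :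
  (forall k, (k < n)%nat -> exists Ck, 0 <= Ck /\ forall t X, Reg t X -> exists e,
     CGamma (RtoC (A k) * t + RtoC (a k)) = cexp (main_term (A k) (a k) t + e) /\ Cmod e <= Ck * / X ^ (K - 2)) ->
  exists CC, 0 <= CC /\ forall t X, Reg t X -> exists e,
     cprod n (fun k => CGamma (RtoC (A k) * t + RtoC (a k))) = cexp (csum n (fun k => main_term (A k) (a k) t) + e)
     /\ Cmod e <= CC * / X ^ (K - 2).
Proof.
  induction n; intros H.
  - exists 0. split; [lra|]. intros t X _. exists 0. simpl. split.
    + replace (0 + 0)%C with (RtoC 0) by ring. rewrite cexp_0. auto.
    + rewrite Cmod_0. lra.
  - destruct IHn as [C1 [HC1 H1]]. { intros; apply H; lia. }
    destruct (H n ltac:(lia)) as [C2 [HC2 H2]].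
    exists (C1 + C2). split; [lra|]. intros t X HR.
    destruct (H1 t X HR) as [e1 [E1 B1]], (H2 t X HR) as [e2 [E2 B2]].
    exists (e1 + e2)%C. cbn [cprod csum]. rewrite E1, E2, <- cexp_plus. split.
    + f_equal. ring.
    + eapply Rle_trans; [apply Cmod_triangle|lra].
Qed.

Lemma prod_stirling_im (n : nat) (A a : nat -> R) : (forall k, (k < n)%nat -> 0 < A k) ->
  exists CC, 0 <= CC /\ forall t, 1 <= Rabs (snd t) -> exists e,
     cprod n (fun k => CGamma (RtoC (A k) * t + RtoC (a k))) = cexp (csum n (fun k => main_term (A k) (a k) t) + e)
     /\ Cmod e <= CC * / Rabs (snd t) ^ (K - 2).
Proof.
  intros HA.
  destruct (prod_stirling n A a (fun t X => X = Rabs (snd t) /\ 1 <= X)) as [CC [HC H]].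
  - intros k Hk. assert (HAk := HA k Hk).
    destruct (stirling_im (a k) K (A k) HK HAk) as [CS [HCS HS]].
    exists (CS * / A k ^ (K - 2)). split.
    { apply Rmult_le_pos; auto. left. apply Rinv_0_lt_compat, pow_lt; auto. }
    intros t X [-> HX].
    assert (Es : Rabs (snd (RtoC (A k) * t)%C) = A k * Rabs (snd t)).
    { simpl. rewrite Rmult_0_l, Rplus_0_r, Rabs_mult, (Rabs_pos_eq (A k)); lra. }
    destruct (HS (RtoC (A k) * t)%C) as [e [E Bd]]. { rewrite Es. nra. }
    exists e. split; auto. eapply Rle_trans; [apply Bd|]. rewrite Es, Rpow_mult_distr. right.
    field. split; apply pow_nonzero; lra.
  - exists CC. split; auto.
Qed.

Lemma finite_max (n : nat) (P : nat -> R -> Prop) :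
  (forall k X Y, P k X -> X <= Y -> P k Y) -> (forall k, (k < n)%nat -> exists X, P k X) ->
  exists X, forall k, (k < n)%nat -> P k X.
Proof.
  intros Hm. induction n; intros H; [exists 0; intros; lia|].
  destruct IHn as [X HX]. { intros; apply H; lia. }
  destruct (H n ltac:(lia)) as [Y HY]. exists (Rmax X Y). intros k Hk.
  destruct (Nat.eq_dec k n) as [->|Hn].
  - apply Hm with Y; auto. apply Rmax_r.
  - apply Hm with X; [apply HX; lia|apply Rmax_l].
Qed.

Lemma prod_stirling_re (n : nat) (A a : nat -> R) : (forall k, (k < n)%nat -> 0 < A k) ->
  exists CC X0, 0 <= CC /\ 1 <= X0 /\ forall t, X0 <= fst t -> exists e,
     cprod n (fun k => CGamma (RtoC (A k) * t + RtoC (a k))) = cexp (csum n (fun k => main_term (A k) (a k) t) + e)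
     /\ Cmod e <= CC * / fst t ^ (K - 2).
Proof.
  intros HA.
  destruct (finite_max n (fun k X0 => exists Ck, 0 <= Ck /\ forall t, X0 <= fst t -> 1 <= fst t -> exists e,
     CGamma (RtoC (A k) * t + RtoC (a k)) = cexp (main_term (A k) (a k) t + e) /\ Cmod e <= Ck * / fst t ^ (K - 2))) as [X0 HX0].
  - intros k X Y [Ck [H1 H2]] HXY. exists Ck. split; auto. intros t Ht. apply H2. lra.
  - intros k Hk. assert (HAk := HA k Hk).
    destruct (stirling_re (a k) K HK) as [CS [R1 [HCS [HR1 HS]]]].
    exists (R1 / A k), (CS * / A k ^ (K - 2)). split.
    { apply Rmult_le_pos; auto. left. apply Rinv_0_lt_compat, pow_lt; auto. }
    intros t Ht Ht1.
    assert (Es : fst (RtoC (A k) * t)%C = A k * fst t) by (simpl; ring).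
    destruct (HS (RtoC (A k) * t)%C) as [e [E Bd]].
    { rewrite Es. apply (Rmult_le_compat_l (A k)) in Ht; [|lra]. replace (A k * (R1 / A k)) with R1 in Ht by (field; lra). auto. }
    exists e. split; auto. eapply Rle_trans; [apply Bd|]. rewrite Es, Rpow_mult_distr. right.
    field. split; apply pow_nonzero; lra.
  - destruct (prod_stirling n A a (fun t X => X = fst t /\ X0 <= X /\ 1 <= X)) as [CC [HC H]].
    + intros k Hk. destruct (HX0 k Hk) as [Ck [HCk Hk2]]. exists Ck. split; auto.
      intros t X [-> [H1 H2]]. apply Hk2; auto.
    + exists CC, (Rmax X0 1). split; auto. split; [apply Rmax_r|].
      intros t Ht. apply H. split; auto. split; eapply Rle_trans; [apply Rmax_l|apply Ht|apply Rmax_r|apply Ht].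
Qed.

(** The contribution of one of the two products to [qcoef] at the index [S j], without sign and the
    factor [/ INR (S (S j))]. *)
Definition tauj (n : nat) (A a : nat -> R) (j : nat) : R :=
  rsum n (fun k => bernoulli_poly (S (S j)) (a k) / A k ^ S j).
(** For positive [A] one has [clog (A t) = ln A + clog t], so the expansions separate into
    [t ln t - t], [t], [ln t], constants and powers of [1 / t]. Numerator and denominator can then
    be compared term by term. *)
Lemma main_sum (n : nat) (A a : nat -> R) (t : C) : (forall k, (k < n)%nat -> 0 < A k) -> slit t ->
  csum n (fun k => main_term (A k) (a k) t) =
  (RtoC (rsum n A) * (t * clog t - t) + t * RtoC (rsum n (fun k => A k * ln (A k))%R)
   + RtoC (rsum n (fun k => a k - 1 / 2)%R) * clog t + RtoC (rsum n (fun k => (a k - 1 / 2) * ln (A k))%R)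
   + RtoC (INR n) * half_ln_2pi
   + csum (K - 2) (fun j => RtoC ((-1) ^ S (S j) / INR (S (S j)) * tauj n A a j / INR (S j)) * Cpow (/ t) (S j)))%C.
Proof.
  intros HA Hs. assert (Ht := slit_neq_0 _ Hs).
  induction n.
  - simpl. rewrite (csum_ext (K - 2) _ (fun _ => RtoC 0)).
    + replace (csum (K - 2) (fun _ => RtoC 0)) with (RtoC 0); [ring|].
      clear. induction (K - 2)%nat; simpl; auto. rewrite <- IHn. ring.
    + intros j _. unfold tauj. cbn [rsum]. unfold Rdiv. rewrite Rmult_0_r, Rmult_0_l. ring.
  - cbn [csum rsum]. rewrite IHn by (intros; apply HA; lia).
    rewrite (csum_ext (K - 2) (fun j => RtoC ((-1) ^ S (S j) / INR (S (S j)) * tauj (S n) A a j / INR (S j)) * Cpow (/ t) (S j))%C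
      (fun j => RtoC ((-1) ^ S (S j) / INR (S (S j)) * tauj n A a j / INR (S j)) * Cpow (/ t) (S j)
        + RtoC (bcoef (a n) (S (S j))) * psi (S (S j)) (RtoC (A n) * t))%C).
    + rewrite csum_plus. unfold main_term. rewrite stirling_sum_split by auto. unfold stirling_tail.
      rewrite clog_scale by (auto; apply HA; lia).
      rewrite !RtoC_plus, !RtoC_mult, !RtoC_minus, S_INR, RtoC_plus. ring.
    + intros j _. unfold tauj. cbn [rsum]. fold (tauj n A a j).
      rewrite Rmult_plus_distr_l. unfold Rdiv at 1. rewrite Rmult_plus_distr_r, RtoC_plus, Cmult_plus_distr_r.
      f_equal. unfold psi, bcoef.
      assert (HAn : 0 < A n) by (apply HA; lia).
      assert (NA : RtoC (A n) <> 0) by (intros E; apply RtoC_inj in E; lra).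
      rewrite Cpow_mult_l, <- RtoC_pow, Cpow_inv by auto.
      assert (NT : Cpow t (S j) <> 0) by (apply Cpow_nz; auto).
      assert (NP : A n ^ S j <> 0) by (apply pow_nonzero; lra).
      replace (RtoC ((-1) ^ j * INR (fact j)) / (RtoC (A n ^ S j) * Cpow t (S j)))%C
        with (RtoC ((-1) ^ j * INR (fact j) / A n ^ S j) * / Cpow t (S j))%C.
      2: { unfold Rdiv. rewrite RtoC_mult, RtoC_inv by auto. field. split; auto.
           intros E; apply RtoC_inj in E; auto. }
      rewrite Cmult_assoc, <- RtoC_mult. f_equal. f_equal.
      replace (INR (fact (S (S j)))) with (INR (S (S j)) * (INR (S j) * INR (fact j))).
      2: { rewrite <- !mult_INR. reflexivity. }
      replace ((-1) ^ S (S j)) with ((-1) ^ j) by (simpl; ring).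
      field. repeat split; try apply INR_fact_neq_0; try (apply not_0_INR; lia); auto.
Qed.
End ProdStirling.

Lemma rprod_Rpower n (x f : nat -> R) :
  rprod n (fun k => Rpower (x k) (f k)) = exp (rsum n (fun k => f k * ln (x k))).
Proof. induction n; simpl; [rewrite exp_0; auto|]. rewrite IHn, exp_plus. auto. Qed.

Lemma rsum_opp n f : rsum n (fun k => - f k) = - rsum n f.
Proof. induction n; simpl; [ring|rewrite IHn; ring]. Qed.

Lemma rsum_half n f : rsum n (fun k => f k - 1 / 2) = rsum n f - INR n / 2.
Proof. induction n; [simpl; lra|]. cbn [rsum]. rewrite IHn, S_INR. field. Qed.

Lemma cexp_INR n z : cexp (RtoC (INR n) * z) = Cpow (cexp z) n.
Proof.
  induction n; [simpl; rewrite Cmult_0_l; apply cexp_0|].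
  rewrite S_INR, RtoC_plus, Cmult_plus_distr_r, cexp_plus, IHn, Cmult_1_l. simpl. ring.
Qed.

Lemma rmin_upto_le n f k : (k <= n)%nat -> rmin_upto n f <= f k.
Proof.
  induction n; intros H; [replace k with 0%nat by lia; simpl; lra|].
  cbn [rmin_upto]. destruct (Nat.eq_dec k (S n)) as [->|Hn]; [apply Rmin_r|].
  eapply Rle_trans; [apply Rmin_l|apply IHn; lia].
Qed.

(** * Growth and holomorphy of the quotient *)

Section HFacts.
Variables (p q : nat) (A a B b : nat -> R) (m : nat).
Hypothesis HA : forall k, (k < p)%nat -> 0 < A k.
Hypothesis HB : forall j, (j < q)%nat -> 0 < B j.
Hypothesis HD : DeltaH p q A B = 0.
Hypothesis Hmu : muH p q a b = - INR m.

Let G := GH p q A a B b.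
Let gam := gammaH p A a.
Let lc := lcoef p q A a B b.
Let qc := qcoef p q A a B b.
Definition lnrho : R := rsum p (fun k => A k * ln (A k)) - rsum q (fun k => B k * ln (B k)).
Definition lnnu : R := (INR p - INR q) / 2 * ln (2 * PI) + rsum p (fun k => (a k - 1 / 2) * ln (A k))
   - rsum q (fun k => (b k - 1 / 2) * ln (B k)).
Lemma rho_exp : rhoH p q A B = exp lnrho.
Proof.
  unfold rhoH, lnrho. rewrite !rprod_Rpower, <- exp_plus. f_equal. unfold Rminus. f_equal.
  rewrite <- rsum_opp. apply rsum_ext. intros; ring.
Qed.

Lemma nu_exp : nuH p q A a B b = exp lnnu.
Proof.
  unfold nuH, lnnu. rewrite !rprod_Rpower. unfold Rpower at 1. rewrite <- !exp_plus. f_equal. unfold Rminus. f_equal.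
  rewrite <- rsum_opp. apply rsum_ext. intros; ring.
Qed.

Lemma cpow_rho t : cpow (rhoH p q A B) t = cexp (t * RtoC lnrho).
Proof. unfold cpow. rewrite rho_exp, ln_exp. auto. Qed.

Lemma Cmod_cpow_rho t : Cmod (cpow (rhoH p q A B) t) = exp (lnrho * fst t).
Proof. rewrite cpow_rho, Cmod_cexp. f_equal. simpl. ring. Qed.

Definition main_poly (t : C) : C := csum (S m) (fun k => RtoC (lc (m - k)) * Cpow t k)%C.
Definition GH_main (t : C) : C := (RtoC (nuH p q A a B b) * cpow (rhoH p q A B) t * main_poly t)%C.
Definition GH_rem (t : C) : C := (G t - GH_main t)%C.

Lemma main_poly_trunc (t : C) : t <> 0 -> main_poly t = (Cpow t m * exp_trunc lc m (/ t))%C.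
Proof.
  intros Ht. unfold main_poly, exp_trunc. rewrite csum_rev, <- csum_scal. apply csum_ext. intros k Hk.
  replace (m - (S m - 1 - k))%nat with k by lia. replace (S m - 1 - k)%nat with (m - k)%nat by lia.
  rewrite Cpow_inv by auto.
  replace (Cpow t m) with (Cpow t (m - k) * Cpow t k)%C by (rewrite <- Cpow_add_r; f_equal; lia).
  field. apply Cpow_nz; auto.
Qed.

(** With this order the Stirling error decays with exponent [m + 1], one more than the growth [t^m]
    of the quotient. *)
Definition stirling_order : nat := (m + 3)%nat.
Lemma stirling_order_sub2 : (stirling_order - 2 = S m)%nat. Proof. unfold stirling_order; lia. Qed.

Lemma stirling_order_ge2 : (2 <= stirling_order)%nat. Proof. unfold stirling_order; lia. Qed.

(** [DeltaH = 0] cancels the terms [t ln t - t], and [muH = - m] leaves exactly [m ln t], that is,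
    the factor [t^m]. The terms linear in [t] give [rho^t], the constants [nu], and the inverse
    powers the exponential whose Taylor coefficients are the [l_r]. *)
Lemma GH_form (t ep eq : C) : slit t ->
  cprod p (fun k => CGamma (RtoC (A k) * t + RtoC (a k))) = cexp (csum p (fun k => main_term stirling_order (A k) (a k) t) + ep) ->
  cprod q (fun k => CGamma (RtoC (B k) * t + RtoC (b k))) = cexp (csum q (fun k => main_term stirling_order (B k) (b k) t) + eq) ->
  G t = (RtoC (nuH p q A a B b) * cpow (rhoH p q A B) t * Cpow t m * (cexp (exp_arg qc (S m) (/ t)) * cexp (ep - eq)))%C.
Proof.
  intros Hs Ep Eq. unfold G, GH. rewrite Ep, Eq.
  unfold Cdiv. rewrite <- cexp_opp, <- cexp_plus.
  rewrite nu_exp, <- cexp_RtoC, cpow_rho.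
  replace (Cpow t m) with (cexp (RtoC (INR m) * clog t)) by (rewrite cexp_INR, cexp_clog; auto).
  rewrite <- !cexp_plus. f_equal.
  rewrite (main_sum stirling_order stirling_order_ge2 p A a t HA Hs), (main_sum stirling_order stirling_order_ge2 q B b t HB Hs).
  rewrite stirling_order_sub2.
  assert (EQ : (csum (S m) (fun j => RtoC ((-1) ^ S (S j) / INR (S (S j)) * tauj p A a j / INR (S j)) * Cpow (/ t) (S j))
     = exp_arg qc (S m) (/ t) + csum (S m) (fun j => RtoC ((-1) ^ S (S j) / INR (S (S j)) * tauj q B b j / INR (S j)) * Cpow (/ t) (S j)))%C).
  { unfold exp_arg. rewrite <- csum_plus. apply csum_ext. intros j _.
    rewrite <- Cmult_plus_distr_r, <- RtoC_plus. f_equal. f_equal.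
    unfold qc, qcoef. unfold tauj. field. split; apply not_0_INR; lia. }
  rewrite EQ.
  unfold DeltaH in HD. unfold muH in Hmu.
  replace (rsum q B) with (rsum p A) by lra.
  replace (rsum p (fun k => a k - 1 / 2)) with (rsum q (fun k => b k - 1 / 2) + INR m) by (rewrite !rsum_half; lra).
  unfold lnnu, lnrho, half_ln_2pi. rewrite !RtoC_minus, !RtoC_plus.
  replace ((INR p - INR q) / 2 * ln (2 * PI)) with ((INR p - INR q) * (ln (2 * PI) / 2)) by field.
  rewrite RtoC_mult, RtoC_minus. ring.
Qed.

Lemma GH_rem_form (t e : C) : t <> 0 ->
  G t = (RtoC (nuH p q A a B b) * cpow (rhoH p q A B) t * Cpow t m * (cexp (exp_arg qc (S m) (/ t)) * cexp e))%C ->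
  GH_rem t = (RtoC (nuH p q A a B b) * cpow (rhoH p q A B) t * Cpow t m *
    (cexp (exp_arg qc (S m) (/ t)) * (cexp e - 1) + (cexp (exp_arg qc (S m) (/ t)) - exp_trunc lc m (/ t))))%C.
Proof. intros Ht E. unfold GH_rem, GH_main. rewrite E, main_poly_trunc by auto. ring. Qed.

Lemma lc_0 : lc 0 = 1. Proof. reflexivity. Qed.

Lemma Cmod_inv_le1 (t : C) : 1 <= Cmod t -> Cmod (/ t) <= 1.
Proof. intros H. rewrite Cmod_inv_tot, <- Rinv_1. apply Rinv_le_contravar; lra. Qed.

Lemma GH_bound : exists CG, 0 <= CG /\ forall t, 1 <= Rabs (snd t) ->
  Cmod (G t) <= CG * exp (lnrho * fst t) * Cmod t ^ m.
Proof.
  destruct (prod_stirling_im stirling_order stirling_order_ge2 p A a HA) as [Cp [HCp Sp]].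
  destruct (prod_stirling_im stirling_order stirling_order_ge2 q B b HB) as [Cq [HCq Sq]].
  set (M := rsum (S m) (fun j => Rabs (qc (S j)))).
  exists (exp lnnu * (exp M * exp (Cp + Cq))). split.
  { left. repeat apply Rmult_lt_0_compat; apply exp_pos. }
  intros t Ht.
  destruct (Sp t Ht) as [ep [Ep Bp]], (Sq t Ht) as [eq [Eq Bq]].
  assert (Hs : slit t) by (right; intros E; rewrite E, Rabs_R0 in Ht; lra).
  assert (H1 : 1 <= Cmod t) by (eapply Rle_trans; [apply Ht|apply abs_snd_le]).
  rewrite (GH_form t ep eq Hs Ep Eq).
  rewrite !Cmod_mult, Cmod_cpow_rho, Cmod_pow, Cmod_R, nu_exp, Rabs_pos_eq by (left; apply exp_pos).
  assert (X1 : Cmod (cexp (exp_arg qc (S m) (/ t))) <= exp M) by (apply Cmod_cexp_le, exp_arg_bound, Cmod_inv_le1; auto).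
  assert (X2 : Cmod (cexp (ep - eq)) <= exp (Cp + Cq)).
  { apply Cmod_cexp_le. eapply Rle_trans; [apply Cmod_triangle_sub|].
    assert (I : / Rabs (snd t) ^ (stirling_order - 2) <= 1).
    { rewrite <- Rinv_1. apply Rinv_le_contravar; [lra|]. apply pow_R1_Rle; auto. }
    assert (I0 : 0 < / Rabs (snd t) ^ (stirling_order - 2)) by (apply Rinv_0_lt_compat, pow_lt; lra).
    nra. }
  assert (X3 : Cmod (cexp (exp_arg qc (S m) (/ t))) * Cmod (cexp (ep - eq)) <= exp M * exp (Cp + Cq)).
  { apply Rmult_le_compat; auto; apply Cmod_ge_0. }
  assert (X4 : 0 <= exp lnnu * exp (lnrho * fst t) * Cmod t ^ m).
  { apply Rmult_le_pos; [left; apply Rmult_lt_0_compat; apply exp_pos|apply pow_le, Cmod_ge_0]. }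
  apply Rle_trans with (exp lnnu * exp (lnrho * fst t) * Cmod t ^ m * (exp M * exp (Cp + Cq))).
  - apply Rmult_le_compat_l; auto.
  - right; ring.
Qed.

(** Two errors of order [h^(-m-1)] relative to [nu rho^t t^m] add up: that of Stirling's series and
    that of truncating the exponential. Horizontal edges use the expansion in [|Im t|], the right
    edge the one in [Re t]. *)
Lemma GH_rem_bound : exists CT h0, 0 <= CT /\ 1 <= h0 /\ forall (h : R) (t : C), h0 <= h -> (Rabs (snd t) = h \/ fst t = h) ->
  Cmod (GH_rem t) <= CT * exp (lnrho * fst t) * Cmod t ^ m / h ^ S m.
Proof.
  destruct (prod_stirling_im stirling_order stirling_order_ge2 p A a HA) as [Cp [HCp Sp]].
  destruct (prod_stirling_im stirling_order stirling_order_ge2 q B b HB) as [Cq [HCq Sq]].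
  destruct (prod_stirling_re stirling_order stirling_order_ge2 p A a HA) as [Cp' [Xp [HCp' [HXp Sp']]]].
  destruct (prod_stirling_re stirling_order stirling_order_ge2 q B b HB) as [Cq' [Xq [HCq' [HXq Sq']]]].
  destruct (exp_poly qc lc m (S m) ltac:(lia) lc_0 (lcoef_rec p q A a B b)) as [CE [HCE HE]].
  set (M := rsum (S m) (fun j => Rabs (qc (S j)))).
  set (CC := Cp + Cq + Cp' + Cq').
  assert (HM := exp_pos M).
  (* [CC] in the threshold makes the Stirling error at most [1] in modulus, as [cexp_sub1_bound]
     requires; its factor is the [6]. *)
  exists (exp lnnu * (exp M * (6 * CC) + CE)), (Xp + Xq + CC).
  assert (HCC : 0 <= CC) by (unfold CC; lra).
  split.
  { apply Rmult_le_pos; [left; apply exp_pos|]. apply Rplus_le_le_0_compat; auto. apply Rmult_le_pos; lra. }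
  split; [lra|]. intros h t Hh Ht.
  assert (Hh1 : 1 <= h) by lra.
  assert (Hth : h <= Cmod t).
  { destruct Ht as [E|E]; rewrite <- E; [apply abs_snd_le|eapply Rle_trans; [apply Rle_abs|apply abs_fst_le]]. }
  assert (Hs : slit t).
  { destruct Ht as [E|E]; [right|left; lra]. intros E0; rewrite E0, Rabs_R0 in E; lra. }
  assert (Hhm : 0 < / h ^ S m) by (apply Rinv_0_lt_compat, pow_lt; lra).
  assert (X : exists e, G t = (RtoC (nuH p q A a B b) * cpow (rhoH p q A B) t * Cpow t m * (cexp (exp_arg qc (S m) (/ t)) * cexp e))%C
     /\ Cmod e <= CC * / h ^ S m).
  { destruct Ht as [E|E].
    - destruct (Sp t ltac:(lra)) as [ep [Ep Bp]], (Sq t ltac:(lra)) as [eq [Eq Bq]].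
      exists (ep - eq)%C. split; [apply GH_form; auto|].
      eapply Rle_trans; [apply Cmod_triangle_sub|]. rewrite E, stirling_order_sub2 in *. unfold CC. nra.
    - destruct (Sp' t ltac:(lra)) as [ep [Ep Bp]], (Sq' t ltac:(lra)) as [eq [Eq Bq]].
      exists (ep - eq)%C. split; [apply GH_form; auto|].
      eapply Rle_trans; [apply Cmod_triangle_sub|]. rewrite E, stirling_order_sub2 in *. unfold CC. nra. }
  destruct X as [e [Eg Be]].
  assert (Be1 : Cmod e <= 1).
  { eapply Rle_trans; [apply Be|]. apply (Rmult_le_reg_r (h ^ S m)); [apply pow_lt; lra|].
    rewrite Rmult_assoc, Rinv_l, Rmult_1_r, Rmult_1_l by (apply pow_nonzero; lra).
    apply Rle_trans with h; [lra|]. rewrite <- (pow_1 h) at 1. apply Rle_pow; [lra|lia]. }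
  rewrite (GH_rem_form t e (slit_neq_0 _ Hs) Eg).
  rewrite !Cmod_mult, Cmod_cpow_rho, Cmod_pow, Cmod_R, nu_exp, Rabs_pos_eq by (left; apply exp_pos).
  assert (H1 : 1 <= Cmod t) by lra.
  assert (W1 := Cmod_inv_le1 t H1).
  assert (Y1 : Cmod (cexp (exp_arg qc (S m) (/ t)) * (cexp e - 1)) <= exp M * (6 * (CC * / h ^ S m))).
  { rewrite Cmod_mult. apply Rmult_le_compat; try apply Cmod_ge_0.
    - apply Cmod_cexp_le, exp_arg_bound; auto.
    - eapply Rle_trans; [apply cexp_sub1_bound; auto|lra]. }
  assert (Y2 : Cmod (cexp (exp_arg qc (S m) (/ t)) - exp_trunc lc m (/ t)) <= CE * / h ^ S m).
  { eapply Rle_trans; [apply HE; auto|]. apply Rmult_le_compat_l; auto.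
    rewrite Cmod_inv_tot, pow_inv. apply Rinv_le_contravar; [apply pow_lt; lra|]. apply pow_incr; lra. }
  assert (Y3 := Cmod_triangle (cexp (exp_arg qc (S m) (/ t)) * (cexp e - 1)) (cexp (exp_arg qc (S m) (/ t)) - exp_trunc lc m (/ t))).
  assert (X4 : 0 <= exp lnnu * exp (lnrho * fst t) * Cmod t ^ m).
  { apply Rmult_le_pos; [left; apply Rmult_lt_0_compat; apply exp_pos|apply pow_le, Cmod_ge_0]. }
  apply Rle_trans with (exp lnnu * exp (lnrho * fst t) * Cmod t ^ m * (exp M * (6 * (CC * / h ^ S m)) + CE * / h ^ S m)).
  - apply Rmult_le_compat_l; auto. lra.
  - right. unfold Rdiv. ring.
Qed.

Lemma GH_main_bound : exists CP, 0 <= CP /\ forall t, Cmod (GH_main t) <= CP * exp (lnrho * fst t) * (1 + Cmod t) ^ m.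
Proof.
  exists (exp lnnu * rsum (S m) (fun k => Rabs (lc (m - k)))).
  assert (Hr : 0 <= rsum (S m) (fun k => Rabs (lc (m - k)))) by (apply rsum_nonneg; intros; apply Rabs_pos).
  split; [apply Rmult_le_pos; auto; left; apply exp_pos|].
  intros t. unfold GH_main. rewrite !Cmod_mult, Cmod_cpow_rho, Cmod_R, nu_exp, Rabs_pos_eq by (left; apply exp_pos).
  assert (X : Cmod (main_poly t) <= rsum (S m) (fun k => Rabs (lc (m - k))) * (1 + Cmod t) ^ m).
  { rewrite Rmult_comm, <- rsum_scal. apply csum_bound. intros k Hk. rewrite Cmod_mult, Cmod_R, Cmod_pow, Rmult_comm.
    apply Rmult_le_compat_r; [apply Rabs_pos|].
    apply Rle_trans with ((1 + Cmod t) ^ k).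
    - apply pow_incr. generalize (Cmod_ge_0 t); lra.
    - apply Rle_pow; [generalize (Cmod_ge_0 t); lra|lia]. }
  apply Rle_trans with (exp lnnu * exp (lnrho * fst t) * (rsum (S m) (fun k => Rabs (lc (m - k))) * (1 + Cmod t) ^ m)).
  - apply Rmult_le_compat_l; auto. left; apply Rmult_lt_0_compat; apply exp_pos.
  - right; ring.
Qed.

(** A half-plane cut along the real ray up to [gam], which contains all poles. The left bound [x]
    keeps the arguments of all Gamma functions in a half-plane where one shift formula for [rGamma]
    is valid. *)
Definition GH_domain (x : R) (t : C) : Prop := x < fst t /\ (gam < fst t \/ snd t <> 0).
Lemma openC_GH_domain x : openC (GH_domain x).
Proof.
  intros z [H1 H2]. destruct H2 as [H2|H2].
  - assert (Hp : 0 < Rmin (fst z - x) (fst z - gam)) by (apply Rmin_pos; lra).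
    exists (mkposreal _ Hp). intros y [Hy _]. change (Rabs (fst y - fst z) < Rmin (fst z - x) (fst z - gam)) in Hy.
    apply Rabs_def2 in Hy. assert (X1 := Rmin_l (fst z - x) (fst z - gam)). assert (X2 := Rmin_r (fst z - x) (fst z - gam)).
    split; [lra|left; lra].
  - assert (Hs := Rabs_pos_lt _ H2).
    assert (Hp : 0 < Rmin (fst z - x) (Rabs (snd z))) by (apply Rmin_pos; lra).
    exists (mkposreal _ Hp). intros y [Hy1 Hy2].
    change (Rabs (fst y - fst z) < Rmin (fst z - x) (Rabs (snd z))) in Hy1.
    change (Rabs (snd y - snd z) < Rmin (fst z - x) (Rabs (snd z))) in Hy2.
    assert (X1 := Rmin_l (fst z - x) (Rabs (snd z))). assert (X2 := Rmin_r (fst z - x) (Rabs (snd z))).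
    apply Rabs_def2 in Hy1. split; [lra|right]. intros E. rewrite E in Hy2.
    replace (0 - snd z) with (- snd z) in Hy2 by ring. rewrite Rabs_Ropp in Hy2. lra.
Qed.

Lemma num_slit k (t : C) x : (k < p)%nat -> GH_domain x t -> slit (RtoC (A k) * t + RtoC (a k)).
Proof.
  intros Hk [_ [H|H]]; assert (HAk := HA k Hk).
  - left. simpl. rewrite Rmult_0_l, Rminus_0_r.
    assert (X := rmin_upto_le (pred p) (fun k => a k / A k) k ltac:(lia)). cbv beta in X.
    unfold gam, gammaH in H.
    assert (Y : - (a k / A k) < fst t) by lra.
    apply (Rmult_lt_compat_l (A k)) in Y; auto. replace (A k * - (a k / A k)) with (- a k) in Y by (field; lra). lra.
  - right. simpl. rewrite Rmult_0_l, !Rplus_0_r. apply Rmult_integral_contrapositive; split; auto; lra.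
Qed.

Lemma hol_GH x : hol (GH_domain x) G.
Proof.
  apply hol_ext with (fun t => cprod p (fun k => / rGamma (RtoC (A k) * t + RtoC (a k))) * cprod q (fun j => rGamma (RtoC (B j) * t + RtoC (b j))))%C.
  - apply openC_GH_domain.
  - intros t _. unfold G, GH, Cdiv. unfold rGamma. rewrite !cprod_inv, Cinv_inv_tot. reflexivity.
  - apply hol_mult.
    + apply (hol_cprod _ p (fun k t => / rGamma (RtoC (A k) * t + RtoC (a k)))%C). intros k Hk.
      apply hol_inv.
      * intros z Hz. apply rGamma_neq_0. eapply num_slit; eauto.
      * apply (hol_affine (GH_domain x) (fun z => A k * x + a k < fst z)); [|apply hol_rGamma].
        intros z [Hz _]. simpl. assert (HAk := HA k Hk). nra.
    + apply (hol_cprod _ q (fun j t => rGamma (RtoC (B j) * t + RtoC (b j)))%C). intros k Hk.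
      apply (hol_affine (GH_domain x) (fun z => B k * x + b k < fst z)); [|apply hol_rGamma].
      intros z [Hz _]. simpl. assert (HAk := HB k Hk). nra.
Qed.

Lemma hol_cpow U (x : R) : hol U (fun t => cpow x t).
Proof.
  unfold cpow. apply hol_cexp. apply hol_mult; [apply hol_id|apply hol_const].
Qed.

Lemma hol_GH_main U : hol U GH_main.
Proof.
  unfold GH_main. apply hol_mult; [apply hol_mult; [apply hol_const|apply hol_cpow]|].
  unfold main_poly. apply (hol_csum U (S m) (fun k t => RtoC (lc (m - k)) * Cpow t k)%C). intros k _.
  apply hol_mult; [apply hol_const|apply hol_pow, hol_id].
Qed.
End HFacts.

(** * Loop integrals and the Mellin transform *)

(** From [y^m / m! <= e^y] at [y = kap (|u| + M)]; the growth to the left is compensated because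
    [|u| + u <= 2 |c|] for [u <= c]. It is used to pay for a polynomial factor with part of an
    exponential decay. *)
Lemma poly_exp (kap : R) (m : nat) (M c : R) : 0 < kap -> 0 <= M ->
  exists Cx, 0 <= Cx /\ forall u, u <= c -> (Rabs u + M) ^ m * exp (kap * u) <= Cx.
Proof.
  intros Hk HM. assert (Hkm : 0 < kap ^ m) by (apply pow_lt; auto).
  exists (INR (fact m) / kap ^ m * exp (kap * (2 * Rabs c + M))).
  assert (F := INR_fact_lt_0 m).
  assert (Hq : 0 < INR (fact m) / kap ^ m) by (apply Rdiv_lt_0_compat; auto).
  split; [left; apply Rmult_lt_0_compat; auto; apply exp_pos|].
  intros u Hu. assert (Hy := Rabs_pos u). set (y := Rabs u + M).
  assert (H1 : y ^ m <= INR (fact m) / kap ^ m * exp (kap * y)).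
  { assert (E := exp_term_le (kap * y) m).
    assert (Hky : 0 <= kap * y) by (apply Rmult_le_pos; unfold y; lra).
    rewrite (Rabs_pos_eq (kap * y)) in E by auto.
    rewrite Rpow_mult_distr in E. assert (E' := Rle_trans _ _ _ (Rle_abs _) E).
    apply (Rmult_le_compat_l (INR (fact m) / kap ^ m)) in E'; [|lra].
    eapply Rle_trans; [|apply E']. right. field. lra. }
  apply Rle_trans with (INR (fact m) / kap ^ m * exp (kap * y) * exp (kap * u)).
  - apply Rmult_le_compat_r; auto. left; apply exp_pos.
  - rewrite Rmult_assoc, <- exp_plus. apply Rmult_le_compat_l; [lra|]. apply exp_le.
    unfold y. assert (Rabs u + u <= 2 * Rabs c).
    { unfold Rabs. destruct (Rcase_abs u), (Rcase_abs c); lra. }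
    replace (kap * (Rabs u + M) + kap * u) with (kap * (Rabs u + u + M)) by ring.
    apply Rmult_le_compat_l; lra.
Qed.

Lemma is_RInt_expk (C0 kap a b : R) : kap <> 0 ->
  is_RInt (fun u => C0 * exp (kap * u)) a b (C0 / kap * (exp (kap * b) - exp (kap * a))).
Proof.
  intros Hk.
  evar_last; [apply (is_RInt_derive (fun u => C0 / kap * exp (kap * u)) (fun u => C0 * exp (kap * u)))|].
  - intros x _. evar_last.
    + apply (is_derive_scal (fun u => exp (kap * u)) x (C0 / kap)).
      apply (is_derive_comp exp (fun u => kap * u)); [apply is_derive_exp|].
      apply (is_derive_scal (fun u => u) x kap). apply @is_derive_id.
    + unfold scal, one; simpl; unfold mult; simpl. field; auto.
  - intros x _. apply (continuous_Rmult (U := R_UniformSpace) (fun _ => C0)); [apply continuous_const|].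
    apply (continuous_comp (fun u => kap * u) exp); [|apply continuous_exp].
    apply (continuous_Rmult (U := R_UniformSpace) (fun _ => kap)); [apply continuous_const|apply continuous_id].
  - unfold minus, plus, opp; simpl. ring.
Qed.

Lemma RIntC_Chasles (f : R -> C) a b c : a <= b <= c -> (forall t, a <= t <= c -> contC f t) ->
  (RIntC f a b + RIntC f b c = RIntC f a c)%C.
Proof.
  intros H Hf. apply (RInt_Chasles (V := C_R_CompleteNormedModule)); eexists; apply contC_ex;
  intros t Ht; apply Hf; rewrite Rmin_left, Rmax_right in Ht by lra; lra.
Qed.

Lemma RIntC_exp_bound (f : R -> C) (C0 kap a b : R) : 0 <= C0 -> 0 < kap -> a <= b ->
  (forall u, a <= u <= b -> contC f u) -> (forall u, a <= u <= b -> Cmod (f u) <= C0 * exp (kap * u)) ->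
  Cmod (RIntC f a b) <= C0 / kap * exp (kap * b).
Proof.
  intros HC Hk Hab Hf Hb.
  eapply Rle_trans; [apply (is_RIntC_bound f (fun u => C0 * exp (kap * u)) a b (RIntC f a b)
     (C0 / kap * (exp (kap * b) - exp (kap * a))) Hab Hb); [|apply is_RInt_expk; lra]|].
  - apply contC_ex. rewrite Rmin_left, Rmax_right by lra. auto.
  - apply Rmult_le_compat_l; [apply Rmult_le_pos; auto; left; apply Rinv_0_lt_compat; auto|].
    generalize (exp_pos (kap * a)); lra.
Qed.

Lemma RIntC_const_bound (f : R -> C) (M a b : R) : a <= b ->
  (forall u, a <= u <= b -> contC f u) -> (forall u, a <= u <= b -> Cmod (f u) <= M) ->
  Cmod (RIntC f a b) <= M * (b - a).
Proof.
  intros Hab Hf Hb. apply is_RIntC_bound_const with f; auto.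
  apply contC_ex. rewrite Rmin_left, Rmax_right by lra. auto.
Qed.

Lemma Cplus_minus_r (x y : C) : (x + y - y)%C = x.
Proof. ring. Qed.

(** Cauchy's criterion at [-oo]. The rate of convergence is recorded because the integrals over the
    loop are later needed uniformly in [x]. *)
Lemma improper_exp (f : R -> C) (c C0 kap : R) : 0 <= C0 -> 0 < kap ->
  (forall u, u <= c -> contC f u) -> (forall u, u <= c -> Cmod (f u) <= C0 * exp (kap * u)) ->
  exists l, @is_RInt_gen C_R_NormedModule f (Rbar_locally m_infty) (at_point c) l /\
    forall x, x <= c -> Cmod (l - RIntC f x c) <= C0 / kap * exp (kap * x).
Proof.
  intros HC Hk Hf Hb.
  assert (D : forall x y, x <= y -> y <= c -> Cmod (RIntC f x c - RIntC f y c) <= C0 / kap * exp (kap * y)).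
  { intros x y Hxy Hyc. rewrite <- (RIntC_Chasles f x y c); [|lra|intros; apply Hf; lra].
    rewrite Cplus_minus_r. apply RIntC_exp_bound; auto; intros; [apply Hf|apply Hb]; lra. }
  assert (HCk : 0 <= C0 / kap) by (apply Rmult_le_pos; auto; left; apply Rinv_0_lt_compat; auto).
  assert (Small : forall eps, 0 < eps -> exists x0, x0 <= c /\ C0 / kap * exp (kap * x0) < eps).
  { intros eps He. set (K0 := C0 / kap + 1).
    exists (Rmin c (ln (eps / K0) / kap)). split; [apply Rmin_l|].
    assert (HK0 : 0 < K0) by (unfold K0; lra).
    assert (exp (kap * Rmin c (ln (eps / K0) / kap)) <= eps / K0).
    { rewrite <- (exp_ln (eps / K0)) at 2 by (apply Rdiv_lt_0_compat; auto). apply exp_le.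
      apply Rle_trans with (kap * (ln (eps / K0) / kap)).
      - apply Rmult_le_compat_l; [lra|apply Rmin_r].
      - right. field. lra. }
    assert (0 < eps / K0) by (apply Rdiv_lt_0_compat; auto).
    apply Rle_lt_trans with (C0 / kap * (eps / K0)); [apply Rmult_le_compat_l; auto|].
    apply (Rmult_lt_reg_r K0); auto. replace (C0 / kap * (eps / K0) * K0) with (C0 / kap * eps) by (field; split; lra).
    unfold K0. nra. }
  destruct (proj1 (filterlim_locally_cauchy (U := C_R_CompleteNormedModule) (F := Rbar_locally m_infty) (fun x => RIntC f x c))) as [l Hl].
  { intros eps. destruct (Small (eps / 2) ltac:(generalize (cond_pos eps); lra)) as [x0 [Hx0 Hs]].
    exists (fun x => x < x0). split; [exists x0; auto|].
    intros u v Hu Hv.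
    assert (Du := D u x0 ltac:(lra) Hx0). assert (Dv := D v x0 ltac:(lra) Hx0).
    assert (Duv : Cmod (RIntC f v c - RIntC f u c) < eps).
    { replace (RIntC f v c - RIntC f u c)%C with ((RIntC f v c - RIntC f x0 c) - (RIntC f u c - RIntC f x0 c))%C by ring.
      eapply Rle_lt_trans; [apply Cmod_triangle_sub|lra]. }
    split.
    - change (Rabs (fst (RIntC f v c) - fst (RIntC f u c)) < eps).
      eapply Rle_lt_trans; [apply (abs_fst_le (RIntC f v c - RIntC f u c)%C)|auto].
    - change (Rabs (snd (RIntC f v c) - snd (RIntC f u c)) < eps).
      eapply Rle_lt_trans; [apply (abs_snd_le (RIntC f v c - RIntC f u c)%C)|auto]. }
  exists l. split.
  - intros P HP. specialize (Hl P HP). unfold filtermap in Hl.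
    assert (Hc : Rbar_locally m_infty (fun x => x < c)) by (exists c; auto).
    apply (Filter_prod _ _ _ (fun x => P (RIntC f x c) /\ x < c) (fun y => y = c)); auto.
    + apply filter_and; auto.
    + reflexivity.
    + intros x y [Hx Hxc] ->. simpl. exists (RIntC f x c). split; auto.
      apply contC_ex. rewrite Rmin_left, Rmax_right by lra. intros; apply Hf; lra.
  - intros x Hx. apply le_epsilon. intros eps He.
    assert (Hb2 := Hl (fun z => Cmod (z - l) < eps)).
    destruct Hb2 as [M HM].
    { assert (He2 : 0 < eps / 2) by lra. exists (mkposreal _ He2). intros z [Hz1 Hz2].
      change (Rabs (fst z - fst l) < eps / 2) in Hz1. change (Rabs (snd z - snd l) < eps / 2) in Hz2.
      eapply Rle_lt_trans; [apply Cmod_le_abs|]. simpl. unfold Rminus in *. lra. }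
    set (y := Rmin x M - 1). assert (Hy1 := Rmin_l x M). assert (Hy2 := Rmin_r x M).
    specialize (HM y ltac:(unfold y; lra)).
    assert (Dy := D y x ltac:(unfold y; lra) Hx).
    replace (l - RIntC f x c)%C with ((RIntC f y c - RIntC f x c) - (RIntC f y c - l))%C by ring.
    eapply Rle_trans; [apply Cmod_triangle_sub|lra].
Qed.

Lemma Cmod_cpow (x : R) (z : C) : Cmod (cpow x z) = exp (fst z * ln x).
Proof. unfold cpow. rewrite Cmod_cexp. f_equal. simpl. ring. Qed.

Lemma cpow_plus (x : R) (z w : C) : cpow x (z + w) = (cpow x z * cpow x w)%C.
Proof. unfold cpow. rewrite Cmult_plus_distr_r, cexp_plus. auto. Qed.

Lemma cpow_minus1 (x : R) : 0 < x -> cpow x (- RtoC 1) = RtoC (/ x).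
Proof.
  intros Hx. unfold cpow. replace (- RtoC 1 * RtoC (ln x))%C with (RtoC (- ln x)) by (rewrite RtoC_opp; ring).
  rewrite cexp_RtoC, exp_Ropp, exp_ln; auto.
Qed.

Lemma dC_cpow (w : C) (x : R) : 0 < x -> dC (fun y => cpow y w) x (w * RtoC (/ x) * cpow x w)%C.
Proof.
  intros Hx. unfold cpow. apply dC_cexp.
  eapply dC_eq; [|apply dC_scal; apply (dC_comp (fun y => RtoC y) ln); [apply dC_id|apply is_derive_ln; auto]].
  ring.
Qed.

Lemma param_cpow (g w : R -> C) (al be x : R) : 0 < x ->
  (forall t, Rmin al be <= t <= Rmax al be -> contC g t) ->
  (forall t, Rmin al be <= t <= Rmax al be -> contC w t) ->
  dC (fun y => RIntC (fun t => g t * cpow y (w t))%C al be) x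
     (RIntC (fun t => g t * (w t * RtoC (/ x) * cpow x (w t)))%C al be).
Proof.
  intros Hx Hg Hw.
  apply (dC_RInt_param (fun y t => g t * cpow y (w t))%C (fun y t => g t * (w t * RtoC (/ y) * cpow y (w t)))%C al be x (mkposreal x Hx)).
  - intros y t Hy Ht. simpl in Hy. apply Rabs_def2 in Hy. apply dC_scal. apply dC_cpow. lra.
  - intros y t Hy Ht. apply contC_mult; auto. unfold cpow. apply contC_cexp.
    apply contC_mult; auto. apply contC_const.
  - intros t Ht.
    assert (Cg : forall v : R -> C, contC v t -> contC (U := prod_UniformSpace R_UniformSpace R_UniformSpace) (fun p => v (snd p)) (x, t)).
    { intros v Hv. apply (contC_comp (U := prod_UniformSpace R_UniformSpace R_UniformSpace) (V := R_UniformSpace) snd v); [apply continuous_snd|auto]. }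
    apply contC_mult; [apply Cg; auto|]. apply contC_mult; [apply contC_mult; [apply Cg; auto|]|].
    + apply contC_RtoC. apply (continuous_Rinv_comp (U := prod_UniformSpace R_UniformSpace R_UniformSpace) fst); [simpl; lra|apply continuous_fst].
    + unfold cpow. apply contC_cexp. apply contC_mult; [apply Cg; auto|]. apply contC_RtoC.
      apply (continuous_comp (fst : prod_UniformSpace R_UniformSpace R_UniformSpace -> R) ln); [apply continuous_fst|].
      apply (ex_derive_continuous ln). eexists. apply is_derive_ln. auto.
Qed.

Definition hor_int (f : C -> C) (y a b : R) : C := RIntC (fun u => f (u, y)) a b.
Definition ver_int (f : C -> C) (x a b : R) : C := RIntC (fun y => f (x, y)) a b.
(** The boundary of [[-R0, c] x [-h, h]] without its left edge. *)
Definition loop (f : C -> C) (R0 c h : R) : C := (hor_int f (- h) (- R0) c + Ci * ver_int f c (- h) h - hor_int f h (- R0) c)%C.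
Lemma contC_hor (f : C -> C) (u y : R) : contC (U := C_UniformSpace) f (u, y) -> contC (fun u => f (u, y)) u.
Proof.
  intros H. apply (contC_compC (fun u => (u, y) : C) f); auto. split; simpl; [apply continuous_id|apply continuous_const].
Qed.

Lemma contC_ver (f : C -> C) (x y : R) : contC (U := C_UniformSpace) f (x, y) -> contC (fun y => f (x, y)) y.
Proof.
  intros H. apply (contC_compC (fun y => (x, y) : C) f); auto. split; simpl; [apply continuous_const|apply continuous_id].
Qed.

Lemma rect_int_eq f a b c d : rect_int f a b c d = (hor_int f c a b + Ci * ver_int f b c d - hor_int f d a b - Ci * ver_int f a c d)%C.
Proof. reflexivity. Qed.

Section Move.
Variables (U : C -> Prop) (f : C -> C).
Hypothesis Hf : hol U f.
Lemma hor_int_chasles y a b c : a <= b <= c -> (forall u, a <= u <= c -> U (u, y)) ->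
  (hor_int f y a b + hor_int f y b c = hor_int f y a c)%C.
Proof.
  intros H HU. apply RIntC_Chasles; auto. intros t Ht. apply contC_hor. apply (hol_cont U); auto.
Qed.

Lemma ver_int_chasles x a b c : a <= b <= c -> (forall y, a <= y <= c -> U (x, y)) ->
  (ver_int f x a b + ver_int f x b c = ver_int f x a c)%C.
Proof.
  intros H HU. apply RIntC_Chasles; auto. intros t Ht. apply contC_ver. apply (hol_cont U); auto.
Qed.

Lemma loop_shift (R0 c c' h : R) : - R0 <= c -> c <= c' -> 0 <= h ->
  (forall u, - R0 <= u <= c' -> U (u, h) /\ U (u, - h)) ->
  loop f R0 c' h = (loop f R0 c h + rect_int f c c' (- h) h)%C.
Proof.
  intros H1 H2 H3 HU. rewrite rect_int_eq. unfold loop.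
  rewrite <- (hor_int_chasles h (- R0) c c'), <- (hor_int_chasles (- h) (- R0) c c'); try lra.
  - ring.
  - intros; apply HU; auto.
  - intros; apply HU; auto.
Qed.

(** A loop has no left edge, so the left edges of the two added rectangles survive as separate
    terms. *)
Lemma loop_widen (R0 c h h' : R) : - R0 <= c -> 0 <= h <= h' ->
  (forall y, - h' <= y <= h' -> U (c, y)) ->
  loop f R0 c h' = (loop f R0 c h + rect_int f (- R0) c h h' + rect_int f (- R0) c (- h') (- h)
     + Ci * ver_int f (- R0) h h' + Ci * ver_int f (- R0) (- h') (- h))%C.
Proof.
  intros H1 H3 HU. rewrite !rect_int_eq. unfold loop.
  rewrite <- (ver_int_chasles c (- h') h h'), <- (ver_int_chasles c (- h') (- h) h); try lra.
  - ring.
  - intros; apply HU; lra.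
  - intros; apply HU; lra.
Qed.
End Move.

Lemma continuous_Cmod {U : UniformSpace} (f : U -> C) (x : U) : contC f x -> continuous (fun t => Cmod (f t)) x.
Proof.
  intros [a b]. unfold Cmod.
  apply (continuous_comp (fun t => fst (f t) ^ 2 + snd (f t) ^ 2) sqrt).
  - apply (continuous_plus (fun t => fst (f t) ^ 2) (fun t => snd (f t) ^ 2)).
    + apply continuous_ext with (fun t => fst (f t) * fst (f t)). { intros; simpl; ring. }
      apply continuous_Rmult; auto.
    + apply continuous_ext with (fun t => snd (f t) * snd (f t)). { intros; simpl; ring. }
      apply continuous_Rmult; auto.
  - apply continuous_sqrt.
Qed.

Lemma RIntC_ext (f g : R -> C) a b : (forall t, f t = g t) -> RIntC f a b = RIntC g a b.
Proof. intros H. apply RInt_ext. intros; apply H. Qed.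

Lemma RIntC_ext_in (f g : R -> C) a b :
  (forall t, Rmin a b <= t <= Rmax a b -> f t = g t) -> RIntC f a b = RIntC g a b.
Proof. intros H. apply RInt_ext. intros; apply H; lra. Qed.

(** * The Mellin transform of a loop integral *)

Section Mellin.
Variables (G E : C -> C) (gam lr : R) (m : nat) (s : C).
Definition loop_domain (x : R) (t : C) : Prop := x < fst t /\ (gam < fst t \/ snd t <> 0).
Hypothesis HG : forall x, hol (loop_domain x) G.
Hypothesis HE : forall V, hol V E.
Definition rem (t : C) : C := (G t - E t)%C.
Variables (CG CP CT h0 : R).
Hypothesis HCG : 0 <= CG.
Hypothesis HGb : forall t, 1 <= Rabs (snd t) -> Cmod (G t) <= CG * exp (lr * fst t) * Cmod t ^ m.
Hypothesis HCP : 0 <= CP.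
Hypothesis HEb : forall t, Cmod (E t) <= CP * exp (lr * fst t) * (1 + Cmod t) ^ m.
Hypothesis HCT : 0 <= CT.
Hypothesis Hh0 : 1 <= h0.
Hypothesis HTb : forall (h : R) (t : C), h0 <= h -> (Rabs (snd t) = h \/ fst t = h) ->
  Cmod (rem t) <= CT * exp (lr * fst t) * Cmod t ^ m / h ^ S m.
Hypothesis Hs : gam < fst s.

Let sg := fst s.
(** A real part at which [s] lies on the right of the loop, while all the poles of [G] stay
    on its left. *)
Definition mid_re : R := gam + Rmin 1 (sg - gam) / 2.
Lemma mid_re_spec : gam < mid_re /\ mid_re < gam + 1 /\ mid_re < sg.
Proof.
  unfold mid_re. assert (X1 := Rmin_l 1 (sg - gam)). assert (X2 := Rmin_r 1 (sg - gam)).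
  assert (X3 : 0 < Rmin 1 (sg - gam)) by (apply Rmin_pos; unfold sg; lra). repeat split; lra.
Qed.

Definition mellin_kernel (x : R) (t : C) : C := (G t * cpow x (- t))%C.
(** For [F = G] this is the integral of [G t * x^(-t) * x^(s-1)] over [x] from [0] to [r], for
    [Re t < Re s]. *)
Definition quot_kernel (F : C -> C) (r : R) (t : C) : C := (F t * cpow r (s - t) / (s - t))%C.

Lemma cpow_neg_hol V x : hol V (fun t => cpow x (- t)).
Proof. unfold cpow. apply hol_cexp, hol_mult; [apply hol_opp, hol_id|apply hol_const]. Qed.

Lemma hol_mellin_kernel x0 x : hol (loop_domain x0) (mellin_kernel x).
Proof. unfold mellin_kernel. apply hol_mult; [apply HG|apply cpow_neg_hol]. Qed.

Lemma hol_rem x : hol (loop_domain x) rem.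
Proof. unfold rem. apply hol_minus; auto. Qed.

Lemma hol_quot_kernel (W : C -> Prop) F r : (forall t, W t -> (s - t)%C <> 0) -> hol W F -> hol W (quot_kernel F r).
Proof.
  intros Hn HF. unfold quot_kernel, Cdiv. apply hol_mult.
  - apply hol_mult; auto. unfold cpow. apply hol_cexp, hol_mult; [|apply hol_const].
    apply hol_minus; [apply hol_const|apply hol_id].
  - apply hol_inv; auto. apply hol_minus; [apply hol_const|apply hol_id].
Qed.

Lemma Cmod_pair_le u y : Cmod (u, y) <= Rabs u + Rabs y.
Proof. apply (Cmod_le_abs (u, y)). Qed.

(** The rate of decay in [u] is uniform for [x <= r], while the dependence on [x] is kept as the
    explicit factor [(rho / x)^c], needed when [x] tends to [0]. *)
Lemma mellin_kernel_bound (r c : R) : 0 < r -> ln r < lr -> exists C1, 0 <= C1 /\ forall x u y, 0 < x <= r -> u <= c -> Rabs y = 1 ->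
  Cmod (mellin_kernel x (u, y)) <= C1 * exp ((lr - ln x) * c) * exp ((lr - ln r) / 2 * u).
Proof.
  intros Hr Hlr. set (k0 := lr - ln r).
  destruct (poly_exp (k0 / 2) m 1 c) as [Cx [HCx Hx]]; [unfold k0; lra|lra|].
  exists (CG * Cx * exp (- k0 * c)). split.
  { apply Rmult_le_pos; [apply Rmult_le_pos; auto|left; apply exp_pos]. }
  intros x u y Hx0 Hu Hy. unfold mellin_kernel. rewrite Cmod_mult, Cmod_cpow.
  assert (B1 := HGb (u, y)). simpl fst in *; simpl snd in *.
  specialize (B1 ltac:(lra)).
  assert (B2 : Cmod (u, y) ^ m <= (Rabs u + 1) ^ m).
  { apply pow_incr. split; [apply Cmod_ge_0|]. rewrite <- Hy. apply Cmod_pair_le. }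
  assert (Hln : ln x <= ln r) by (apply ln_le; lra).
  (* Since [k0 <= lr - ln x] and [u <= c], the exponent [(lr - ln x) u] is at most
     [(lr - ln x) c + k0 (u - c)]. One half of [k0 u] absorbs the polynomial, the other half is the
     decay. *)
  assert (E1 : exp (lr * u) * exp (- u * ln x) <= exp ((lr - ln x) * c) * exp (- k0 * c) * (exp (k0 / 2 * u) * exp (k0 / 2 * u))).
  { rewrite <- !exp_plus. apply exp_le. unfold k0. nra. }
  assert (P1 := exp_pos (lr * u)). assert (P2 := exp_pos (- u * ln x)).
  apply Rle_trans with (CG * (Rabs u + 1) ^ m * (exp (lr * u) * exp (- u * ln x))).
  { replace (CG * (Rabs u + 1) ^ m * (exp (lr * u) * exp (- u * ln x))) with (CG * exp (lr * u) * (Rabs u + 1) ^ m * exp (- u * ln x)) by ring.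
    apply Rmult_le_compat_r; [lra|]. eapply Rle_trans; [apply B1|]. apply Rmult_le_compat_l; auto. apply Rmult_le_pos; lra. }
  assert (P3 : 0 <= (Rabs u + 1) ^ m) by (apply pow_le; generalize (Rabs_pos u); lra).
  eapply Rle_trans; [apply Rmult_le_compat_l; [apply Rmult_le_pos; auto|apply E1]|].
  assert (B3 := Hx u Hu).
  replace (CG * (Rabs u + 1) ^ m * (exp ((lr - ln x) * c) * exp (- k0 * c) * (exp (k0 / 2 * u) * exp (k0 / 2 * u))))
    with (CG * exp (- k0 * c) * exp ((lr - ln x) * c) * exp (k0 / 2 * u) * ((Rabs u + 1) ^ m * exp (k0 / 2 * u))) by ring.
  replace (CG * Cx * exp (- k0 * c) * exp ((lr - ln x) * c) * exp (k0 / 2 * u))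
    with (CG * exp (- k0 * c) * exp ((lr - ln x) * c) * exp (k0 / 2 * u) * Cx) by ring.
  apply Rmult_le_compat_l; auto.
  repeat apply Rmult_le_pos; auto; left; apply exp_pos.
Qed.

Lemma loop_domain_line x u y : x < u -> y <> 0 -> loop_domain x (u, y).
Proof. intros; split; simpl; auto. Qed.

Lemma mellin_kernel_cont x u y : y <> 0 \/ gam < u -> contC (U := C_UniformSpace) (mellin_kernel x) (u, y).
Proof.
  intros Hy. apply (hol_cont (loop_domain (u - 1))); [apply hol_mellin_kernel|]. split; simpl; [lra|tauto].
Qed.

(** The H function times [2 PI i], with its contour at the abscissa [gam + 1]. *)
Definition Hraw (x : R) : C :=
  Cminus (Cplus
    (@RInt_gen C_R_CompleteNormedModule (fun t => mellin_kernel x (t, -1)) (Rbar_locally m_infty) (at_point (gam + 1)))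
    (RIntC (fun y => Cmult (mellin_kernel x (gam + 1, y)) (0, 1)) (-1) 1))
    (@RInt_gen C_R_CompleteNormedModule (fun t => mellin_kernel x (t, 1)) (Rbar_locally m_infty) (at_point (gam + 1))).

(** The point [s] may have real part at most [gam + 1], so the vertical edge is moved to [mid_re];
    no pole is crossed. Cutting the horizontal rays at [- R0] costs an exponentially small tail. *)
Lemma Hraw_approx (r : R) : 0 < r -> ln r < lr -> exists C2 kap, 0 <= C2 /\ 0 < kap /\
  forall x R0, 0 < x <= r -> - R0 <= mid_re ->
  Cmod (Hraw x - loop (mellin_kernel x) R0 mid_re 1) <= C2 * exp ((lr - ln x) * (gam + 1)) * exp (kap * - R0).
Proof.
  intros Hr Hlr. destruct (mellin_kernel_bound r (gam + 1) Hr Hlr) as [C1 [HC1 HB]].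
  set (kap := (lr - ln r) / 2) in *. assert (Hk : 0 < kap) by (unfold kap; lra).
  destruct mid_re_spec as (S1 & S2 & S3).
  exists (2 * (C1 / kap)), kap. split.
  { apply Rmult_le_pos; [lra|]. apply Rmult_le_pos; auto. left; apply Rinv_0_lt_compat; auto. }
  split; auto. intros x R0 Hx HR.
  set (ex := exp ((lr - ln x) * (gam + 1))) in *.
  assert (Hex : 0 < ex) by apply exp_pos.
  assert (HC' : 0 <= C1 * ex) by (apply Rmult_le_pos; lra).
  assert (L : forall y, Rabs y = 1 -> exists l,
     @RInt_gen C_R_CompleteNormedModule (fun t => mellin_kernel x (t, y)) (Rbar_locally m_infty) (at_point (gam + 1)) = l /\
     Cmod (l - hor_int (mellin_kernel x) y (- R0) (gam + 1)) <= C1 * ex / kap * exp (kap * - R0)).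
  { intros y Hy. assert (Hy0 : y <> 0) by (intros ->; rewrite Rabs_R0 in Hy; lra).
    destruct (improper_exp (fun t => mellin_kernel x (t, y)) (gam + 1) (C1 * ex) kap HC' Hk) as [l [Hl1 Hl2]].
    - intros u Hu. apply contC_hor. apply mellin_kernel_cont; auto.
    - intros u Hu. apply HB; auto.
    - exists l. split; [apply (is_RInt_gen_unique (V := C_R_CompleteNormedModule)); auto|].
      apply Hl2. lra. }
  destruct (L (-1)) as [l1 [E1 B1]]. { rewrite Rabs_left; lra. }
  destruct (L 1) as [l2 [E2 B2]]. { apply Rabs_R1. }
  unfold Hraw. rewrite E1, E2.
  assert (EV : RIntC (fun y => Cmult (mellin_kernel x (gam + 1, y)) (0, 1)) (-1) 1 = Cmult Ci (ver_int (mellin_kernel x) (gam + 1) (- (1)) 1)).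
  { apply is_RIntC_eq. apply is_RIntC_ext with (fun y => Cmult Ci (mellin_kernel x (gam + 1, y))).
    { intros; apply Cmult_comm. }
    apply is_RIntC_scal. unfold ver_int. replace (- (1)) with (-1) by ring. apply contC_ex. intros; apply contC_ver. apply mellin_kernel_cont. right; lra. }
  rewrite EV.
  assert (ES : loop (mellin_kernel x) R0 mid_re 1 = loop (mellin_kernel x) R0 (gam + 1) 1).
  { rewrite (loop_shift (loop_domain (- R0 - 1)) (mellin_kernel x) (hol_mellin_kernel _ x) R0 mid_re (gam + 1) 1); try lra.
    - rewrite (cauchy_rect (loop_domain gam) (mellin_kernel x) mid_re (gam + 1) (- (1)) 1 ((mid_re - gam) / 2)); try lra; [ring|apply hol_mellin_kernel|].
      intros z Hz _. split; [|left]; lra.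
    - intros u Hu. split; apply loop_domain_line; lra. }
  rewrite ES. unfold loop. replace (- (1)) with (-1) in * by ring.
  set (c' := gam + 1) in *.
  replace (l1 + Ci * ver_int (mellin_kernel x) c' (-1) 1 - l2 - (hor_int (mellin_kernel x) (-1) (- R0) c' + Ci * ver_int (mellin_kernel x) c' (-1) 1 - hor_int (mellin_kernel x) 1 (- R0) c'))%C
    with ((l1 - hor_int (mellin_kernel x) (-1) (- R0) c') - (l2 - hor_int (mellin_kernel x) 1 (- R0) c'))%C by ring.
  eapply Rle_trans; [apply Cmod_triangle_sub|].
  replace (2 * (C1 / kap) * ex * exp (kap * - R0)) with (C1 * ex / kap * exp (kap * - R0) + C1 * ex / kap * exp (kap * - R0)) by (field; lra).
  lra.
Qed.

Definition loop_quot (R0 x : R) : C := loop (quot_kernel G x) R0 mid_re 1.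
Lemma edge_mellin (e : R -> C) (al be x : R) : 0 < x ->
  (forall t, Rmin al be <= t <= Rmax al be -> contC e t /\ contC (U := C_UniformSpace) G (e t) /\ (s - e t)%C <> 0) ->
  dC (fun y => RIntC (fun t => quot_kernel G y (e t)) al be) x (cpow x (s - 1) * RIntC (fun t => mellin_kernel x (e t)) al be)%C.
Proof.
  intros Hx He.
  apply dC_ext with (fun y => RIntC (fun t => G (e t) / (s - e t) * cpow y (s - e t))%C al be).
  { intros y. apply RIntC_ext. intros t. unfold quot_kernel, Cdiv. ring. }
  eapply dC_eq; [|apply (param_cpow (fun t => G (e t) / (s - e t))%C (fun t => s - e t)%C); auto].
  - transitivity (RIntC (fun t => cpow x (s - 1) * mellin_kernel x (e t))%C al be).
    + apply RIntC_ext_in. intros t Ht. destruct (He t Ht) as (_ & _ & Hn).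
      assert (Q1 : cpow x (s - e t) = (cpow x s * cpow x (- e t))%C) by apply cpow_plus.
      assert (Q2 : cpow x (s - 1) = (cpow x s * RtoC (/ x))%C) by (unfold Cminus; rewrite cpow_plus, cpow_minus1; auto).
      unfold mellin_kernel. rewrite Q1, Q2. field. auto.
    + apply is_RIntC_eq. apply is_RIntC_scal. apply contC_ex. intros t Ht. destruct (He t Ht) as (H1 & H2 & H3).
      unfold mellin_kernel. apply contC_mult; [apply (contC_compC e G); auto|].
      unfold cpow. apply contC_cexp, contC_mult; [apply contC_opp; auto|apply contC_const].
  - intros t Ht. destruct (He t Ht) as (H1 & H2 & H3).
    apply contC_mult; [apply (contC_compC e G); auto|]. apply contC_inv; auto. apply contC_minus; auto. apply contC_const.
  - intros t Ht. destruct (He t Ht) as (H1 & H2 & H3). apply contC_minus; auto. apply contC_const.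
Qed.

Lemma edge_kernel_cont (e : R -> C) (al be x : R) : 0 < x ->
  (forall t, Rmin al be <= t <= Rmax al be -> contC e t /\ contC (U := C_UniformSpace) G (e t)) ->
  contC (fun y => RIntC (fun t => mellin_kernel y (e t)) al be) x.
Proof.
  intros Hx He. unfold mellin_kernel. eapply dC_contC.
  apply (param_cpow (fun t => G (e t)) (fun t => - e t)%C); auto.
  - intros t Ht. destruct (He t Ht). apply (contC_compC e G); auto.
  - intros t Ht. destruct (He t Ht). apply contC_opp; auto.
Qed.

Lemma G_cont u y : y <> 0 \/ gam < u -> contC (U := C_UniformSpace) G (u, y).
Proof. intros Hy. apply (hol_cont (loop_domain (u - 1))); [apply HG|]. split; simpl; [lra|tauto]. Qed.

Lemma hor_line_cont y t : contC (fun u : R => (u, y) : C) t.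
Proof. split; simpl; [apply continuous_id|apply continuous_const]. Qed.

Lemma ver_line_cont x t : contC (fun y : R => (x, y) : C) t.
Proof. split; simpl; [apply continuous_const|apply continuous_id]. Qed.

Lemma s_sub_neq (u y : R) : u < sg -> (s - (u, y))%C <> 0.
Proof. intros Hu E0. apply (f_equal fst) in E0. simpl in E0. unfold sg in Hu. lra. Qed.

(** Differentiating [x^(s-t) / (s - t)] cancels the denominator. Thus [loop_quot R0] is a primitive
    in [x] of the truncated loop integral times [x^(s-1)], which replaces an exchange of
    integrals. *)
Lemma loop_quot_deriv (R0 x : R) : 0 < x -> - R0 <= mid_re ->
  dC (loop_quot R0) x (cpow x (s - 1) * loop (mellin_kernel x) R0 mid_re 1)%C.
Proof.
  intros Hx HR. destruct mid_re_spec as (S1 & S2 & S3). unfold loop_quot, loop, hor_int, ver_int.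
  assert (Hm : Rmin (- R0) mid_re = - R0 /\ Rmax (- R0) mid_re = mid_re) by (split; [apply Rmin_left|apply Rmax_right]; lra).
  eapply dC_eq; [|apply dC_minus; [apply dC_plus; [apply (edge_mellin (fun u => (u, - (1)))); auto|
      apply dC_scal; apply (edge_mellin (fun y => (mid_re, y))); auto]|apply (edge_mellin (fun u => (u, 1))); auto]].
  - ring.
  - destruct Hm as [-> ->]. intros t Ht. split; [apply hor_line_cont|]. split; [apply G_cont; left; lra|apply s_sub_neq; lra].
  - intros t Ht. split; [apply ver_line_cont|]. split; [apply G_cont; right; lra|apply s_sub_neq; lra].
  - destruct Hm as [-> ->]. intros t Ht. split; [apply hor_line_cont|]. split; [apply G_cont; left; lra|apply s_sub_neq; lra].
Qed.

Lemma loop_kernel_cont (R0 x : R) : 0 < x -> - R0 <= mid_re -> contC (fun y => loop (mellin_kernel y) R0 mid_re 1) x.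
Proof.
  intros Hx HR. destruct mid_re_spec as (S1 & S2 & S3). unfold loop, hor_int, ver_int.
  apply contC_minus; [apply contC_plus|].
  - apply (edge_kernel_cont (fun u => (u, - (1)))); auto. intros t _. split; [apply hor_line_cont|apply G_cont; left; lra].
  - apply contC_mult; [apply contC_const|]. apply (edge_kernel_cont (fun y => (mid_re, y))); auto.
    intros t _. split; [apply ver_line_cont|apply G_cont; right; lra].
  - apply (edge_kernel_cont (fun u => (u, 1))); auto. intros t _. split; [apply hor_line_cont|apply G_cont; left; lra].
Qed.

Lemma loop_quot_FTC (R0 de r : R) : 0 < de <= r -> - R0 <= mid_re ->
  is_RIntC (fun x => cpow x (s - 1) * loop (mellin_kernel x) R0 mid_re 1)%C de r (loop_quot R0 r - loop_quot R0 de)%C.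
Proof.
  intros Hd HR. apply (is_RIntC_FTC (loop_quot R0)); rewrite Rmin_left, Rmax_right by lra.
  - intros x Hx. apply loop_quot_deriv; lra.
  - intros x Hx. apply contC_mult; [|apply loop_kernel_cont; lra].
    eapply dC_contC. apply dC_cpow. lra.
Qed.

Definition cutoff (n : nat) : R := INR n + Rabs mid_re + 1.
Lemma cutoff_c1 n : - cutoff n < mid_re.
Proof. unfold cutoff. generalize (pos_INR n) (Rle_abs (- mid_re)). rewrite Rabs_Ropp. lra. Qed.

(** [filterlim_RInt] asks for uniform convergence on the whole real line. *)
Definition clamp (de r x : R) : R := Rmax de (Rmin x r).
Lemma clamp_in de r x : de <= r -> de <= clamp de r x <= r.
Proof. intros H. unfold clamp. split; [apply Rmax_l|]. apply Rmax_lub; auto. apply Rmin_r. Qed.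

Lemma clamp_id de r x : de <= x <= r -> clamp de r x = x.
Proof. intros H. unfold clamp. rewrite Rmin_left, Rmax_right; lra. Qed.

Lemma mellin_limit (de r : R) : 0 < de <= r -> ln r < lr -> exists I,
  is_RIntC (fun x => Hraw x * cpow x (s - 1))%C de r I /\
  limC (fun n => loop_quot (cutoff n) r - loop_quot (cutoff n) de)%C I.
Proof.
  intros Hd Hlr.
  destruct (Hraw_approx r) as [C2 [kap [HC2 [Hk HA]]]]; [lra|auto|].
  set (M1 := exp (Rabs (sg - 1) * (Rabs (ln de) + Rabs (ln r)))).
  set (M2 := C2 * exp ((Rabs lr + (Rabs (ln de) + Rabs (ln r))) * Rabs (gam + 1))).
  assert (Hln : forall x, de <= x <= r -> Rabs (ln x) <= Rabs (ln de) + Rabs (ln r)).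
  { intros x Hx. assert (ln de <= ln x) by (apply ln_le; lra). assert (ln x <= ln r) by (apply ln_le; lra).
    generalize (Rle_abs (- ln de)) (Rle_abs (ln r)) (Rabs_pos (ln de)) (Rabs_pos (ln r)). rewrite Rabs_Ropp. intros.
    apply Rabs_le. lra. }
  (* On [[de, r]] the logarithm of [x] is bounded, which turns the bound of [Hraw_approx] into one
     that is uniform in [x]. *)
  assert (Unif : forall x n, de <= x <= r -> Cmod (Hraw x * cpow x (s - 1) - cpow x (s - 1) * loop (mellin_kernel x) (cutoff n) mid_re 1) <= M1 * M2 * exp (kap * - cutoff n)).
  { intros x n Hx. replace (Hraw x * cpow x (s - 1) - cpow x (s - 1) * loop (mellin_kernel x) (cutoff n) mid_re 1)%C
      with (cpow x (s - 1) * (Hraw x - loop (mellin_kernel x) (cutoff n) mid_re 1))%C by ring.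
    rewrite Cmod_mult, Cmod_cpow. assert (Hx' := Hln x Hx).
    rewrite Rmult_assoc. apply Rmult_le_compat; [left; apply exp_pos|apply Cmod_ge_0| |].
    - apply exp_le. change (fst (s - 1)%C) with (sg - 1).
      eapply Rle_trans; [apply Rle_abs|]. rewrite Rabs_mult. apply Rmult_le_compat_l; [apply Rabs_pos|auto].
    - eapply Rle_trans; [apply HA; [lra|generalize (cutoff_c1 n); lra]|].
      apply Rmult_le_compat_r; [left; apply exp_pos|]. apply Rmult_le_compat_l; auto. apply exp_le.
      eapply Rle_trans; [apply Rle_abs|]. rewrite Rabs_mult. apply Rmult_le_compat_r; [apply Rabs_pos|].
      unfold Rminus. eapply Rle_trans; [apply Rabs_triang|]. rewrite Rabs_Ropp. lra. }
  assert (Lim0 : is_lim_seq (fun n => M1 * M2 * exp (kap * - cutoff n)) 0).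
  { assert (HM : 0 <= M1 * M2).
    { apply Rmult_le_pos; [left; apply exp_pos|apply Rmult_le_pos; auto; left; apply exp_pos]. }
    apply is_lim_seq_le_le_loc with (fun _ => 0) (fun n => (M1 * M2 / kap) / INR n).
    - exists 1%nat. intros n Hn. assert (HN : 0 < INR n) by (apply lt_0_INR; lia).
      split; [apply Rmult_le_pos; auto; left; apply exp_pos|].
      replace (M1 * M2 / kap / INR n) with (M1 * M2 * / (kap * INR n)) by (field; lra).
      apply Rmult_le_compat_l; auto. replace (kap * - cutoff n) with (- (kap * cutoff n)) by ring. rewrite exp_Ropp.
      apply Rinv_le_contravar; [apply Rmult_lt_0_compat; auto|].
      assert (Y := exp_ineq1_le (kap * cutoff n)).
      assert (INR n <= cutoff n) by (unfold cutoff; generalize (Rabs_pos mid_re); lra). nra.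
    - apply is_lim_seq_const.
    - apply lim_inv_INR. }
  set (fn := fun (n : nat) (x : R) => Cmult (cpow (clamp de r x) (s - 1)) (loop (mellin_kernel (clamp de r x)) (cutoff n) mid_re 1)).
  set (gn := fun x : R => Cmult (Hraw (clamp de r x)) (cpow (clamp de r x) (s - 1))).
  set (hn := fun n : nat => Cminus (loop_quot (cutoff n) r) (loop_quot (cutoff n) de)).
  destruct (filterlim_RInt (U := nat) (V := C_R_CompleteNormedModule) fn de r eventually eventually_filter gn hn)
    as [I [HI1 HI2]].
  - intros n. apply is_RIntC_ext with (fun x => cpow x (s - 1) * loop (mellin_kernel x) (cutoff n) mid_re 1)%C.
    + rewrite Rmin_left, Rmax_right by lra. intros x Hx. unfold fn. rewrite clamp_id; auto.
    + apply loop_quot_FTC; auto. generalize (cutoff_c1 n); lra.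
  - apply (filterlim_locally (U := fct_UniformSpace R C_R_CompleteNormedModule)). intros eps.
    assert (Hev := proj2 (is_lim_seq_spec _ _) Lim0 eps). simpl in Hev.
    apply filter_imp with (2 := Hev). intros n Hn x. unfold fn, gn.
    assert (Hcl := clamp_in de r x ltac:(lra)).
    assert (B := Unif _ n Hcl). rewrite Rminus_0_r in Hn.
    assert (B' : Cmod (cpow (clamp de r x) (s - 1) * loop (mellin_kernel (clamp de r x)) (cutoff n) mid_re 1 - Hraw (clamp de r x) * cpow (clamp de r x) (s - 1)) < eps).
    { rewrite Cmod_sub_sym. eapply Rle_lt_trans; [apply Unif; auto|]. eapply Rle_lt_trans; [apply Rle_abs|apply Hn]. }
    split.
    + eapply Rle_lt_trans; [|apply B']. eapply Rle_trans; [|apply abs_fst_le]. right. reflexivity.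
    + eapply Rle_lt_trans; [|apply B']. eapply Rle_trans; [|apply abs_snd_le]. right. reflexivity.
  - exists I. split.
    + apply is_RIntC_ext with (2 := HI2). rewrite Rmin_left, Rmax_right by lra. intros x Hx. unfold gn. rewrite clamp_id; auto.
    + split.
      * intros P HP. apply (HI1 (fun z => P (fst z))). destruct HP as [ep HP]. exists ep. intros z [Hz _]. apply HP. auto.
      * intros P HP. apply (HI1 (fun z => P (snd z))). destruct HP as [ep HP]. exists ep. intros z [_ Hz]. apply HP. auto.
Qed.

Lemma quot_kernel_eq (x : R) (t : C) : quot_kernel G x t = (mellin_kernel x t * (cpow x s / (s - t)))%C.
Proof.
  unfold quot_kernel, mellin_kernel. assert (Q1 : cpow x (s - t) = (cpow x s * cpow x (- t))%C) by apply cpow_plus.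
  rewrite Q1. unfold Cdiv. ring.
Qed.

Lemma s_sub_ge (u y d : R) : d <= sg - u -> d <= Cmod (s - (u, y)).
Proof.
  intros H. eapply Rle_trans; [apply H|]. eapply Rle_trans; [apply Rle_abs|]. apply (abs_fst_le (s - (u, y))%C).
Qed.

Lemma quot_kernel_cont (F : C -> C) (r u y : R) : contC (U := C_UniformSpace) F (u, y) -> (s - (u, y))%C <> 0 ->
  contC (U := C_UniformSpace) (quot_kernel F r) (u, y).
Proof.
  intros HF Hn. unfold quot_kernel. apply contC_mult; [apply contC_mult; auto|].
  - unfold cpow. apply contC_cexp, contC_mult; [|apply contC_const]. apply contC_minus; [apply contC_const|apply contC_idC].
  - apply contC_inv; auto. apply contC_minus; [apply contC_const|apply contC_idC].
Qed.

Lemma Cmod_Ci_mult z : Cmod (Ci * z) = Cmod z.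
Proof. rewrite Cmod_mult, Cmod_Ci. ring. Qed.

Lemma loop_norm f R0 c h B1 B2 B3 : Cmod (hor_int f (- h) (- R0) c) <= B1 -> Cmod (ver_int f c (- h) h) <= B2 ->
  Cmod (hor_int f h (- R0) c) <= B3 -> Cmod (loop f R0 c h) <= B1 + B2 + B3.
Proof.
  intros H1 H2 H3. unfold loop. eapply Rle_trans; [apply Cmod_triangle_sub|].
  apply Rplus_le_compat; auto. eapply Rle_trans; [apply Cmod_triangle|]. rewrite Cmod_Ci_mult. lra.
Qed.

(** On the loop [Re t <= mid_re < Re s], so [de^(s-t)] is governed by the positive power
    [sg - mid_re] of [de]. The constant must not depend on [R0]. *)
Lemma loop_quot_small : exists C3 de0, 0 <= C3 /\ 0 < de0 /\ forall de R0, 0 < de <= de0 -> - R0 <= mid_re ->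
  Cmod (loop_quot R0 de) <= C3 * exp ((sg - mid_re) * ln de).
Proof.
  destruct mid_re_spec as (S1 & S2 & S3).
  (* Any radius below [rho] would do; this one makes the decay rate of [mellin_kernel_bound] equal
     to [1 / 2]. *)
  set (r0 := exp (lr - 1)). assert (Hr0 : 0 < r0) by apply exp_pos.
  assert (Hl0 : ln r0 = lr - 1) by (unfold r0; apply ln_exp).
  destruct (mellin_kernel_bound r0 mid_re Hr0 ltac:(lra)) as [C1 [HC1 HB]].
  set (d := sg - mid_re). assert (Hd : 0 < d) by (unfold d; lra).
  set (Mv := RInt (fun y => Cmod (G (mid_re, y))) (- (1)) 1).
  assert (HMv : is_RInt (fun y => Cmod (G (mid_re, y))) (- (1)) 1 Mv).
  { apply (RInt_correct (fun y => Cmod (G (mid_re, y)))). apply (ex_RInt_continuous (fun y => Cmod (G (mid_re, y)))).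
    intros y _. apply (continuous_Cmod (fun y => G (mid_re, y))). apply contC_ver. apply G_cont. right; lra. }
  assert (HMv0 : 0 <= Mv).
  { replace 0 with (scal (1 - - (1)) 0) by (unfold scal; simpl; unfold mult; simpl; ring).
    apply (is_RInt_le (fun _ => 0) (fun y => Cmod (G (mid_re, y))) (- (1)) 1); auto; [lra|apply (is_RInt_const (V := R_NormedModule))|].
    intros; apply Cmod_ge_0. }
  set (Kh := C1 * exp (lr * mid_re) * / d / (1 / 2) * exp (1 / 2 * mid_re)).
  exists (Kh + / d * Mv + Kh), r0.
  assert (Hdi : 0 < / d) by (apply Rinv_0_lt_compat; auto).
  assert (HKh : 0 <= Kh).
  { unfold Kh. apply Rmult_le_pos; [|left; apply exp_pos]. apply Rmult_le_pos; [|lra].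
    apply Rmult_le_pos; [|lra]. apply Rmult_le_pos; [auto|left; apply exp_pos]. }
  split. { apply Rplus_le_le_0_compat; auto. apply Rplus_le_le_0_compat; auto. apply Rmult_le_pos; lra. }
  split; auto. intros de R0 Hde HR.
  assert (Hsd : forall u y, u <= mid_re -> / Cmod (s - (u, y)) <= / d).
  { intros u y Hu. apply Rinv_le_contravar; auto. apply s_sub_ge. unfold d; lra. }
  assert (Hor : forall y, Rabs y = 1 -> Cmod (hor_int (quot_kernel G de) y (- R0) mid_re) <= Kh * exp (d * ln de)).
  { intros y Hy. assert (Hy0 : y <> 0) by (intros ->; rewrite Rabs_R0 in Hy; lra).
    unfold hor_int.
    eapply Rle_trans; [apply (RIntC_exp_bound (fun u => quot_kernel G de (u, y)) (C1 * exp ((lr - ln de) * mid_re) * exp (sg * ln de) * / d) (1 / 2)); auto|].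
    - repeat apply Rmult_le_pos; auto; try (left; apply exp_pos). lra.
    - lra.
    - intros u Hu. apply contC_hor. apply quot_kernel_cont; [apply G_cont; auto|apply s_sub_neq; lra].
    - intros u Hu. rewrite quot_kernel_eq, Cmod_mult. unfold Cdiv. rewrite Cmod_mult, Cmod_cpow, Cmod_inv_tot.
      assert (B := HB de u y Hde ltac:(lra) Hy). rewrite Hl0 in B. replace ((lr - (lr - 1)) / 2) with (1 / 2) in B by field.
      replace (C1 * exp ((lr - ln de) * mid_re) * exp (sg * ln de) * / d * exp (1 / 2 * u)) with
        (C1 * exp ((lr - ln de) * mid_re) * exp (1 / 2 * u) * (exp (sg * ln de) * / d)) by ring.
      apply Rmult_le_compat; [apply Cmod_ge_0| |auto|].
      + apply Rmult_le_pos; [left; apply exp_pos|]. left. apply Rinv_0_lt_compat. apply Cmod_gt_0. apply s_sub_neq. lra.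
      + apply Rmult_le_compat_l; [left; apply exp_pos|]. apply Hsd; lra.
    - right. unfold Kh.
      replace (exp ((lr - ln de) * mid_re)) with (exp (lr * mid_re) * exp (- ln de * mid_re)) by (rewrite <- exp_plus; f_equal; ring).
      replace (exp (d * ln de)) with (exp (- ln de * mid_re) * exp (sg * ln de)) by (rewrite <- exp_plus; f_equal; unfold d; ring).
      field. lra. }
  unfold loop_quot. eapply Rle_trans; [apply (loop_norm _ _ _ _ (Kh * exp (d * ln de)) (/ d * Mv * exp (d * ln de)) (Kh * exp (d * ln de)))|].
  - apply Hor. rewrite Rabs_left; lra.
  - unfold ver_int. apply (is_RIntC_bound (fun y => quot_kernel G de (mid_re, y)) (fun y => (exp (d * ln de) * / d) * Cmod (G (mid_re, y))) (- (1)) 1 _ _); [lra| | |].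
    + intros y Hy. unfold quot_kernel, Cdiv. rewrite !Cmod_mult, Cmod_cpow, Cmod_inv_tot.
      change (fst (s - (mid_re, y))%C) with (sg - mid_re). fold d.
      replace (exp (d * ln de) * / d * Cmod (G (mid_re, y))) with (Cmod (G (mid_re, y)) * exp (d * ln de) * / d) by ring.
      apply Rmult_le_compat_l; [|apply Hsd; lra]. apply Rmult_le_pos; [apply Cmod_ge_0|left; apply exp_pos].
    + apply contC_ex. intros y _. apply contC_ver. apply quot_kernel_cont; [apply G_cont; right; lra|apply s_sub_neq; lra].
    + replace (/ d * Mv * exp (d * ln de)) with (scal (exp (d * ln de) * / d) Mv) by (unfold scal; simpl; unfold mult; simpl; ring).
      apply (is_RInt_scal (V := R_NormedModule)). auto.
  - apply Hor. apply Rabs_R1.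
  - right; ring.
Qed.

Lemma rem_bound_strip (t : C) : 1 <= Rabs (snd t) -> Cmod (rem t) <= (CG + CP) * exp (lr * fst t) * (1 + Cmod t) ^ m.
Proof.
  intros Ht. unfold rem. eapply Rle_trans; [apply Cmod_triangle_sub|].
  assert (B1 := HGb t Ht). assert (B2 := HEb t).
  assert (B3 : Cmod t ^ m <= (1 + Cmod t) ^ m) by (apply pow_incr; generalize (Cmod_ge_0 t); lra).
  assert (P := exp_pos (lr * fst t)).
  assert (CG * exp (lr * fst t) * Cmod t ^ m <= CG * exp (lr * fst t) * (1 + Cmod t) ^ m).
  { apply Rmult_le_compat_l; auto. apply Rmult_le_pos; lra. }
  lra.
Qed.

(** Against [r^(s-t)] the growth [rho^v] leaves [e^(v / h)]; one half of the exponent absorbs the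
    polynomial and the other makes the kernel small. It disposes of the left edges of the
    rectangles. *)
Lemma left_small (F : C -> C) (CF Y r h : R) : 0 <= CF -> 0 <= Y -> 0 < r -> 0 < h -> ln r = lr - / h ->
  forall eps, 0 < eps -> exists R1, forall v y, v <= - R1 -> Rabs y <= Y ->
   Cmod (F (v, y)) <= CF * exp (lr * v) * (1 + Cmod (v, y)) ^ m ->
   v < sg /\ Cmod (quot_kernel F r (v, y)) <= eps.
Proof.
  intros HCF HY Hr Hh Hlr eps He.
  destruct (poly_exp (/ h / 2) m (1 + Y) 0) as [Cx [HCx Hx]].
  { apply Rmult_lt_0_compat; [apply Rinv_0_lt_compat; auto|lra]. } { lra. }
  set (K0 := CF * Cx * exp (sg * ln r)).
  assert (HK0 : 0 <= K0) by (unfold K0; apply Rmult_le_pos; [apply Rmult_le_pos; auto|left; apply exp_pos]).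
  (* The three bounds ensure [|s - t| >= 1], [v <= 0] and the smallness of [e^(v / (2 h))],
     respectively. *)
  set (R1 := Rmax (1 - sg) (Rmax 0 (- (2 * h) * ln (eps / (K0 + 1))))).
  exists R1. intros v y HR' Hy HF. assert (HR : R1 <= - v) by lra.
  assert (HR1 : 1 - sg <= - v) by (eapply Rle_trans; [apply Rmax_l|apply HR]).
  assert (HR2 : 0 <= - v) by (eapply Rle_trans; [apply Rmax_l|eapply Rle_trans; [apply Rmax_r|apply HR]]).
  assert (HR3 : - (2 * h) * ln (eps / (K0 + 1)) <= - v) by (eapply Rle_trans; [apply Rmax_r|eapply Rle_trans; [apply Rmax_r|apply HR]]).
  split; [lra|].
  unfold quot_kernel, Cdiv. rewrite !Cmod_mult, Cmod_cpow, Cmod_inv_tot.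
  change (fst (s - (v, y))%C) with (sg - v).
  assert (I1 : / Cmod (s - (v, y)) <= 1).
  { rewrite <- Rinv_1. apply Rinv_le_contravar; [lra|]. apply s_sub_ge. lra. }
  assert (P1 : 0 <= Cmod (F (v, y)) * exp ((sg - v) * ln r)) by (apply Rmult_le_pos; [apply Cmod_ge_0|left; apply exp_pos]).
  apply Rle_trans with (Cmod (F (v, y)) * exp ((sg - v) * ln r)).
  { rewrite <- Rmult_1_r. apply Rmult_le_compat_l; auto. }
  assert (B1 : (1 + Cmod (v, y)) ^ m <= (Rabs (v) + (1 + Y)) ^ m).
  { apply pow_incr. generalize (Cmod_ge_0 (v, y)) (Cmod_pair_le (v) y). lra. }
  assert (B2 := Hx (v) ltac:(lra)).
  apply Rle_trans with (CF * exp (lr * v) * (Rabs (v) + (1 + Y)) ^ m * exp ((sg - v) * ln r)).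
  { apply Rmult_le_compat_r; [left; apply exp_pos|]. eapply Rle_trans; [apply HF|].
    apply Rmult_le_compat_l; auto. apply Rmult_le_pos; auto. left; apply exp_pos. }
  replace (CF * exp (lr * v) * (Rabs (v) + (1 + Y)) ^ m * exp ((sg - v) * ln r)) with
    (CF * exp (sg * ln r) * exp (/ h / 2 * v) * ((Rabs (v) + (1 + Y)) ^ m * exp (/ h / 2 * v))).
  2: { replace (exp ((sg - v) * ln r)) with (exp (sg * ln r) * exp (- v * ln r)) by (rewrite <- exp_plus; f_equal; ring).
       replace (exp (lr * v)) with (exp (v * ln r) * (exp (/ h / 2 * v) * exp (/ h / 2 * v))).
       2: { rewrite <- !exp_plus. f_equal. rewrite Hlr. field. lra. }
       replace (- v * ln r) with (- (v * ln r)) by ring. rewrite exp_Ropp. field. apply Rgt_not_eq, exp_pos. }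
  apply Rle_trans with (CF * exp (sg * ln r) * exp (/ h / 2 * v) * Cx).
  { apply Rmult_le_compat_l; auto. apply Rmult_le_pos; [apply Rmult_le_pos; auto|]; left; apply exp_pos. }
  replace (CF * exp (sg * ln r) * exp (/ h / 2 * v) * Cx) with (K0 * exp (/ h / 2 * v)) by (unfold K0; ring).
  assert (B3 : exp (/ h / 2 * v) <= eps / (K0 + 1)).
  { rewrite <- (exp_ln (eps / (K0 + 1))) by (apply Rdiv_lt_0_compat; lra). apply exp_le.
    apply (Rmult_le_reg_l (2 * h)); [lra|].
    replace (2 * h * (/ h / 2 * v)) with (v) by (field; lra). lra. }
  apply Rle_trans with (K0 * (eps / (K0 + 1))); [apply Rmult_le_compat_l; auto|].
  apply (Rmult_le_reg_r (K0 + 1)); [lra|]. replace (K0 * (eps / (K0 + 1)) * (K0 + 1)) with (K0 * eps) by (field; lra). nra.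
Qed.

Lemma rem_cont (u y : R) : y <> 0 \/ gam < u -> contC (U := C_UniformSpace) rem (u, y).
Proof. intros Hy. apply (hol_cont (loop_domain (u - 1))); [apply hol_rem|]. split; simpl; [lra|tauto]. Qed.

(** With [r = rho e^(-1/h)] the growth [(rho / r)^(Re t) = e^(Re t / h)] stays bounded for
    [Re t <= h]. *)
Lemma big_loop : exists C4 h1, 0 <= C4 /\ 1 <= h1 /\ Cmod s + Rabs mid_re + 2 <= h1 /\
  forall h r R0, h1 <= h -> 0 < r -> ln r = lr - / h -> - R0 <= h ->
  Cmod (loop (quot_kernel rem r) R0 h h) <= C4 / h.
Proof.
  (* To be applied to [u / h], which is at most [1], so that the constant does not depend on [h]. *)
  destruct (poly_exp (1 / 2) m 1 1) as [Cx [HCx Hx]]; [lra|lra|].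
  set (C5 := 2 * CT * exp (Rabs sg * (Rabs lr + 1)) * Cx).
  assert (HC5 : 0 <= C5).
  { unfold C5. repeat apply Rmult_le_pos; auto; try lra. left; apply exp_pos. }
  set (eh := exp (1 / 2)). assert (Heh : 0 < eh) by apply exp_pos.
  assert (Hc1 := Rabs_pos mid_re). assert (Hcs := Cmod_ge_0 s).
  (* [h >= 2 |s|] gives [|s - t| >= h / 2] on the loop. Each of the three edges contributes at most
     [2 C5 eh / h]: a horizontal one because [e^(u / (2 h))] has an integral of at most [2 h eh],
     the vertical one by its length [2 h]. *)
  exists (6 * C5 * eh), (h0 + 2 * Cmod s + Rabs mid_re + 2).
  split; [apply Rmult_le_pos; lra|]. split; [lra|]. split; [lra|].
  intros h r R0 Hh Hr Hlr HR.
  assert (Hhi : 0 < / h <= 1). { split; [apply Rinv_0_lt_compat; lra|]. rewrite <- Rinv_1. apply Rinv_le_contravar; lra. }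
  assert (Hfs := abs_fst_le s). assert (Hss := abs_snd_le s).
  assert (Main : forall u y, u <= h -> (Rabs y = h \/ (u = h /\ Rabs y <= h)) ->
     Cmod (quot_kernel rem r (u, y)) <= C5 / h ^ 2 * exp (/ (2 * h) * u)).
  { intros u y Hu Hy.
    assert (Hyh : Rabs y <= h) by lra.
    assert (B1 := HTb h (u, y) ltac:(lra) ltac:(simpl; tauto)). simpl fst in B1.
    assert (Hth : h <= Cmod (u, y)).
    { destruct Hy as [E1|[E1 _]].
      - rewrite <- E1. apply (abs_snd_le (u, y)).
      - rewrite <- E1. eapply Rle_trans; [apply Rle_abs|]. apply (abs_fst_le (u, y)). }
    assert (Hst : h / 2 <= Cmod (s - (u, y))).
    { rewrite Cmod_sub_sym. unfold Cminus. eapply Rle_trans; [|apply Cmod_triangle_rev]. rewrite Cmod_opp. lra. }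
    unfold quot_kernel, Cdiv. rewrite !Cmod_mult, Cmod_cpow, Cmod_inv_tot.
    change (fst (s - (u, y))%C) with (sg - u).
    assert (I1 : / Cmod (s - (u, y)) <= 2 / h).
    { replace (2 / h) with (/ (h / 2)) by (field; lra). apply Rinv_le_contravar; lra. }
    assert (B2 : Cmod (u, y) ^ m / h ^ m <= (Rabs (u / h) + 1) ^ m).
    { unfold Rdiv. rewrite <- pow_inv, <- Rpow_mult_distr. apply pow_incr. split.
      - apply Rmult_le_pos; [apply Cmod_ge_0|lra].
      - apply Rle_trans with ((Rabs u + Rabs y) * / h).
        + apply Rmult_le_compat_r; [lra|apply Cmod_pair_le].
        + rewrite Rmult_plus_distr_r, Rabs_mult, (Rabs_pos_eq (/ h)) by lra. apply Rplus_le_compat_l.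
          apply (Rmult_le_reg_r h); [lra|]. rewrite Rmult_assoc, Rinv_l by lra. lra. }
    assert (Huh : u / h <= 1). { apply (Rmult_le_reg_r h); [lra|]. replace (u / h * h) with u by (field; lra). lra. }
    assert (B3 := Hx (u / h) Huh).
    assert (B4 : exp (sg * ln r) <= exp (Rabs sg * (Rabs lr + 1))).
    { apply exp_le. eapply Rle_trans; [apply Rle_abs|]. rewrite Rabs_mult. apply Rmult_le_compat_l; [apply Rabs_pos|].
      rewrite Hlr. unfold Rminus. eapply Rle_trans; [apply Rabs_triang|]. rewrite Rabs_Ropp, (Rabs_pos_eq (/ h)) by lra. lra. }
    assert (Ph : 0 < h ^ m) by (apply pow_lt; lra).
    assert (P0 := exp_pos (sg * ln r)). assert (P1 := exp_pos (/ (2 * h) * u)). assert (P2 := exp_pos (lr * u)).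
    assert (Pq : 0 <= (Rabs (u / h) + 1) ^ m) by (apply pow_le; generalize (Rabs_pos (u / h)); lra).
    assert (Step1 : Cmod (rem (u, y)) * exp ((sg - u) * ln r) <=
        CT * / h * exp (sg * ln r) * exp (/ (2 * h) * u) * ((Rabs (u / h) + 1) ^ m * exp (1 / 2 * (u / h)))).
    { replace (exp ((sg - u) * ln r)) with (exp (sg * ln r) * exp (- (u * ln r))) by (rewrite <- exp_plus; f_equal; ring).
      apply Rle_trans with (CT * exp (lr * u) * Cmod (u, y) ^ m / h ^ S m * (exp (sg * ln r) * exp (- (u * ln r)))).
      - apply Rmult_le_compat_r; auto. left; apply Rmult_lt_0_compat; apply exp_pos.
      - assert (Ee : exp (lr * u) * exp (- (u * ln r)) = exp (/ (2 * h) * u) * exp (1 / 2 * (u / h))).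
        { rewrite <- !exp_plus. f_equal. rewrite Hlr. field. lra. }
        replace (CT * exp (lr * u) * Cmod (u, y) ^ m / h ^ S m * (exp (sg * ln r) * exp (- (u * ln r)))) with
          (CT * / h * exp (sg * ln r) * (exp (lr * u) * exp (- (u * ln r))) * (Cmod (u, y) ^ m / h ^ m)) by (simpl; field; split; lra).
        rewrite Ee.
        replace (CT * / h * exp (sg * ln r) * exp (/ (2 * h) * u) * ((Rabs (u / h) + 1) ^ m * exp (1 / 2 * (u / h)))) with
          (CT * / h * exp (sg * ln r) * (exp (/ (2 * h) * u) * exp (1 / 2 * (u / h))) * (Rabs (u / h) + 1) ^ m) by ring.
        apply Rmult_le_compat_l; auto.
        repeat apply Rmult_le_pos; try lra; try (left; apply exp_pos). }
    apply Rle_trans with (CT * / h * exp (sg * ln r) * exp (/ (2 * h) * u) * Cx * (2 / h)).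
    - apply Rmult_le_compat; auto.
      + apply Rmult_le_pos; [apply Cmod_ge_0|left; apply exp_pos].
      + left. apply Rinv_0_lt_compat. lra.
      + eapply Rle_trans; [apply Step1|]. apply Rmult_le_compat_l; auto.
        repeat apply Rmult_le_pos; try lra; try (left; apply exp_pos).
    - unfold C5.
      replace (2 * CT * exp (Rabs sg * (Rabs lr + 1)) * Cx / h ^ 2 * exp (/ (2 * h) * u)) with
        (CT * / h * exp (/ (2 * h) * u) * Cx * (2 / h) * exp (Rabs sg * (Rabs lr + 1))) by (field; lra).
      replace (CT * / h * exp (sg * ln r) * exp (/ (2 * h) * u) * Cx * (2 / h)) with
        (CT * / h * exp (/ (2 * h) * u) * Cx * (2 / h) * exp (sg * ln r)) by ring.
      apply Rmult_le_compat_l; auto.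
      assert (0 <= 2 / h) by (unfold Rdiv; lra).
      repeat apply Rmult_le_pos; try lra; try (left; apply exp_pos). }
  assert (Hc : 0 <= C5 / h ^ 2) by (apply Rmult_le_pos; auto; left; apply Rinv_0_lt_compat, pow_lt; lra).
  assert (Hk : 0 < / (2 * h)) by (apply Rinv_0_lt_compat; lra).
  assert (Heq : exp (/ (2 * h) * h) = eh) by (unfold eh; f_equal; field; lra).
  assert (Hns : forall u y, Rabs y = h -> (s - (u, y))%C <> 0).
  { intros u y Hy E0. apply (f_equal snd) in E0. simpl in E0.
    assert (y = snd s) by lra. subst y. lra. }
  assert (Hor : forall y, Rabs y = h -> Cmod (hor_int (quot_kernel rem r) y (- R0) h) <= 2 * C5 * eh / h).
  { intros y Hy. assert (Hy0 : y <> 0) by (intros ->; rewrite Rabs_R0 in Hy; lra).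
    unfold hor_int. eapply Rle_trans; [apply (RIntC_exp_bound (fun u => quot_kernel rem r (u, y)) (C5 / h ^ 2) (/ (2 * h))); auto|].
    - intros u Hu. apply contC_hor. apply quot_kernel_cont; [apply rem_cont; auto|auto].
    - intros u Hu. apply Main; [lra|auto].
    - rewrite Heq. right. field. lra. }
  eapply Rle_trans; [apply (loop_norm _ _ _ _ (2 * C5 * eh / h) (2 * C5 * eh / h) (2 * C5 * eh / h))|].
  - apply Hor. rewrite Rabs_Ropp, Rabs_pos_eq; lra.
  - unfold ver_int. eapply Rle_trans; [apply (RIntC_const_bound (fun y => quot_kernel rem r (h, y)) (C5 / h ^ 2 * eh)); [lra| |]|].
    + intros y Hy. apply contC_ver. apply quot_kernel_cont.
      * apply rem_cont. right. destruct mid_re_spec as (S1 & S2 & S3). generalize (Rle_abs mid_re). lra.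
      * intros E0. apply (f_equal fst) in E0. simpl in E0. generalize (Rle_abs (fst s)). lra.
    + intros y Hy. rewrite <- Heq. apply Main; [lra|]. right. split; auto. apply Rabs_le; lra.
    + right. field. lra.
  - apply Hor. rewrite Rabs_pos_eq; lra.
  - right. field. lra.
Qed.

Lemma loop_quot_main : exists C4 h1, 0 <= C4 /\ 1 <= h1 /\ forall h r, h1 <= h -> 0 < r -> ln r = lr - / h ->
  forall eps, 0 < eps -> exists R1, forall R0, R1 <= R0 ->
  Cmod (loop_quot R0 r - RtoC (2 * PI) * Ci * rem s) <= C4 / h + eps.
Proof.
  destruct big_loop as [C4 [h1 [HC4 [Hh1 [Hh1s HL]]]]].
  destruct mid_re_spec as (S1 & S2 & S3).
  exists C4, h1. split; auto. split; auto. intros h r Hh Hr Hlr eps He.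
  assert (Hfs := abs_fst_le s). assert (Hss := abs_snd_le s).
  assert (Hc1 := Rle_abs mid_re). assert (Hc2 := Rabs_pos mid_re). assert (Hcs := Cmod_ge_0 s).
  assert (Hfs2 := Rle_abs (fst s)). assert (Hss2 : - h < snd s < h).
  { assert (X := Rabs_def2 (snd s) h ltac:(lra)). lra. }
  assert (Hh0' : 0 < h) by lra.
  destruct (left_small E CP 1 r h HCP ltac:(lra) Hr Hh0' Hlr (eps / 4) ltac:(lra)) as [RE HRE].
  (* The division by [h] compensates for the length of the left edge pieces, which is at most [h]
     each. *)
  destruct (left_small rem (CG + CP) h r h ltac:(lra) ltac:(lra) Hr Hh0' Hlr (eps / (4 * h))) as [RT HRT].
  { apply Rdiv_lt_0_compat; lra. }
  exists (Rmax (Rmax RE RT) (1 + Rabs mid_re)). intros R0 HR.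
  assert (HR1 : RE <= R0) by (eapply Rle_trans; [apply Rmax_l|eapply Rle_trans; [apply Rmax_l|apply HR]]).
  assert (HR2 : RT <= R0) by (eapply Rle_trans; [apply Rmax_r|eapply Rle_trans; [apply Rmax_l|apply HR]]).
  assert (HR3 : 1 + Rabs mid_re <= R0) by (eapply Rle_trans; [apply Rmax_r|apply HR]).
  assert (Hc3 := Rle_abs (- mid_re)). rewrite Rabs_Ropp in Hc3.
  set (fT := quot_kernel rem r). set (fE := quot_kernel E r).
  set (V := fun t => loop_domain (- R0 - 1) t /\ (s - t)%C <> 0).
  assert (HfT : hol V fT).
  { apply hol_quot_kernel; [intros t [_ H]; auto|]. apply hol_subset with (loop_domain (- R0 - 1)); [intros t [H _]; auto|apply hol_rem]. }
  assert (HfE : hol (fun t => fst t < sg) fE).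
  { apply hol_quot_kernel; auto. intros t Ht E0. apply (f_equal fst) in E0. simpl in E0. unfold sg in Ht. lra. }
  assert (EK : loop_quot R0 r = (loop fT R0 mid_re 1 + loop fE R0 mid_re 1)%C).
  { assert (Hadd : forall (e : R -> C) al be, (forall t, Rmin al be <= t <= Rmax al be ->
        contC (fun t => fT (e t)) t /\ contC (fun t => fE (e t)) t) ->
        RIntC (fun t => quot_kernel G r (e t)) al be = Cplus (RIntC (fun t => fT (e t)) al be) (RIntC (fun t => fE (e t)) al be)).
    { intros e al be Hc. apply is_RIntC_eq.
      apply is_RIntC_ext with (fun t => Cplus (fT (e t)) (fE (e t))).
      - intros t _. unfold fT, fE, quot_kernel, rem, Cdiv. ring.
      - apply (is_RIntC_plus (fun t => fT (e t)) (fun t => fE (e t)));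
        [apply (contC_ex (fun t => fT (e t)))|apply (contC_ex (fun t => fE (e t)))]; intros t Ht;
        destruct (Hc t Ht); assumption. }
    assert (HcE : forall u y, u <= mid_re -> contC (U := C_UniformSpace) fE (u, y)).
    { intros u y Hu. apply (hol_cont _ _ _ HfE). simpl; lra. }
    assert (HcT : forall u y, u <= mid_re -> y <> 0 \/ gam < u -> contC (U := C_UniformSpace) fT (u, y)).
    { intros u y Hu Hy. apply quot_kernel_cont; [apply rem_cont; auto|apply s_sub_neq; lra]. }
    unfold loop_quot, loop, hor_int, ver_int.
    rewrite (Hadd (fun u => (u, - (1)))), (Hadd (fun y => (mid_re, y))), (Hadd (fun u => (u, 1))).
    - ring.
    - intros t Ht. rewrite Rmin_left, Rmax_right in Ht by lra. split; apply contC_hor; [apply HcT|apply HcE]; lra.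
    - intros t Ht. split; apply contC_ver; [apply HcT|apply HcE]; lra.
    - intros t Ht. rewrite Rmin_left, Rmax_right in Ht by lra. split; apply contC_hor; [apply HcT|apply HcE]; lra. }
  (* The kernel of [E] has no singularity left of [s], not even on the real axis, so the loop can be
     closed by its left edge and only that edge remains. *)
  assert (EE : loop fE R0 mid_re 1 = (Ci * ver_int fE (- R0) (- (1)) 1)%C).
  { assert (X := cauchy_rect _ fE (- R0) mid_re (- (1)) 1 ((sg - mid_re) / 2) HfE ltac:(lra) ltac:(lra) ltac:(lra)).
    rewrite rect_int_eq in X. unfold loop.
    assert (X0 : (hor_int fE (- (1)) (- R0) mid_re + Ci * ver_int fE mid_re (- (1)) 1 - hor_int fE 1 (- R0) mid_re - Ci * ver_int fE (- R0) (- (1)) 1)%C = 0).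
    { apply X. intros z Hz _. lra. }
    replace (hor_int fE (- (1)) (- R0) mid_re + Ci * ver_int fE mid_re (- (1)) 1 - hor_int fE 1 (- R0) mid_re)%C
      with ((hor_int fE (- (1)) (- R0) mid_re + Ci * ver_int fE mid_re (- (1)) 1 - hor_int fE 1 (- R0) mid_re - Ci * ver_int fE (- R0) (- (1)) 1) + Ci * ver_int fE (- R0) (- (1)) 1)%C by ring.
    rewrite X0. ring. }
  assert (HVu : forall u y, - R0 <= u -> y <> 0 -> u < sg \/ y <> snd s -> V (u, y)).
  { intros u y Hu Hy Hn. split; [split; simpl; [lra|auto]|].
    intros E0. assert (E1 := f_equal fst E0). assert (E2 := f_equal snd E0). simpl in E1, E2. unfold sg in Hn. lra. }
  assert (M1 := loop_widen V fT HfT R0 mid_re 1 h ltac:(lra) ltac:(lra)).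
  assert (M1' : loop fT R0 mid_re h = (loop fT R0 mid_re 1 + rect_int fT (- R0) mid_re 1 h + rect_int fT (- R0) mid_re (- h) (- (1))
     + Ci * ver_int fT (- R0) 1 h + Ci * ver_int fT (- R0) (- h) (- (1)))%C).
  { apply M1. intros y Hy. split; [split; simpl; [lra|left; lra]|apply s_sub_neq; lra]. }
  assert (M2 := loop_shift V fT HfT R0 mid_re h h ltac:(lra) ltac:(lra) ltac:(lra)).
  assert (M2' : loop fT R0 h h = (loop fT R0 mid_re h + rect_int fT mid_re h (- h) h)%C).
  { apply M2. intros u Hu. split; apply HVu; lra. }
  (* A margin for Cauchy's theorem that keeps the rectangles off the real axis and to the left of
     [s]. *)
  set (ee := Rmin (1 / 2) ((sg - mid_re) / 2)).
  assert (Hee : 0 < ee) by (apply Rmin_pos; lra).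
  assert (Hee1 : ee <= 1 / 2) by apply Rmin_l. assert (Hee2 : ee <= (sg - mid_re) / 2) by apply Rmin_r.
  assert (RU : rect_int fT (- R0) mid_re 1 h = 0).
  { apply (cauchy_rect V fT (- R0) mid_re 1 h ee HfT Hee); try lra.
    intros [zx zy] Hz1 Hz2. simpl in Hz1, Hz2. split; [split; simpl; [lra|right; lra]|apply s_sub_neq; lra]. }
  assert (RL : rect_int fT (- R0) mid_re (- h) (- (1)) = 0).
  { apply (cauchy_rect V fT (- R0) mid_re (- h) (- (1)) ee HfT Hee); try lra.
    intros [zx zy] Hz1 Hz2. simpl in Hz1, Hz2. split; [split; simpl; [lra|right; lra]|apply s_sub_neq; lra]. }
  (* The only rectangle that contains [s]. The minus sign comes from
     [1 / (s - t) = - 1 / (t - s)]. *)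
  assert (RR : rect_int fT mid_re h (- h) h = (- (RtoC (2 * PI) * Ci * rem s))%C).
  { assert (X := cauchy_formula (loop_domain gam) (fun t => - (rem t * cpow r (s - t)))%C mid_re h (- h) h ((mid_re - gam) / 2) s).
    assert (E0 : rect_int fT mid_re h (- h) h = rect_int (fun t => (- (rem t * cpow r (s - t))) / (t - s))%C mid_re h (- h) h).
    { assert (Q : forall t, fT t = ((- (rem t * cpow r (s - t))) / (t - s))%C).
      { intros t. unfold fT, quot_kernel, Cdiv. replace (t - s)%C with ((- (1)) * (s - t))%C by ring.
        rewrite Cinv_mult_tot. replace (/ - (1))%C with (- (1))%C by (apply C_ext; simpl; field). ring. }
      unfold rect_int. rewrite !(RIntC_ext (fun x => fT (x, _)) _ _ _ (fun x => Q (x, _))).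
      rewrite !(RIntC_ext (fun y => fT (_, y)) _ _ _ (fun y => Q (_, y))). reflexivity. }
    rewrite E0, X; try lra.
    - replace (s - s)%C with (RtoC 0) by ring. unfold cpow. rewrite Cmult_0_l, cexp_0. ring.
    - apply hol_opp, hol_mult; [apply hol_rem|]. unfold cpow. apply hol_cexp, hol_mult; [|apply hol_const].
      apply hol_minus; [apply hol_const|apply hol_id].
    - intros z Hz1 Hz2. split; [|left]; lra.
    - fold sg. unfold sg in *. lra. }
  assert (Fin : (loop_quot R0 r - RtoC (2 * PI) * Ci * rem s = loop fT R0 h h - Ci * ver_int fT (- R0) 1 h - Ci * ver_int fT (- R0) (- h) (- (1)) + Ci * ver_int fE (- R0) (- (1)) 1)%C).
  { rewrite EK, EE, M2', M1', RU, RL, RR. ring. }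
  rewrite Fin.
  assert (BL := HL h r R0 Hh Hr Hlr ltac:(lra)). fold fT in BL.
  assert (Hh1' : 1 <= h) by lra.
  assert (BT : forall a0 b0, a0 <= b0 -> (forall y, a0 <= y <= b0 -> 1 <= Rabs y <= h) -> Cmod (ver_int fT (- R0) a0 b0) <= eps / (4 * h) * (b0 - a0)).
  { intros a0 b0 Hab Hy. unfold ver_int. apply RIntC_const_bound; auto.
    - intros y Hy1. specialize (Hy y Hy1). apply contC_ver. apply quot_kernel_cont; [apply rem_cont; left|apply s_sub_neq; lra].
      intros ->. rewrite Rabs_R0 in Hy. lra.
    - intros y Hy1. specialize (Hy y Hy1). apply HRT; [lra|lra|]. apply rem_bound_strip. simpl. lra. }
  assert (B1 : Cmod (ver_int fT (- R0) 1 h) <= eps / 4).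
  { eapply Rle_trans; [apply BT; [lra|]|].
    - intros y Hy. rewrite Rabs_pos_eq; lra.
    - apply Rle_trans with (eps / (4 * h) * h); [|right; field; lra].
      apply Rmult_le_compat_l; [left; apply Rdiv_lt_0_compat; lra|lra]. }
  assert (B2 : Cmod (ver_int fT (- R0) (- h) (- (1))) <= eps / 4).
  { eapply Rle_trans; [apply BT; [lra|]|].
    - intros y Hy. rewrite Rabs_left; lra.
    - apply Rle_trans with (eps / (4 * h) * h); [|right; field; lra].
      apply Rmult_le_compat_l; [left; apply Rdiv_lt_0_compat; lra|lra]. }
  assert (B3 : Cmod (ver_int fE (- R0) (- (1)) 1) <= eps / 4 * (1 - - (1))).
  { unfold ver_int. apply RIntC_const_bound; [lra| |].
    - intros y Hy. apply contC_ver. apply (hol_cont _ _ _ HfE). simpl. lra.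
    - intros y Hy. apply HRE; [lra|apply Rabs_le; lra|]. apply HEb. }
  eapply Rle_trans; [apply Cmod_triangle|]. rewrite Cmod_Ci_mult.
  assert (B4 := Cmod_triangle_sub (loop fT R0 h h - Ci * ver_int fT (- R0) 1 h) (Ci * ver_int fT (- R0) (- h) (- (1)))).
  assert (B5 := Cmod_triangle_sub (loop fT R0 h h) (Ci * ver_int fT (- R0) 1 h)).
  rewrite Cmod_Ci_mult in B4, B5. lra.
Qed.

(** Convergence along pairs of end points asks for estimates with [de] and [r] independent of each
    other: [de] enters only through [loop_quot_small], and [r] only through [h]. *)
Theorem mellin_main :
  @is_RInt_gen C_R_NormedModule
    (fun x => Cmult (Cmult (Cinv (Cmult (RtoC (2 * PI)) (0, 1))) (Hraw x)) (cpow x (Cminus s (RtoC 1))))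
    (at_right 0) (at_left (exp lr)) (rem s).
Proof.
  destruct loop_quot_main as [C4 [h1 [HC4 [Hh1 HM]]]].
  destruct loop_quot_small as [C3 [de0 [HC3 [Hde0 HS]]]].
  destruct mid_re_spec as (S1 & S2 & S3).
  assert (HPI := PI_RGT_0).
  set (k := Cinv (Cmult (RtoC (2 * PI)) (0, 1))).
  assert (Hn : Cmult (RtoC (2 * PI)) (0, 1) <> 0).
  { intros E0. apply (f_equal snd) in E0. simpl in E0. lra. }
  assert (Hk : Cmod k <= 1).
  { unfold k. rewrite Cmod_inv_tot, Cmod_mult, Cmod_R, Rabs_pos_eq by lra. change (0, 1) with Ci. rewrite Cmod_Ci, Rmult_1_r.
    rewrite <- Rinv_1. apply Rinv_le_contravar; [lra|]. generalize PI2_3_2. unfold PI2. lra. }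
  apply (filterlimi_locally (U := C_R_NormedModule)). intros eps. assert (He := cond_pos eps).
  (* So that [C4 / h <= eps / 4] for all [h >= H]. *)
  set (H := h1 + 4 * C4 / eps).
  assert (HH : h1 <= H). { unfold H. assert (0 <= 4 * C4 / eps) by (apply Rmult_le_pos; [lra|left; apply Rinv_0_lt_compat; auto]). lra. }
  assert (HHi : 0 < / H) by (apply Rinv_0_lt_compat; lra).
  set (r1 := exp (lr - / H)).
  (* The bounds put [de] in the range of [loop_quot_small], below [r], and so close to [0] that
     [C3 * de^(sg - mid_re) <= eps / 4]. *)
  set (de1 := Rmin (Rmin de0 r1) (exp (ln (eps / (4 * (C3 + 1))) / (sg - mid_re)))).
  assert (Hr1 : 0 < r1) by apply exp_pos.
  assert (Hde1 : 0 < de1) by (apply Rmin_pos; [apply Rmin_pos; auto|apply exp_pos]).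
  apply (Filter_prod _ _ _ (fun x => 0 < x < de1) (fun x => r1 < x < exp lr)).
  - exists (mkposreal _ Hde1). intros y Hy Hy0. change (Rabs (y - 0) < de1) in Hy. rewrite Rminus_0_r in Hy.
    apply Rabs_def2 in Hy. lra.
  - assert (Hp : 0 < exp lr - r1).
    { assert (r1 < exp lr) by (unfold r1; apply exp_increasing; lra). lra. }
    exists (mkposreal _ Hp). intros y Hy Hy0. change (Rabs (y - exp lr) < exp lr - r1) in Hy. apply Rabs_def2 in Hy. lra.
  - intros de r Hde Hr. simpl.
    assert (D1 : de1 <= de0) by (eapply Rle_trans; [apply Rmin_l|apply Rmin_l]).
    assert (D2 : de1 <= r1) by (eapply Rle_trans; [apply Rmin_l|apply Rmin_r]).
    assert (D3 : de1 <= exp (ln (eps / (4 * (C3 + 1))) / (sg - mid_re))) by apply Rmin_r.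
    assert (L1 : ln r < lr). { rewrite <- (ln_exp lr). apply ln_increasing; lra. }
    assert (L2 : lr - / H < ln r). { rewrite <- (ln_exp (lr - / H)). apply ln_increasing; auto. fold r1. lra. }
    destruct (mellin_limit de r ltac:(lra) L1) as [I [HI HL]].
    (* The solution of [r = rho e^(-1/h)]; it exceeds [H] as soon as [r > r1]. *)
    set (h := / (lr - ln r)).
    assert (Hhh : H <= h).
    { unfold h. rewrite <- (Rinv_inv H). apply Rinv_le_contravar; lra. }
    assert (Hlr : ln r = lr - / h) by (unfold h; rewrite Rinv_inv; ring).
    exists (k * I)%C. split.
    + apply is_RIntC_ext with (fun x => k * (Hraw x * cpow x (s - 1)))%C.
      { intros x _. fold k. ring. }
      apply is_RIntC_scal. auto.
    + assert (B1 : C4 / h <= eps / 4).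
      { apply Rle_trans with (C4 / H).
        - apply Rmult_le_compat_l; auto. apply Rinv_le_contravar; lra.
        - apply (Rmult_le_reg_r H); [lra|]. replace (C4 / H * H) with C4 by (field; lra).
          unfold H. replace (eps / 4 * (h1 + 4 * C4 / eps)) with (eps / 4 * h1 + C4) by (field; lra). nra. }
      assert (B2 : C3 * exp ((sg - mid_re) * ln de) <= eps / 4).
      { assert (X : exp ((sg - mid_re) * ln de) <= eps / (4 * (C3 + 1))).
        { rewrite <- (exp_ln (eps / (4 * (C3 + 1)))) by (apply Rdiv_lt_0_compat; lra). apply exp_le.
          assert (Y : ln de <= ln (eps / (4 * (C3 + 1))) / (sg - mid_re)).
          { rewrite <- (ln_exp (ln (eps / (4 * (C3 + 1))) / (sg - mid_re))). apply ln_le; lra. }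
          apply (Rmult_le_compat_l (sg - mid_re)) in Y; [|lra].
          eapply Rle_trans; [apply Y|]. right. field. lra. }
        apply Rle_trans with (C3 * (eps / (4 * (C3 + 1)))); [apply Rmult_le_compat_l; auto|].
        apply (Rmult_le_reg_r (4 * (C3 + 1))); [lra|].
        replace (C3 * (eps / (4 * (C3 + 1))) * (4 * (C3 + 1))) with (C3 * eps) by (field; lra). nra. }
      destruct (HM h r ltac:(lra) ltac:(lra) Hlr (eps / 4) ltac:(lra)) as [R1 HR1].
      assert (B3 : Cmod (I - RtoC (2 * PI) * Ci * rem s) <= 3 * eps / 4).
      { apply (limC_bound _ _ _ (limC_minus _ _ _ _ HL (limC_const (RtoC (2 * PI) * Ci * rem s)%C))).
        destruct (nfloor_ex (Rabs R1)) as [N [_ HN]]; [apply Rabs_pos|].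
        exists (S N). intros n Hn'.
        assert (cutoff n >= R1).
        { apply le_INR in Hn'. rewrite S_INR in Hn'. unfold cutoff. generalize (Rle_abs R1) (Rabs_pos mid_re). lra. }
        replace (loop_quot (cutoff n) r - loop_quot (cutoff n) de - RtoC (2 * PI) * Ci * rem s)%C with
          ((loop_quot (cutoff n) r - RtoC (2 * PI) * Ci * rem s) - loop_quot (cutoff n) de)%C by ring.
        eapply Rle_trans; [apply Cmod_triangle_sub|].
        assert (X1 := HR1 (cutoff n) ltac:(lra)). assert (X2 := HS de (cutoff n) ltac:(lra) ltac:(generalize (cutoff_c1 n); lra)). lra. }
      assert (B4 : Cmod (k * I - rem s) < eps).
      { replace (k * I - rem s)%C with (k * (I - RtoC (2 * PI) * Ci * rem s))%C.
        - rewrite Cmod_mult. generalize (Cmod_ge_0 k) (Cmod_ge_0 (I - RtoC (2 * PI) * Ci * rem s)). intros. nra.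
        - unfold k. change (0, 1) with Ci. change (0, 1) with Ci in Hn.
          replace (/ (RtoC (2 * PI) * Ci) * (I - RtoC (2 * PI) * Ci * rem s))%C with
            (/ (RtoC (2 * PI) * Ci) * I - (/ (RtoC (2 * PI) * Ci) * (RtoC (2 * PI) * Ci)) * rem s)%C by ring.
          rewrite Cinv_l by auto. ring. }
      split.
      * eapply Rle_lt_trans; [|apply B4]. eapply Rle_trans; [|apply abs_fst_le]. right. reflexivity.
      * eapply Rle_lt_trans; [|apply B4]. eapply Rle_trans; [|apply abs_snd_le]. right. reflexivity.
Qed.
End Mellin.

Theorem theorem2 (p q : nat) (A a B b : nat -> R) (m : nat) :
  (1 <= p)%nat -> (1 <= q)%nat ->
  (forall k, (k < p)%nat -> 0 < A k) ->
  (forall j, (j < q)%nat -> 0 < B j) ->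
  DeltaH p q A B = 0 ->
  muH p q a b = - INR m ->
  forall s : C, gammaH p A a < Re s ->
  @is_RInt_gen C_R_NormedModule
    (fun x => Cmult (Hfox p q A a B b x) (cpow x (Cminus s (RtoC 1))))
    (at_right 0) (at_left (rhoH p q A B))
    (Cminus (GH p q A a B b s)
       (Cmult (Cmult (RtoC (nuH p q A a B b)) (cpow (rhoH p q A B) s))
          (csum (S m) (fun k => Cmult (RtoC (lcoef p q A a B b (m - k))) (Cpow s k))))).
Proof.
  intros _ _ HA HB HD Hmu s Hs.
  destruct (GH_bound p q A a B b m HA HB HD Hmu) as [CG [HCG HGb]].
  destruct (GH_rem_bound p q A a B b m HA HB HD Hmu) as [CT [h0 [HCT [Hh0 HTb]]]].
  destruct (GH_main_bound p q A a B b m) as [CP [HCP HEb]].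
  assert (M := mellin_main (GH p q A a B b) (GH_main p q A a B b m) (gammaH p A a) (lnrho p q A B) m s
    (hol_GH p q A a B b HA HB) (hol_GH_main p q A a B b m) CG CP CT h0 HCG HGb HCP HEb HCT Hh0 HTb Hs).
  rewrite <- rho_exp in M. exact M.
Qed.
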